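(* Let $\{a_i^{\pm}\}_{i\ge 1},\{b_i^{\pm}\}_{i\ge1},c^{\pm}$ be parameters satisfying the standing parameter assumption in the context, and let $\underline a,\underline b,\Phi_{a,b,c},K^1_{a,b,c},K^2_{a,b,c},K^3_{a,b,c},K_{a,b,c}$ be as defined there. For each $t_1,t_2,x_1,x_2\in\mathbb R$ the double integral in the definition of $K^3_{a,b,c}(t_1,x_1;t_2,x_2)$ is convergent. The value of $K_{a,b,c}(t_1,x_1;t_2,x_2)$ does not depend on the choice of $\alpha,\beta\in\mathbb R$ as long as $\alpha+t_1<\underline a$ and $\beta+t_2>\underline b$. Moreover, for each fixed $t_1,t_2\in\mathbb R$ the function $(x_1,x_2)\mapsto K_{a,b,c}(t_1,x_1;t_2,x_2)$ is continuous on $\mathbb R^2$.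
   Context: Parameter assumption: $\{a_i^+\}_{i\ge1},\{a_i^-\}_{i\ge1},\{b_i^+\}_{i\ge1},\{b_i^-\}_{i\ge1}$ are sequences of non-negative reals with $\sum_{i\ge1}(a_i^++a_i^-+b_i^++b_i^-)<\infty$ and $a_i^\pm\ge a_{i+1}^\pm$, $b_i^\pm\ge b_{i+1}^\pm$ for all $i\ge1$; $c^+,c^-\ge0$. Define $\underline a=0$ if $a_1^-+b_1^-+c^->0$; $\underline a=\infty$ if $a_1^-+b_1^-+c^-=0$ and $a_1^+=0$; $\underline a=1/a_1^+$ if $a_1^-+b_1^-+c^-=0$ and $a_1^+>0$. Define $\underline b=0$ if $a_1^-+b_1^-+c^->0$; $\underline b=-\infty$ if $a_1^-+b_1^-+c^-=0$ and $b_1^+=0$; $\underline b=-1/b_1^+$ if $a_1^-+b_1^-+c^-=0$ and $b_1^+>0$. For $z\in\mathbb C\setminus\{0\}$ let $$\Phi_{a,b,c}(z)=e^{c^+z+c^-/z}\prod_{i=1}^\infty\frac{(1+b_i^+z)(1+b_i^-/z)}{(1-a_i^+z)(1-a_i^-/z)},$$ a meromorphic function on $\mathbb C\setminus\{0\}$. Contours: for $a\in\mathbb R$, $\Gamma_a^+=\{a+ye^{\pi\mathrm i/4}\}_{y\ge0}\cup\{a+ye^{-\pi\mathrm i/4}\}_{y\ge0}$ and $\Gamma_a^-=\{a+ye^{3\pi\mathrm i/4}\}_{y\ge0}\cup\{a+ye^{-3\pi\mathrm i/4}\}_{y\ge0}$, both oriented in the direction of increasing imaginary part. Kernel: for $t_1,t_2,x_1,x_2\in\mathbb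 R$, $K_{a,b,c}=K^1_{a,b,c}+K^2_{a,b,c}+K^3_{a,b,c}$ (all evaluated at $(t_1,x_1;t_2,x_2)$), where $$K^1_{a,b,c}=\frac1{2\pi\mathrm i}\int_\gamma dw\, e^{(t_2-t_1)w^2+(t_1^2-t_2^2)w+w(x_2-x_1)+x_1t_1-x_2t_2-t_1^3/3+t_2^3/3},$$ $$K^2_{a,b,c}=-\frac{\mathbf 1\{t_2>t_1\}}{\sqrt{4\pi(t_2-t_1)}}\,e^{-\frac{(x_2-x_1)^2}{4(t_2-t_1)}-\frac{(t_2-t_1)(x_2+x_1)}2+\frac{(t_2-t_1)^3}{12}},$$ $$K^3_{a,b,c}=\frac1{(2\pi\mathrm i)^2}\int_{\Gamma_\alpha^+}dz\int_{\Gamma_\beta^-}dw\,\frac{e^{z^3/3-x_1z-w^3/3+x_2w}}{z+t_1-w-t_2}\cdot\frac{\Phi_{a,b,c}(z+t_1)}{\Phi_{a,b,c}(w+t_2)}.$$ Here $\alpha,\beta\in\mathbb R$ satisfy $\alpha+t_1<\underline a$ and $\beta+t_2>\underline b$. If $\Gamma^+_{\alpha+t_1}$ and $\Gamma^-_{\beta+t_2}$ have zero or one intersection points, then $\gamma=\emptyset$ and $K^1_{a,b,c}=0$. Otherwise they have exactly two intersection points, which are complex conjugates, and $\gamma$ is the straight vertical segment connecting them, oriented in the direction of increasing imaginary part. *)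

(* Defs.v *)
From HB Require Import structures.
From mathcomp Require Import all_boot all_order all_algebra.
From mathcomp Require Import complex.
From mathcomp Require Import all_classical all_reals all_analysis.

Set Implicit Arguments.
Unset Strict Implicit.
Unset Printing Implicit Defensive.

Import Order.TTheory GRing.Theory Num.Theory.
Import numFieldNormedType.Exports.

Local Open Scope classical_set_scope.
Local Open Scope complex_scope.
Local Open Scope ring_scope.

(* Complex numbers are R[i]; its topology (limits, continuity) is that of the
   normed space R[i]^o, convertible to R[i]. *)

Notation leb2 R := (@lebesgue_measure R \x @lebesgue_measure R)%E.

Section ComplexAnalysis.
Context {R : realType}.

Definition cis (theta : R) : R[i] := cos theta +i* sin theta.

Definition cexp (z : R[i]) : R[i] := (expR (complex.Re z))%:C * cis (complex.Im z).

Definition Cintegrable d (T : measurableType d) (mu : {measure set T -> \bar R})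
    (D : set T) (f : T -> R[i]) : Prop :=
  mu.-integrable D (fun x => (complex.Re (f x))%:E) /\
  mu.-integrable D (fun x => (complex.Im (f x))%:E).

Definition Cintegral d (T : measurableType d) (mu : {measure set T -> \bar R})
    (D : set T) (f : T -> R[i]) : R[i] :=
  (\int[mu]_(x in D) complex.Re (f x)) +i* (\int[mu]_(x in D) complex.Im (f x)).

(* The two rays a + y e^(+- i theta), y >= 0, traversed as one curve: y = |s|,
   with s >= 0 on the upper ray and s <= 0 on the lower one.  For 0 < theta < pi
   the imaginary part increases with s. *)
Definition wedge (theta a s : R) : R[i] :=
  a%:C + `|s|%:C * cis (Num.sg s * theta).

(* The derivative of [wedge theta a] at s != 0. *)
Definition dwedge (theta s : R) : R[i] :=
  (Num.sg s)%:C * cis (Num.sg s * theta).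

Definition Gamma_plus : R -> R -> R[i] := wedge (pi / 4).
Definition Gamma_minus : R -> R -> R[i] := wedge (3 * pi / 4).
Definition dGamma_plus : R -> R[i] := dwedge (pi / 4).
Definition dGamma_minus : R -> R[i] := dwedge (3 * pi / 4).

Definition vsegment_integral (p : R[i]) (f : R[i] -> R[i]) : R[i] :=
  'i%C * Cintegral (@lebesgue_measure R) `[- complex.Im p, complex.Im p]
         (fun s => f (complex.Re p +i* s)).

End ComplexAnalysis.

(* Sequences are indexed from 0: [ap i] is a^+_(i+1), and so on. *)
Record params (R : realType) := Params {
  ap : nat -> R; am : nat -> R; bp : nat -> R; bm : nat -> R; cp : R; cm : R }.

Section Kernel.
Context {R : realType}.

Definition admissible (q : params R) : Prop :=
  [/\ forall i, [/\ 0 <= ap q i, 0 <= am q i, 0 <= bp q i & 0 <= bm q i],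
      (\sum_(0 <= i <oo) (ap q i + am q i + bp q i + bm q i)%:E < +oo)%E,
      forall i, [/\ ap q i.+1 <= ap q i, am q i.+1 <= am q i,
                    bp q i.+1 <= bp q i & bm q i.+1 <= bm q i],
      0 <= cp q & 0 <= cm q].

Definition a_low (q : params R) : \bar R :=
  if 0 < am q 0%N + bm q 0%N + cm q then 0%E
  else if ap q 0%N == 0 then +oo%E else ((ap q 0%N)^-1)%:E.

Definition b_low (q : params R) : \bar R :=
  if 0 < am q 0%N + bm q 0%N + cm q then 0%E
  else if bp q 0%N == 0 then -oo%E else (- (bp q 0%N)^-1)%:E.

Definition Phi (q : params R) (z : R[i]) : R[i] :=
  cexp ((cp q)%:C * z + (cm q)%:C / z) *
  limn (fun n => \prod_(i < n)
    ((1 + (bp q i)%:C * z) * (1 + (bm q i)%:C / z) /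
     ((1 - (ap q i)%:C * z) * (1 - (am q i)%:C / z))) : R[i]^o).

Variables (q : params R) (alpha beta t1 x1 t2 x2 : R).

Definition K1_integrand (w : R[i]) : R[i] :=
  cexp ((t2 - t1)%:C * w ^+ 2 + (t1 ^+ 2 - t2 ^+ 2)%:C * w + w * (x2 - x1)%:C
        + (x1 * t1 - x2 * t2 - t1 ^+ 3 / 3 + t2 ^+ 3 / 3)%:C).

(* p is the upper end point of the segment gamma. *)
Definition gamma_top (p : R[i]) : Prop :=
  0 < complex.Im p /\
  range (Gamma_plus (alpha + t1)) `&` range (Gamma_minus (beta + t2))
    = [set p; conjc p].

Definition K1 : R[i] :=
  if pselect (exists p, gamma_top p) is left ex_p then
    ((2 * pi)%:C * 'i%C)^-1 * vsegment_integral (projT1 (cid ex_p)) K1_integrand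
  else 0.

Definition K2 : R[i] :=
  (if t1 < t2 then
     - ((Num.sqrt (4 * pi * (t2 - t1)))^-1 *
        expR (- ((x2 - x1) ^+ 2 / (4 * (t2 - t1)))
              - (t2 - t1) * (x2 + x1) / 2 + (t2 - t1) ^+ 3 / 12))
   else 0)%:C.

Definition K3_integrand (z w : R[i]) : R[i] :=
  cexp (z ^+ 3 / 3 - x1%:C * z - w ^+ 3 / 3 + x2%:C * w)
    / (z + t1%:C - w - t2%:C)
  * (Phi q (z + t1%:C) / Phi q (w + t2%:C)).

Definition K3_pullback (s : R * R) : R[i] :=
  K3_integrand (Gamma_plus alpha s.1) (Gamma_minus beta s.2)
    * dGamma_plus s.1 * dGamma_minus s.2.

Definition K3 : R[i] :=
  (((2 * pi)%:C * 'i%C) ^+ 2)^-1 * Cintegral (leb2 R) setT K3_pullback.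

Definition K : R[i] := K1 + K2 + K3.

End Kernel.

(* Main.v *)
(* The substitution w -> -w turns Gamma^- into a contour of type Gamma^+ and
   1 / Phi(w) into the function Phi of the parameters with a and b exchanged, so
   K^3 is the integral of G1(z) G2(w) / (z + w) over two contours
   Gm a = a + {kap |s| + i kap s}, symmetric in (z, w).  On such contours G1 and
   G2 decay like exp(- c |s|^3), and |z + w| is bounded below by a multiple of
   (||s| - d| ||t| - d|)^(1/2): a singularity at the crossing points is dominated
   by a product of two locally integrable functions of one variable.

   Independence of a (hence, by symmetry, of b): by Fubini, moving the vertex
   from a to a' changes the inner integral over z by 2 pi i G1(-w) when -w lies
   between the two contours and by 0 otherwise.  Hence the double integral changes
   by the integral of G1(-w) G2(w), in which Phi cancels and which is therefore
   entire, over two arcs of the w-contour; by Cauchy's theorem these have the same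
   integral as the difference of the two vertical segments.

   The factors are holomorphic near the vertices only for the partial products of
   Phi; the limit is taken under the integral, by a bound which is uniform in n.
   Off the real axis the partial products converge, which is enough since the
   vertices have measure zero.  Continuity in (x1, x2), which enter only through
   exp(- x1 z + x2 w), follows from the same domination. *)
Require Import Defs.
From HB Require Import structures.
From mathcomp Require Import all_boot all_order all_algebra.
From mathcomp Require Import complex.
From mathcomp Require Import all_classical all_reals all_analysis.
From mathcomp Require Import ring lra.

Set Implicit Arguments.
Unset Strict Implicit.
Unset Printing Implicit Defensive.

Import Order.TTheory GRing.Theory Num.Theory.
Import numFieldNormedType.Exports measurable_realfun.

Local Open Scope classical_set_scope.
Local Open Scope complex_scope.
Local Open Scope ring_scope.

(** * Complex-valued functions *)

(** The contours may cross, and the integrand of K^3 is then unbounded at the crossing points. The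
    residue computation is therefore made only for the inner integral, at almost every point of the
    outer contour; crossing points and vertices occupy finitely many parameter values.

    Cauchy's theorem comes from Fubini: for a patch gam(u, y), the y-derivative of g(gam) gam_u
    equals the u-derivative of g(gam) gam_y, and integrating this common function in both orders
    relates the two pairs of opposite sides. The strip between the contours with vertices a and a'
    is cut along the real axis into two half strips, whose truncations are parallelograms with sides
    on the contours.

    The pole of G(Z) / (Z - W) is removed by subtracting G(W) / (Z - W), and the subtracted term is
    integrated explicitly, with ln and atan, along the truncated wedge. The argument of Z - W turns
    by pi/2 if W is outside the wedge and by -3 pi/2 if it is inside; the jump between these values
    is the 2 pi of the residue. *)

Section ComplexBasics.
Context {R : realType}.
Implicit Types (z w : R[i]) (x y : R).
Local Notation Re := (@complex.Re R).
Local Notation Im := (@complex.Im R).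

(** The norm of [R[i]] takes its values in [R[i]] itself; integrability and domination need a
    modulus with values in [R]. *)
Definition nm z : R := ComplexField.Normc.normc z.

Lemma nmE z : nm z = Num.sqrt (Re z ^+ 2 + Im z ^+ 2).
Proof. by case: z. Qed.

Lemma nm_ge0 z : 0 <= nm z.
Proof. by rewrite nmE sqrtr_ge0. Qed.

Lemma nmM z w : nm (z * w) = nm z * nm w.
Proof. exact: ComplexField.Normc.normcM. Qed.

Lemma nmV z : nm z^-1 = (nm z)^-1.
Proof. exact: ComplexField.Normc.normcV. Qed.

Lemma nmD z w : nm (z + w) <= nm z + nm w.
Proof. exact: le_normcD. Qed.

Lemma nmN z : nm (- z) = nm z.
Proof. exact: normcN. Qed.

Lemma nmB z w : nm (z - w) <= nm z + nm w.
Proof. by rewrite -(nmN w); exact: nmD. Qed.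

Lemma nm0 : nm 0 = 0.
Proof. by rewrite nmE /= expr0n /= addr0 sqrtr0. Qed.

Lemma nm1 : nm 1 = 1.
Proof. by rewrite nmE /= expr1n expr0n /= addr0 sqrtr1. Qed.

Lemma nm_sqr z : nm z ^+ 2 = Re z ^+ 2 + Im z ^+ 2.
Proof. by rewrite nmE sqr_sqrtr // addr_ge0 // sqr_ge0. Qed.

Lemma nm_Re z : `|Re z| <= nm z.
Proof.
by rewrite nmE -sqrtr_sqr ler_wsqrtr // lerDl sqr_ge0.
Qed.

Lemma nm_Im z : `|Im z| <= nm z.
Proof.
by rewrite nmE -sqrtr_sqr ler_wsqrtr // lerDr sqr_ge0.
Qed.

Lemma nm_le z : nm z <= `|Re z| + `|Im z|.
Proof.
rewrite nmE -[leRHS]ger0_norm ?addr_ge0// -sqrtr_sqr ler_wsqrtr //.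
have := mulr_ge0 (normr_ge0 (Re z)) (normr_ge0 (Im z)).
rewrite -(real_normK (num_real (Re z))) -(real_normK (num_real (Im z))).
by nra.
Qed.

Lemma nm_real x : nm x%:C = `|x|.
Proof. by rewrite nmE /= expr0n /= addr0 sqrtr_sqr. Qed.

Lemma nm_eq0 z : (nm z == 0) = (z == 0).
Proof.
apply/eqP/eqP => [|->]; last exact: nm0.
exact: ComplexField.Normc.eq0_normc.
Qed.

Lemma nm_gt0 z : (0 < nm z) = (z != 0).
Proof. by rewrite lt_neqAle nm_ge0 andbT eq_sym nm_eq0. Qed.

Lemma nmX z n : nm (z ^+ n) = nm z ^+ n.
Proof. by elim: n => [|n ih]; rewrite ?expr0 ?nm1// !exprS nmM ih. Qed.

Lemma cReD z w : Re (z + w) = Re z + Re w. Proof. by case: z w => [a b] []. Qed.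
Lemma cImD z w : Im (z + w) = Im z + Im w. Proof. by case: z w => [a b] []. Qed.
Lemma cReN z : Re (- z) = - Re z. Proof. by case: z. Qed.
Lemma cImN z : Im (- z) = - Im z. Proof. by case: z. Qed.
Lemma cReM z w : Re (z * w) = Re z * Re w - Im z * Im w.
Proof. by case: z w => [a b] []. Qed.
Lemma cImM z w : Im (z * w) = Re z * Im w + Im z * Re w.
Proof. by case: z w => [a b] []. Qed.
Lemma cReV z : Re z^-1 = Re z / (Re z ^+ 2 + Im z ^+ 2).
Proof. by case: z. Qed.
Lemma cImV z : Im z^-1 = - Im z / (Re z ^+ 2 + Im z ^+ 2).
Proof. by case: z => a b; rewrite mulNr. Qed.
Lemma Re_cexp z : Re (cexp z) = expR (Re z) * cos (Im z).
Proof. by rewrite /cexp cReM /= mul0r subr0. Qed.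
Lemma Im_cexp z : Im (cexp z) = expR (Re z) * sin (Im z).
Proof. by rewrite /cexp cImM /= mul0r addr0. Qed.

Definition ReImE :=
  (cReD, cImD, cReN, cImN, cReM, cImM, Re_cexp, Im_cexp).

Lemma complex_eq z w : Re z = Re w -> Im z = Im w -> z = w.
Proof. by case: z w => [a b] [c d] /= -> ->. Qed.

Lemma nm_cexp z : nm (cexp z) = expR (Re z).
Proof.
rewrite nmE Re_cexp Im_cexp !exprMn -mulrDr cos2Dsin2 mulr1.
by rewrite sqrtr_sqr ger0_norm // expR_ge0.
Qed.

Lemma cexpD z w : cexp (z + w) = cexp z * cexp w.
Proof.
by apply: complex_eq; rewrite !ReImE expRD ?cosD ?sinD; ring.
Qed.

Lemma cexp0 : cexp (0 : R[i]) = 1.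
Proof. by apply: complex_eq; rewrite !ReImE /= expR0 ?cos0 ?sin0 ?mulr0 ?mulr1. Qed.

Lemma natC n : (n%:R : R[i]) = (n%:R : R)%:C.
Proof. by rewrite rmorph_nat. Qed.

End ComplexBasics.

(** * Derivatives along real curves, continuity and holomorphy *)

Section CDeriv.
Context {R : realType}.
Local Notation Re := (@complex.Re R).
Local Notation Im := (@complex.Im R).

Lemma derD (f g : R -> R) (t a b : R) : is_derive t 1 f a -> is_derive t 1 g b ->
  is_derive t 1 (fun s => f s + g s) (a + b).
Proof. by move=> ? ?; exact: (@is_deriveD _ _ _ f g). Qed.

Lemma derB (f g : R -> R) (t a b : R) : is_derive t 1 f a -> is_derive t 1 g b ->
  is_derive t 1 (fun s => f s - g s) (a - b).
Proof. by move=> ? ?; exact: (@is_deriveB _ _ _ f g). Qed.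

Lemma derN (f : R -> R) (t a : R) : is_derive t 1 f a ->
  is_derive t 1 (fun s => - f s) (- a).
Proof. by move=> ?; exact: (@is_deriveN _ _ _ f). Qed.

Lemma derM (f g : R -> R) (t a b : R) : is_derive t 1 f a -> is_derive t 1 g b ->
  is_derive t 1 (fun s => f s * g s) (f t * b + a * g t).
Proof.
move=> df dg; apply: (is_derive_eq (is_deriveM df dg)).
by rewrite /GRing.scale /= [g t * _]mulrC.
Qed.

Lemma derV (f : R -> R) (t a : R) : f t != 0 -> is_derive t 1 f a ->
  is_derive t 1 (fun s => (f s)^-1) (- a / f t ^+ 2).
Proof.
move=> f0 df; apply: (is_derive_eq (is_deriveV f0 df)).
by rewrite /GRing.scale /=; field.
Qed.

Lemma der_comp (f g : R -> R) (t a b : R) : is_derive (g t) 1 f a ->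
  is_derive t 1 g b -> is_derive t 1 (fun s => f (g s)) (a * b).
Proof. exact: is_derive1_comp. Qed.

Lemma der_cst (c t : R) : is_derive t (1 : R) (fun=> c) (0 : R).
Proof. exact: is_derive_cst. Qed.

Lemma der_id (t : R) : is_derive t (1 : R) (fun s => s) (1 : R).
Proof. exact: is_derive_id. Qed.

(** Componentwise, like [ccont] below, so that the mean value theorem and the fundamental theorem of
    calculus for real functions apply directly. *)
Definition cder (f : R -> R[i]) (d : R[i]) (t : R) : Prop :=
  is_derive t 1 (fun s => Re (f s)) (Re d) /\
  is_derive t 1 (fun s => Im (f s)) (Im d).

Definition ccont (T : topologicalType) (f : T -> R[i]) (x : T) : Prop :=
  ((fun y => Re (f y)) @ x --> Re (f x)) /\ ((fun y => Im (f y)) @ x --> Im (f x)).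

Lemma cder_cst c t : cder (fun=> c) 0 t.
Proof. by split; apply: is_derive_cst. Qed.

Lemma cderD f g df dg t : cder f df t -> cder g dg t ->
  cder (fun s => f s + g s) (df + dg) t.
Proof.
move=> [f1 f2] [g1 g2]; split; rewrite ?cReD ?cImD.
- by under eq_fun do rewrite cReD; exact: derD.
- by under eq_fun do rewrite cImD; exact: derD.
Qed.

Lemma cderM f g df dg t : cder f df t -> cder g dg t ->
  cder (fun s => f s * g s) (f t * dg + df * g t) t.
Proof.
move=> [f1 f2] [g1 g2]; split.
- under eq_fun do rewrite cReM.
  apply: (is_derive_eq (derB (derM f1 g1) (derM f2 g2))).
  by rewrite cReD !cReM; ring.
- under eq_fun do rewrite cImM.
  apply: (is_derive_eq (derD (derM f1 g2) (derM f2 g1))).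
  by rewrite cImD !cImM; ring.
Qed.

Lemma neq0_sqr (z : R[i]) : z != 0 -> Re z ^+ 2 + Im z ^+ 2 != 0.
Proof. by rewrite -nm_sqr expf_eq0 /= nm_eq0. Qed.

Lemma cderV f df t : f t != 0 -> cder f df t ->
  cder (fun s => (f s)^-1) (- df / (f t) ^+ 2) t.
Proof.
move=> f0 [f1 f2].
have n0 := neq0_sqr f0.
have X2 : is_derive t 1 (fun s => Re (f s) * Re (f s) + Im (f s) * Im (f s))
    (2 * Re (f t) * Re df + 2 * Im (f t) * Im df).
  apply: (is_derive_eq (derD (derM f1 f1) (derM f2 f2))).
  by ring.
have n1 : Re (f t) * Re (f t) + Im (f t) * Im (f t) != 0 by rewrite -!expr2.
have XV := @derV (fun s => Re (f s) * Re (f s) + Im (f s) * Im (f s)) _ _ n1 X2.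
split.
- under eq_fun do rewrite cReV !expr2.
  apply: (is_derive_eq (derM f1 XV)).
  rewrite [f t ^+ 2]expr2 invfM !(cReM, cImM) cReV cImV cReN cImN.
  move: n0; case: (f t) df {f1 f2 X2 XV n1 f0} => a b [c d] /= n0.
  have n2 : (a * a - b * b) ^+ 2 + (a * b + b * a) ^+ 2 != 0.
    by rewrite (_ : _ + _ = (a ^+ 2 + b ^+ 2) ^+ 2) ?expf_neq0//; ring.
  by field; rewrite n2 -!expr2.
- under eq_fun do rewrite cImV !expr2.
  apply: (is_derive_eq (derM (derN f2) XV)).
  rewrite [f t ^+ 2]expr2 invfM !(cReM, cImM) cReV cImV cReN cImN.
  move: n0; case: (f t) df {f1 f2 X2 XV n1 f0} => a b [c d] /= n0.
  have n2 : (a * a - b * b) ^+ 2 + (a * b + b * a) ^+ 2 != 0.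
    by rewrite (_ : _ + _ = (a ^+ 2 + b ^+ 2) ^+ 2) ?expf_neq0//; ring.
  by field; rewrite n2 -!expr2.
Qed.

Lemma cder_cexp f df t : cder f df t -> cder (fun s => cexp (f s)) (cexp (f t) * df) t.
Proof.
move=> [f1 f2].
have e := der_comp (is_derive_expR (Re (f t))) f1.
have c := der_comp (is_derive_cos (Im (f t))) f2.
have s := der_comp (is_derive_sin (Im (f t))) f2.
split.
- under eq_fun do rewrite Re_cexp.
  apply: (is_derive_eq (derM e c)).
  by rewrite cReM Re_cexp Im_cexp; ring.
- under eq_fun do rewrite Im_cexp.
  apply: (is_derive_eq (derM e s)).
  by rewrite cImM Re_cexp Im_cexp; ring.
Qed.

Lemma cder_id (t : R) : cder (fun s => s%:C) 1 t.
Proof. by split; [exact: der_id|exact: der_cst]. Qed.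

Lemma cder_eq f df dg t : cder f df t -> df = dg -> cder f dg t.
Proof. by move=> + <-. Qed.

Lemma cder_lin (p v : R[i]) t : cder (fun s => p + s%:C * v) v t.
Proof.
apply: cder_eq; first by apply: cderD;[exact: cder_cst|apply: cderM;[exact: cder_id|exact: cder_cst]].
by rewrite mulr0 mul1r !add0r.
Qed.

Section Continuity.
Context {T : topologicalType}.
Implicit Types (f g : T -> R[i]) (x : T).

Lemma ccont_cst c x : ccont (fun=> c) x.
Proof. by split; exact: cvg_cst. Qed.

Lemma ccontD f g x : ccont f x -> ccont g x -> ccont (fun y => f y + g y) x.
Proof.
move=> [f1 f2] [g1 g2]; split; rewrite ?cReD ?cImD.
- by under eq_fun do rewrite cReD; apply: cvgD.
- by under eq_fun do rewrite cImD; apply: cvgD.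
Qed.

Lemma ccontM f g x : ccont f x -> ccont g x -> ccont (fun y => f y * g y) x.
Proof.
move=> [f1 f2] [g1 g2]; split; rewrite ?cReM ?cImM.
- by under eq_fun do rewrite cReM; apply: cvgB; apply: cvgM.
- by under eq_fun do rewrite cImM; apply: cvgD; apply: cvgM.
Qed.

Lemma ccontV f x : f x != 0 -> ccont f x -> ccont (fun y => (f y)^-1) x.
Proof.
move=> f0 [f1 f2].
have n0 := neq0_sqr f0.
have X : (fun y => (Re (f y) ^+ 2 + Im (f y) ^+ 2)^-1) @ x --> (Re (f x) ^+ 2 + Im (f x) ^+ 2)^-1.
  by apply: cvgV => //; apply: cvgD; rewrite expr2; under eq_fun do rewrite expr2; apply: cvgM.
split; rewrite ?cReV ?cImV.
- by under eq_fun do rewrite cReV; apply: cvgM.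
- by under eq_fun do rewrite cImV; apply: cvgM => //; apply: cvgN.
Qed.

Lemma ccont_cexp f x : ccont f x -> ccont (fun y => cexp (f y)) x.
Proof.
move=> [f1 f2].
have e : (fun y => expR (Re (f y))) @ x --> expR (Re (f x)).
  by apply: continuous_cvg => //; exact: continuous_expR.
split; rewrite ?Re_cexp ?Im_cexp.
- under eq_fun do rewrite Re_cexp; apply: cvgM => //.
  by apply: continuous_cvg => //; exact: continuous_cos.
- under eq_fun do rewrite Im_cexp; apply: cvgM => //.
  by apply: continuous_cvg => //; exact: continuous_sin.
Qed.

Lemma ccont_real (f : T -> R) x : f @ x --> f x -> ccont (fun y => (f y)%:C) x.
Proof. by move=> fx; split => //=; exact: cvg_cst. Qed.

End Continuity.

(* Holomorphy at [z], in the form of the chain rule along real curves; [dG] is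
   the derivative as a function, required to be continuous at [z]. *)
Record chol (G dG : R[i] -> R[i]) (z : R[i]) : Prop := CHol {
  chol_der : forall (f : R -> R[i]) t d, f t = z -> cder f d t ->
    cder (fun s => G (f s)) (dG z * d) t ;
  chol_cont : forall (T : topologicalType) (f : T -> R[i]) x, f x = z ->
    ccont f x -> ccont (fun y => G (f y)) x ;
  chol_dcont : forall (T : topologicalType) (f : T -> R[i]) x, f x = z ->
    ccont f x -> ccont (fun y => dG (f y)) x }.

Lemma chol_cst c z : chol (fun=> c) (fun=> 0) z.
Proof.
split=> *; [rewrite mul0r; exact: cder_cst|exact: ccont_cst..].
Qed.

Lemma chol_id z : chol (fun w => w) (fun=> 1) z.
Proof.
split=> [f t d _|T f x _|T f x _ _]; [by rewrite mul1r|by []|exact: ccont_cst].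
Qed.

Lemma cholD F dF G dG z : chol F dF z -> chol G dG z ->
  chol (fun w => F w + G w) (fun w => dF w + dG w) z.
Proof.
move=> [f1 f2 f3] [g1 g2 g3]; split=> [f t d fz df|T f x fz cf|T f x fz cf].
- by rewrite mulrDl; apply: cderD; [exact: f1|exact: g1].
- by apply: ccontD; [exact: f2|exact: g2].
- by apply: ccontD; [exact: f3|exact: g3].
Qed.

Lemma cholM F dF G dG z : chol F dF z -> chol G dG z ->
  chol (fun w => F w * G w) (fun w => F w * dG w + dF w * G w) z.
Proof.
move=> [f1 f2 f3] [g1 g2 g3]; split=> [f t d fz df|T f x fz cf|T f x fz cf].
- apply: (cder_eq (cderM (f1 _ _ _ fz df) (g1 _ _ _ fz df))).
  by rewrite fz; ring.
- by apply: ccontM; [exact: f2|exact: g2].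
- by apply: ccontD; apply: ccontM; [exact: f2|exact: g3|exact: f3|exact: g2].
Qed.

Lemma cholV F dF z : F z != 0 -> chol F dF z ->
  chol (fun w => (F w)^-1) (fun w => - dF w / F w ^+ 2) z.
Proof.
move=> Fz [f1 f2 f3]; split=> [f t d fz df|T f x fz cf|T f x fz cf].
- have Fz' : F (f t) != 0 by rewrite fz.
  apply: (cder_eq (@cderV (fun s => F (f s)) _ _ Fz' (f1 _ _ _ fz df))).
  by rewrite fz; ring.
- by apply: ccontV; [rewrite fz|exact: f2].
- apply: ccontM.
    under eq_fun do rewrite -mulN1r.
    by apply: ccontM; [exact: ccont_cst|exact: f3].
  apply: ccontV; first by rewrite fz expf_neq0.
  by under eq_fun do rewrite expr2; apply: ccontM; exact: f2.
Qed.

Lemma chol_cexp F dF z : chol F dF z ->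
  chol (fun w => cexp (F w)) (fun w => cexp (F w) * dF w) z.
Proof.
move=> [f1 f2 f3]; split=> [f t d fz df|T f x fz cf|T f x fz cf].
- apply: (cder_eq (cder_cexp (f1 _ _ _ fz df))).
  by rewrite fz; ring.
- by apply: ccont_cexp; exact: f2.
- by apply: ccontM; [apply: ccont_cexp; exact: f2|exact: f3].
Qed.

Lemma chol_ext F dF z G dG : F =1 G -> dF =1 dG -> chol F dF z -> chol G dG z.
Proof. by move=> /funext <- /funext <-. Qed.

End CDeriv.

(** Inversion is discontinuous at 0, where its value is the default 0; that point is treated apart
    from its open complement. *)
Lemma measurable_inv (R : realType) : measurable_fun [set: R] (@GRing.inv R).
Proof.
have -> : @GRing.inv R = (fun x => if x == 0 then 0 else x^-1).
  by apply/funext => x; case: eqP => // ->; rewrite invr0.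
apply: measurable_fun_if => //.
- by apply: measurable_fun_eqr => //; exact: measurable_cst.
- rewrite setTI (_ : _ @^-1` _ = [set x | x != 0]).
    apply: open_continuous_measurable_fun; first exact: open_neq.
    by move=> x; rewrite inE /= => x0; exact: inv_continuous.
  by apply/seteqP; split=> x /=; case: eqP.
Qed.

(** * Measurability of complex functions *)

Section CMeasurable.
Context {R : realType} d (T : measurableType d).
Local Notation Re := (@complex.Re R).
Local Notation Im := (@complex.Im R).
Implicit Types (D : set T) (f g : T -> R[i]).

Definition cmeas D f : Prop :=
  measurable_fun D (fun x => Re (f x)) /\ measurable_fun D (fun x => Im (f x)).

Lemma cmeas_cst D c : cmeas D (fun=> c).
Proof. by split; exact: measurable_cst. Qed.

Lemma cmeasD D f g : cmeas D f -> cmeas D g -> cmeas D (fun x => f x + g x).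
Proof.
move=> [f1 f2] [g1 g2]; split.
- by under eq_fun do rewrite cReD; exact: measurable_funD.
- by under eq_fun do rewrite cImD; exact: measurable_funD.
Qed.

Lemma cmeasM D f g : cmeas D f -> cmeas D g -> cmeas D (fun x => f x * g x).
Proof.
move=> [f1 f2] [g1 g2]; split.
- by under eq_fun do rewrite cReM; apply: measurable_funB; exact: measurable_funM.
- by under eq_fun do rewrite cImM; apply: measurable_funD; exact: measurable_funM.
Qed.

Lemma cmeasN D f : cmeas D f -> cmeas D (fun x => - f x).
Proof.
move=> mf; under eq_fun do rewrite -mulN1r.
by apply: cmeasM => //; exact: cmeas_cst.
Qed.

Lemma cmeasB D f g : cmeas D f -> cmeas D g -> cmeas D (fun x => f x - g x).
Proof. by move=> mf mg; apply: cmeasD => //; exact: cmeasN. Qed.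

Lemma cmeasV D f : cmeas D f -> cmeas D (fun x => (f x)^-1).
Proof.
move=> [f1 f2].
have mV : measurable_fun D (fun x => (Re (f x) ^+ 2 + Im (f x) ^+ 2)^-1).
  apply: (measurableT_comp (@measurable_inv R)).
  by apply: measurable_funD; exact: measurable_funX.
split.
- by under eq_fun do rewrite cReV; exact: measurable_funM.
- by under eq_fun do rewrite cImV; apply: measurable_funM => //; exact: measurable_funN.
Qed.

Lemma cmeasX D f n : cmeas D f -> cmeas D (fun x => f x ^+ n).
Proof.
move=> mf; elim: n => [|n ih]; first exact: cmeas_cst.
by under eq_fun do rewrite exprS; exact: cmeasM.
Qed.

Lemma cmeas_cexp D f : cmeas D f -> cmeas D (fun x => cexp (f x)).
Proof.
move=> [f1 f2].
have me : measurable_fun D (fun x => expR (Re (f x))).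
  exact: (measurableT_comp (@measurable_expR R)).
have mc : measurable_fun D (fun x => cos (Im (f x))).
  by apply: (measurableT_comp (continuous_measurable_fun (@continuous_cos R))).
have ms : measurable_fun D (fun x => sin (Im (f x))).
  by apply: (measurableT_comp (continuous_measurable_fun (@continuous_sin R))).
split.
- by under eq_fun do rewrite Re_cexp; exact: measurable_funM.
- by under eq_fun do rewrite Im_cexp; exact: measurable_funM.
Qed.

Lemma cmeas_real D (f : T -> R) : measurable_fun D f -> cmeas D (fun x => (f x)%:C).
Proof. by move=> mf; split => //=; exact: measurable_cst. Qed.

Lemma cmeasS D E f : measurable E -> D `<=` E -> cmeas E f -> cmeas D f.
Proof.
by move=> mE DE [f1 f2]; split; [exact: (measurable_funS mE DE f1)
  |exact: (measurable_funS mE DE f2)].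
Qed.

Lemma cmeas_cvg D (F : nat -> T -> R[i]) f : (forall n, cmeas D (F n)) ->
  (forall x, D x -> Re (F n x) @[n --> \oo] --> Re (f x)) ->
  (forall x, D x -> Im (F n x) @[n --> \oo] --> Im (f x)) ->
  cmeas D f.
Proof.
move=> mF cR cI; split.
- by apply: (measurable_fun_cvg (h := fun n x => Re (F n x))) => // n; exact: (mF n).1.
- by apply: (measurable_fun_cvg (h := fun n x => Im (F n x))) => // n; exact: (mF n).2.
Qed.

Lemma measurable_nm D f : cmeas D f -> measurable_fun D (fun x => nm (f x)).
Proof.
move=> [f1 f2]; under eq_fun do rewrite nmE.
apply: (measurableT_comp (continuous_measurable_fun (@sqrt_continuous R))).
by apply: measurable_funD; exact: measurable_funX.
Qed.

End CMeasurable.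

Lemma cmeas_comp {R : realType} d (T : measurableType d) d' (U : measurableType d')
    (h : U -> T) (f : T -> R[i]) (D : set U) :
  cmeas setT f -> measurable_fun D h -> cmeas D (fun x => f (h x)).
Proof.
by move=> [f1 f2] mh; split; [exact: (measurableT_comp f1 mh)|exact: (measurableT_comp f2 mh)].
Qed.

(** * Integrals of complex functions, Fubini and reflection *)

Section CIntegral.
Context {R : realType} d (T : measurableType d) (mu : {measure set T -> \bar R}).
Local Notation Re := (@complex.Re R).
Local Notation Im := (@complex.Im R).
Variables (D : set T) (mD : measurable D).
Implicit Types (f g : T -> R[i]) (h : T -> R).
Local Notation cint f := (Cintegral mu D f).
Local Notation cintb f := (Cintegrable mu D f).
Local Notation rintb h := (mu.-integrable D (EFin \o h)).

Lemma integrable_le_real h k : measurable_fun D h ->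
  (forall x, D x -> `|h x| <= k x) -> rintb k -> rintb h.
Proof.
move=> mh hk ik; apply: (le_integrable mD _ _ ik); first exact/measurable_EFinP.
by move=> x Dx /=; rewrite lee_fin (le_trans (hk _ Dx)) // ler_norm.
Qed.

Lemma cintegrable_dom f k : cmeas D f -> (forall x, D x -> nm (f x) <= k x) ->
  rintb k -> cintb f.
Proof.
move=> [f1 f2] fk ik; split.
- apply: integrable_le_real ik => // x Dx.
  exact: le_trans (nm_Re _) (fk _ Dx).
- apply: integrable_le_real ik => // x Dx.
  exact: le_trans (nm_Im _) (fk _ Dx).
Qed.

Lemma cintegrable_cmeas f : cintb f -> cmeas D f.
Proof.
by move=> [/integrableP[/measurable_EFinP f1 _] /integrableP[/measurable_EFinP f2 _]].
Qed.

Lemma rintegrableD h k : rintb h -> rintb k -> rintb (fun x => h x + k x).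
Proof. by move=> ih ik; exact: (integrableD mD ih ik). Qed.

Lemma rintegrableB h k : rintb h -> rintb k -> rintb (fun x => h x - k x).
Proof. by move=> ih ik; exact: (integrableB mD ih ik). Qed.

Lemma rintegrableZ c h : rintb h -> rintb (fun x => c * h x).
Proof. by move=> ih; exact: (integrableZl mD c ih). Qed.

Lemma rintegrable_nm f : cintb f -> rintb (fun x => nm (f x)).
Proof.
move=> fi; have [f1 f2] := fi.
apply: (@integrable_le_real _ (fun x => `|Re (f x)| + `|Im (f x)|)).
- exact/measurable_nm/cintegrable_cmeas.
- by move=> x Dx; rewrite ger0_norm ?nm_ge0 // nm_le.
- by apply: rintegrableD; [exact: (integrable_norm f1)|exact: (integrable_norm f2)].
Qed.

Lemma cintegrableD f g : cintb f -> cintb g -> cintb (fun x => f x + g x).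
Proof.
move=> [f1 f2] [g1 g2]; split.
- by under eq_fun do rewrite cReD; exact: rintegrableD.
- by under eq_fun do rewrite cImD; exact: rintegrableD.
Qed.

Lemma cintegrableZ c f : cintb f -> cintb (fun x => c * f x).
Proof.
move=> [f1 f2]; split.
- by under eq_fun do rewrite cReM; apply: rintegrableB; exact: rintegrableZ.
- by under eq_fun do rewrite cImM; apply: rintegrableD; exact: rintegrableZ.
Qed.

Lemma cintegrableN f : cintb f -> cintb (fun x => - f x).
Proof. by move=> fi; under eq_fun do rewrite -mulN1r; exact: cintegrableZ. Qed.

Lemma cintegrableB f g : cintb f -> cintb g -> cintb (fun x => f x - g x).
Proof. by move=> fi gi; apply: cintegrableD => //; exact: cintegrableN. Qed.

Lemma CintegralD f g : cintb f -> cintb g ->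
  cint (fun x => f x + g x) = cint f + cint g.
Proof.
move=> [f1 f2] [g1 g2]; apply: complex_eq; rewrite ?cReD ?cImD /Cintegral /=.
- by under eq_Rintegral do rewrite cReD; rewrite RintegralD.
- by under eq_Rintegral do rewrite cImD; rewrite RintegralD.
Qed.

Lemma CintegralZ c f : cintb f -> cint (fun x => c * f x) = c * cint f.
Proof.
move=> [f1 f2]; apply: complex_eq; rewrite ?cReM ?cImM /Cintegral /=.
- under eq_Rintegral do rewrite cReM.
  by rewrite RintegralB ?RintegralZl//; exact: rintegrableZ.
- under eq_Rintegral do rewrite cImM.
  by rewrite RintegralD ?RintegralZl//; exact: rintegrableZ.
Qed.

Lemma CintegralN f : cintb f -> cint (fun x => - f x) = - cint f.
Proof. by move=> fi; under eq_fun do rewrite -mulN1r; rewrite CintegralZ // mulN1r. Qed.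

Lemma CintegralB f g : cintb f -> cintb g ->
  cint (fun x => f x - g x) = cint f - cint g.
Proof.
by move=> fi gi; rewrite CintegralD ?CintegralN//; exact: cintegrableN.
Qed.

Lemma eq_Cintegral f g : (forall x, D x -> f x = g x) -> cint f = cint g.
Proof.
move=> fg; rewrite /Cintegral; congr (_ +i* _).
- by apply: eq_Rintegral => x; rewrite inE => Dx; rewrite fg.
- by apply: eq_Rintegral => x; rewrite inE => Dx; rewrite fg.
Qed.

(** The factor 2 comes from bounding the real and the imaginary part separately. *)
Lemma nm_Cintegral f k : cmeas D f -> (forall x, D x -> nm (f x) <= k x) ->
  rintb k -> nm (cint f) <= 2 * \int[mu]_(x in D) k x.
Proof.
move=> mf fk ik; have [f1 f2] := cintegrable_dom mf fk ik.
rewrite (le_trans (nm_le _)) //= mulr_natl mulr2n lerD //.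
- rewrite (le_trans (le_normr_Rintegral _ f1)) //.
  apply: le_Rintegral => //; first exact: (integrable_norm f1).
  by move=> x Dx; exact: le_trans (nm_Re _) (fk _ Dx).
- rewrite (le_trans (le_normr_Rintegral _ f2)) //.
  apply: le_Rintegral => //; first exact: (integrable_norm f2).
  by move=> x Dx; exact: le_trans (nm_Im _) (fk _ Dx).
Qed.

Lemma Rintegral_dct (F : nat -> T -> R) h k : (forall n, measurable_fun D (F n)) ->
  measurable_fun D h ->
  (\forall x \ae mu, D x -> F n x @[n --> \oo] --> h x) ->
  (\forall x \ae mu, forall n, D x -> `|F n x| <= k x) -> rintb k ->
  \int[mu]_(x in D) F n x @[n --> \oo] --> \int[mu]_(x in D) h x.
Proof.
move=> mF mh Fh Fk ik.
have [] := dominated_convergence mD (f_ := fun n x => (F n x)%:E)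
    (f := EFin \o h) (g := EFin \o k) _ _ _ ik _.
- by move=> n; exact/measurable_EFinP.
- exact/measurable_EFinP.
- by apply: filterS Fh => x Fh Dx; apply/fine_cvgP; split; [near=> n|exact: Fh].
- by apply: filterS Fk => x Fk n Dx /=; rewrite lee_fin; exact: Fk.
move=> ih _ cv.
by apply: fine_cvg; rewrite fineK //; exact: integrable_fin_num.
Unshelve. all: by end_near. Qed.

Lemma Cintegral_dct (F : nat -> T -> R[i]) f k : (forall n, cmeas D (F n)) ->
  cmeas D f ->
  (\forall x \ae mu, D x -> Re (F n x) @[n --> \oo] --> Re (f x)) ->
  (\forall x \ae mu, D x -> Im (F n x) @[n --> \oo] --> Im (f x)) ->
  (\forall x \ae mu, forall n, D x -> nm (F n x) <= k x) -> rintb k ->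
  Re (cint (F n)) @[n --> \oo] --> Re (cint f) /\
  Im (cint (F n)) @[n --> \oo] --> Im (cint f).
Proof.
move=> mF [m1 m2] cR cI Fk ik; split => /=.
- apply: (@Rintegral_dct _ _ k) => // [n|]; first exact: (mF n).1.
  by apply: filterS Fk => x Fk n Dx; exact: le_trans (nm_Re _) (Fk n Dx).
- apply: (@Rintegral_dct _ _ k) => // [n|]; first exact: (mF n).2.
  by apply: filterS Fk => x Fk n Dx; exact: le_trans (nm_Im _) (Fk n Dx).
Qed.

Lemma Cintegral_ae_eq f g : cmeas D f -> cmeas D g ->
  (\forall x \ae mu, D x -> f x = g x) -> cint f = cint g.
Proof.
move=> [f1 f2] [g1 g2] fg; rewrite /Cintegral /Rintegral; congr (fine _ +i* fine _).
- apply: ae_eq_integral => //; [exact/measurable_EFinP..|].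
  by apply: filterS fg => x /[apply] ->.
- apply: ae_eq_integral => //; [exact/measurable_EFinP..|].
  by apply: filterS fg => x /[apply] ->.
Qed.

End CIntegral.

Section FubiniC.
Context {R : realType} d1 d2 (T1 : measurableType d1) (T2 : measurableType d2).
Variables (m1 : {sigma_finite_measure set T1 -> \bar R})
          (m2 : {sigma_finite_measure set T2 -> \bar R}).

(** Fubini yields an inner integral in the extended reals, while the inner [Rintegral] is its finite
    part; they agree where the section is integrable, that is, almost everywhere. *)
Lemma Rintegral_prod12 (h : T1 * T2 -> R) :
  (m1 \x m2)%E.-integrable setT (EFin \o h) ->
  \int[(m1 \x m2)%E]_z h z = \int[m1]_x (\int[m2]_y h (x, y)).
Proof.
move=> ih; rewrite /Rintegral -(integral12_prod_meas1 ih); congr fine.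
have mF := measurable_fubini_F ih.
apply: ae_eq_integral => //.
- by apply/measurable_EFinP; apply: (measurableT_comp (@fine_measurable R setT measurableT)).
- apply: filterS (ae_integrable1 ih) => x ix _ /=.
  by rewrite fineK // integrable_fin_num.
Qed.

Lemma Rintegral_prod21 (h : T1 * T2 -> R) :
  (m1 \x m2)%E.-integrable setT (EFin \o h) ->
  \int[(m1 \x m2)%E]_z h z = \int[m2]_y (\int[m1]_x h (x, y)).
Proof.
move=> ih; rewrite /Rintegral -(integral21_prod_meas1 ih); congr fine.
have mF := measurable_fubini_G ih.
apply: ae_eq_integral => //.
- by apply/measurable_EFinP; apply: (measurableT_comp (@fine_measurable R setT measurableT)).
- apply: filterS (ae_integrable2 ih) => x ix _ /=.
  by rewrite fineK // integrable_fin_num.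
Qed.

Lemma measurable_Rintegral_prod2 (h : T1 * T2 -> R) :
  (m1 \x m2)%E.-integrable setT (EFin \o h) ->
  measurable_fun setT (fun y => \int[m1]_x h (x, y)).
Proof.
move=> ih; have mF := measurable_fubini_G ih.
exact: (measurableT_comp (@fine_measurable R setT measurableT)).
Qed.

Lemma Cintegral_prod12 (f : T1 * T2 -> R[i]) :
  Cintegrable (m1 \x m2)%E setT f ->
  Cintegral (m1 \x m2)%E setT f =
  Cintegral m1 setT (fun x => Cintegral m2 setT (fun y => f (x, y))).
Proof. by move=> [f1 f2]; rewrite /Cintegral /= (Rintegral_prod12 f1) (Rintegral_prod12 f2). Qed.

Lemma Cintegral_prod21 (f : T1 * T2 -> R[i]) :
  Cintegrable (m1 \x m2)%E setT f ->
  Cintegral (m1 \x m2)%E setT f =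
  Cintegral m2 setT (fun y => Cintegral m1 setT (fun x => f (x, y))).
Proof. by move=> [f1 f2]; rewrite /Cintegral /= (Rintegral_prod21 f1) (Rintegral_prod21 f2). Qed.

Lemma cmeas_Cintegral_prod2 (f : T1 * T2 -> R[i]) :
  Cintegrable (m1 \x m2)%E setT f ->
  cmeas setT (fun y => Cintegral m1 setT (fun x => f (x, y))).
Proof.
by move=> [f1 f2]; split; [exact: (measurable_Rintegral_prod2 f1)
  |exact: (measurable_Rintegral_prod2 f2)].
Qed.

Lemma integrable_prod_mul (g : T1 -> R) (h : T2 -> R) :
  (forall x, 0 <= g x) -> (forall y, 0 <= h y) ->
  m1.-integrable setT (EFin \o g) -> m2.-integrable setT (EFin \o h) ->
  (m1 \x m2)%E.-integrable setT (fun z => (g z.1 * h z.2)%:E).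
Proof.
move=> g0 h0 ig ih.
have mg : measurable_fun setT g by have /integrableP[/measurable_EFinP] := ig.
have mh : measurable_fun setT h by have /integrableP[/measurable_EFinP] := ih.
apply/integrable12ltyP.
  apply/measurable_EFinP; apply: measurable_funM.
    exact: (measurableT_comp mg).
  exact: (measurableT_comp mh).
have hfin : (\int[m2]_y `|(h y)%:E| < +oo)%E by have /integrableP[] := ih.
have E x : (\int[m2]_y `|(g x * h y)%:E| = `|(g x)%:E| * \int[m2]_y `|(h y)%:E|)%E.
  rewrite -ge0_integralZl //.
    by apply: eq_integral => y _; rewrite EFinM abseM.
  by apply/measurable_EFinP; apply: (measurableT_comp (@normr_measurable R setT)).
under eq_integral do rewrite /= E.
rewrite ge0_integralZr //; last 2 first.
- by apply/measurable_EFinP; apply: (measurableT_comp (@normr_measurable R setT)).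
- exact: integral_ge0.
by rewrite lte_mul_pinfty ?integral_ge0 ?ge0_fin_numE ?integral_ge0//; have /integrableP[] := ig.
Qed.

End FubiniC.

Section Reflection.
Context {R : realType}.
Local Notation leb := (@lebesgue_measure R).

Lemma integral_pushforward_opp (F : R -> \bar R) :
  (\int[pushforward leb (-%R : R -> measurableTypeR R)]_x F x = \int[leb]_x F x)%E.
Proof. by apply: eq_measure_integral => A mA _; exact: lebesgue_measureN. Qed.

Lemma integrable_opp (h : R -> R) : leb.-integrable setT (EFin \o h) ->
  leb.-integrable setT (fun x => (h (- x))%:E).
Proof.
move=> ih.
have mh : measurable_fun setT h by have /integrableP[/measurable_EFinP] := ih.
have mN : measurable_fun setT (fun x : R => - x) by exact: measurable_funN.
apply/integrableP; split; first by apply/measurable_EFinP; exact: (measurableT_comp mh).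
have /integrableP[_] := ih; congr (_ < _)%E.
rewrite -integral_pushforward_opp.
rewrite ge0_integral_pushforward //.
by apply: (measurableT_comp (@abse_measurable R setT)); exact/measurable_EFinP.
Qed.

Lemma Rintegral_opp (h : R -> R) : leb.-integrable setT (EFin \o h) ->
  \int[leb]_x h (- x) = \int[leb]_x h x.
Proof.
move=> ih.
have mh : measurable_fun setT h by have /integrableP[/measurable_EFinP] := ih.
have mN : measurable_fun setT (fun x : R => - x) by exact: measurable_funN.
rewrite /Rintegral; congr fine.
rewrite -[RHS]integral_pushforward_opp.
rewrite integral_pushforward //; first exact/measurable_EFinP.
by rewrite preimage_setT; exact: integrable_opp.
Qed.

Lemma Cintegral_opp (f : R -> R[i]) : Cintegrable leb setT f ->
  Cintegral leb setT (fun x => f (- x)) = Cintegral leb setT f.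
Proof. by move=> [f1 f2]; rewrite /Cintegral (Rintegral_opp f1) (Rintegral_opp f2). Qed.

End Reflection.

Section FTC.
Context {R : realType}.
Local Notation leb := (@lebesgue_measure R).

Lemma rintegrable_continuous (f : R -> R) (a b : R) :
  (forall x, a <= x <= b -> f @ x --> f x) ->
  leb.-integrable `[a, b] (EFin \o f).
Proof.
move=> cf; apply: continuous_compact_integrable; first exact: segment_compact.
by apply: continuous_in_subspaceT => x; rewrite inE /= in_itv /=; exact: cf.
Qed.

Lemma Rintegral_FTC (F f : R -> R) (a b : R) : a <= b ->
  (forall x, a <= x <= b -> is_derive x (1 : R) F (f x)) ->
  (forall x, a <= x <= b -> f @ x --> f x) ->
  \int[leb]_(x in `[a, b]) f x = F b - F a.
Proof.
rewrite le_eqVlt => /predU1P[<- _ _|ab dF cf].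
  by rewrite set_itv1 Rintegral_set1 subrr.
have drv x : a <= x <= b -> derivable F x 1 by move=> /dF [].
have cF x : a <= x <= b -> F @ x --> F x.
  by move=> /drv dx; apply: differentiable_continuous; exact/derivable1_diffP.
rewrite /Rintegral (@continuous_FTC2 _ f F) //.
- by apply: continuous_in_subspaceT => x; rewrite inE /= in_itv /=; exact: cf.
- split.
  + by move=> x; rewrite in_itv /= => /andP[ax xb]; apply: drv; rewrite !ltW.
  + by apply: cvg_at_right_filter; apply: cF; rewrite lexx ltW.
  + by apply: cvg_at_left_filter; apply: cF; rewrite lexx ltW.
- move=> x; rewrite in_itv /= => /andP[ax xb].
  have /dF dx : a <= x <= b by rewrite !ltW.
  by rewrite derive1E; exact: derive_val.
Qed.

End FTC.

(** * Closure properties of holomorphic functions *)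

Section Holomorphic.
Context {R : realType}.
Implicit Types (D : set R[i]) (F G : R[i] -> R[i]).

(** Measurability of [G] is expressed through its composites, in keeping with the componentwise
    [cmeas]. *)
Definition mcomp G : Prop := forall d (T : measurableType d) (D : set T) (f : T -> R[i]),
  cmeas D f -> cmeas D (fun x => G (f x)).

(** Holomorphy is local to [D] but measurability is global: integrands are cut off to an interval or
    a rectangle by a conditional whose branch must be measurable everywhere. The derivative has to
    be measurable too, because Green's formula integrates it. *)
Definition hol D G : Prop :=
  exists dG, [/\ mcomp G, mcomp dG & forall z, D z -> chol G dG z].

Lemma hol_cst D c : hol D (fun=> c).
Proof.
exists (fun=> 0); split=> [d T E f _|d T E f _|z _];
  [exact: cmeas_cst..|exact: chol_cst].
Qed.

Lemma hol_id D : hol D (fun w => w).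
Proof.
exists (fun=> 1); split=> [d T E f //|d T E f _|z _]; [exact: cmeas_cst|exact: chol_id].
Qed.

Lemma holD D F G : hol D F -> hol D G -> hol D (fun w => F w + G w).
Proof.
move=> [dF [mF mdF hF]] [dG [mG mdG hG]]; exists (fun w => dF w + dG w); split.
- by move=> d T E f mf; apply: cmeasD; [exact: mF|exact: mG].
- by move=> d T E f mf; apply: cmeasD; [exact: mdF|exact: mdG].
- by move=> z Dz; apply: cholD; [exact: hF|exact: hG].
Qed.

Lemma holM D F G : hol D F -> hol D G -> hol D (fun w => F w * G w).
Proof.
move=> [dF [mF mdF hF]] [dG [mG mdG hG]]; exists (fun w => F w * dG w + dF w * G w); split.
- by move=> d T E f mf; apply: cmeasM; [exact: mF|exact: mG].
- by move=> d T E f mf; apply: cmeasD; apply: cmeasM; [exact: mF|exact: mdG|exact: mdF|exact: mG].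
- by move=> z Dz; apply: cholM; [exact: hF|exact: hG].
Qed.

Lemma holN D F : hol D F -> hol D (fun w => - F w).
Proof.
move=> hF; under eq_fun do rewrite -mulN1r.
by apply: holM => //; exact: hol_cst.
Qed.

Lemma holB D F G : hol D F -> hol D G -> hol D (fun w => F w - G w).
Proof. by move=> hF hG; apply: holD => //; exact: holN. Qed.

Lemma holV D F : (forall z, D z -> F z != 0) -> hol D F -> hol D (fun w => (F w)^-1).
Proof.
move=> F0 [dF [mF mdF hF]]; exists (fun w => - dF w / F w ^+ 2); split.
- by move=> d T E f mf; apply: cmeasV; exact: mF.
- move=> d T E f mf; apply: cmeasM; first by apply: cmeasN; exact: mdF.
  by apply: cmeasV; apply: cmeasX; exact: mF.
- by move=> z Dz; apply: cholV; [exact: F0|exact: hF].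
Qed.

Lemma hol_cexp D F : hol D F -> hol D (fun w => cexp (F w)).
Proof.
move=> [dF [mF mdF hF]]; exists (fun w => cexp (F w) * dF w); split.
- by move=> d T E f mf; apply: cmeas_cexp; exact: mF.
- by move=> d T E f mf; apply: cmeasM; [apply: cmeas_cexp; exact: mF|exact: mdF].
- by move=> z Dz; apply: chol_cexp; exact: hF.
Qed.

Lemma holX D F n : hol D F -> hol D (fun w => F w ^+ n).
Proof.
move=> hF; elim: n => [|n ih]; first exact: hol_cst.
by under eq_fun do rewrite exprS; exact: holM.
Qed.

Lemma hol_prod D (F : nat -> R[i] -> R[i]) n : (forall i, hol D (F i)) ->
  hol D (fun w => \prod_(i < n) F i w).
Proof.
move=> hF; elim: n => [|n ih].
  by under eq_fun do rewrite big_ord0; exact: hol_cst.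
by under eq_fun do rewrite big_ord_recr /=; exact: holM.
Qed.

Lemma hol_sub D D' F : D' `<=` D -> hol D F -> hol D' F.
Proof. by move=> sD [dF [mF mdF hF]]; exists dF; split => // z /sD; exact: hF. Qed.

End Holomorphic.

Section AlmostEqual.
Context {R : realType}.
Local Notation leb := (@lebesgue_measure R).

(** Measurability of [g] is part of the conclusion, since [g] is often known only through its
    agreement with [f] off a vertex or some crossing points. The induction changes [f] at one point
    at a time. *)
Lemma Rintegral_eq_off (s : seq R) (f g : R -> R) : measurable_fun setT f ->
  (forall x, x \notin s -> f x = g x) ->
  measurable_fun setT g /\ \int[leb]_x f x = \int[leb]_x g x.
Proof.
elim: s f => [|p s ih] f mf fg.
  by have -> : g = f by apply/funext => x; rewrite fg.
pose f' x := if x == p then g p else f x.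
have mf' : measurable_fun setT f'.
  apply: measurable_fun_ifT => //.
  exact: (measurable_fun_eqr (@measurable_id _ _ setT) (@measurable_cst _ _ _ _ setT p)).
have [mg <-] : measurable_fun setT g /\ \int[leb]_x f' x = \int[leb]_x g x.
  apply: ih => // x xs; rewrite /f'; case: eqP => [->//|/eqP xp].
  by rewrite fg // inE negb_or xp.
split=> //; rewrite /Rintegral; congr fine.
apply: ae_eq_integral => //; [exact/measurable_EFinP..|].
exists [set p]; split => //; first exact: lebesgue_measure_set1.
move=> x /= /not_implyP[_]; rewrite /f'; by case: eqP => // _ [].
Qed.

Lemma Cintegral_eq_off (s : seq R) (f g : R -> R[i]) : cmeas setT f ->
  (forall x, x \notin s -> f x = g x) ->
  Cintegral leb setT f = Cintegral leb setT g.
Proof.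
move=> [m1 m2] fg; rewrite /Cintegral; congr (_ +i* _).
- by apply: (Rintegral_eq_off (s := s) _ _).2 => // x xs; rewrite fg.
- by apply: (Rintegral_eq_off (s := s) _ _).2 => // x xs; rewrite fg.
Qed.

End AlmostEqual.

(** * Weights with inverse square-root singularities *)

Section Isq.
Context {R : realType}.
Local Notation leb := (@lebesgue_measure R).

(* The value at 0 is the junk value 0. *)
Definition isq (x : R) : R := (Num.sqrt `|x|)^-1.

Lemma isq_ge0 x : 0 <= isq x. Proof. by rewrite invr_ge0 sqrtr_ge0. Qed.

Lemma isqN x : isq (- x) = isq x. Proof. by rewrite /isq normrN. Qed.

Lemma measurable_isq : measurable_fun setT isq.
Proof.
apply: (measurableT_comp (@measurable_inv R)).
apply: (measurableT_comp (continuous_measurable_fun (@sqrt_continuous R))).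
exact: normr_measurable.
Qed.

Lemma isq_le1 x : 1 <= `|x| -> isq x <= 1.
Proof.
move=> x1; rewrite /isq invf_le1 ?sqrtr_gt0 ?(lt_le_trans ltr01)//.
by rewrite -[leLHS]sqrtr1 ler_wsqrtr.
Qed.

(** The piece of [isq (x - c)] on the unit interval to the right of [c]. The left piece is the
    reflection [isqr (- c) (- x)], so that only one improper integral has to be studied. *)
Definition isqr (c x : R) : R := if (c < x) && (x <= c + 1) then isq (x - c) else 0.

Lemma isqr_ge0 c x : 0 <= isqr c x.
Proof. by rewrite /isqr; case: ifP => // _; exact: isq_ge0. Qed.

Lemma measurable_isqr c : measurable_fun setT (isqr c).
Proof.
apply: measurable_fun_ifT; last exact: measurable_cst.
  by apply: measurable_and; [apply: measurable_fun_ltr|apply: measurable_fun_ler];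
    (exact: measurable_id || exact: measurable_cst).
apply: (measurableT_comp measurable_isq).
by apply: measurable_funB; [exact: measurable_id|exact: measurable_cst].
Qed.

(** The primitive [2 * Num.sqrt (x - c)] bounds by 2 the integral over the interval from
    [c + n.+1%:R^-1] to [c + 1]; monotone convergence then reaches the singular end. *)
Lemma integrable_isqr c : leb.-integrable setT (EFin \o isqr c).
Proof.
have misqr := @measurable_isqr c.
apply/integrableP; split; first exact/measurable_EFinP.
pose A n := `[c + n.+1%:R^-1, c + 1]%classic : set R.
have AE : \bigcup_n A n = `]c, c + 1]%classic.
  apply/seteqP; split=> [x [n _]|x] /=.
    rewrite /A /= !in_itv /= => /andP[cx ->]; rewrite andbT (lt_le_trans _ cx)//.
    by rewrite ltrDl invr_gt0.
  rewrite in_itv /= => /andP[cx x1].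
  have [n nx] := ltr_add_invr cx.
  by exists n => //; rewrite /A /= in_itv /= (ltW nx) x1.
have fA n : (\int[leb]_(x in A n) `|isqr c x|%:E <= 2%:E)%E.
  rewrite (_ : (\int[_]_(x in _) _)%E = (\int[leb]_(x in A n) (Num.sqrt (x - c))^-1%:E)%E); last first.
    apply: eq_integral => x; rewrite inE /A /= in_itv /= => /andP[cx x1].
    have cx' : c < x by rewrite (lt_le_trans _ cx)// ltrDl invr_gt0.
    by rewrite ger0_norm ?isqr_ge0 // /isqr cx' x1 /= /isq gtr0_norm // subr_gt0.
  have [n1|] := leP (c + n.+1%:R^-1) (c + 1); last first.
    by move=> n1; rewrite /A set_itv_ge ?integral_set0 ?lee_fin// -leNgt // ltW.
  have pos x : c + n.+1%:R^-1 <= x <= c + 1 -> 0 < x - c.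
    by move=> /andP[cx _]; rewrite subr_gt0 (lt_le_trans _ cx)// ltrDl invr_gt0.
  have cv x : c + n.+1%:R^-1 <= x <= c + 1 -> (fun x => (Num.sqrt (x - c))^-1) @ x --> (Num.sqrt (x - c))^-1.
    move=> /pos x0; apply: cvgV; first by rewrite gt_eqF // sqrtr_gt0.
    apply: continuous_cvg; first exact: sqrt_continuous.
    by apply: cvgB => //; exact: cvg_cst.
  have dF x : c + n.+1%:R^-1 <= x <= c + 1 ->
      is_derive x (1 : R) (fun x => 2 * Num.sqrt (x - c)) (Num.sqrt (x - c))^-1.
    move=> /pos x0.
    have d1 := derB (der_id x) (der_cst c x).
    have d2 := @der_comp _ Num.sqrt (fun x : R => x - c) x _ _ (is_derive1_sqrt x0) d1.
    have d3 := @derM _ (fun=> 2) (fun x : R => Num.sqrt (x - c)) x _ _ (der_cst 2 x) d2.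
    apply: (is_derive_eq d3).
    by rewrite mul0r addr0 subr0 mulr1 invfM mulrA divff ?mul1r.
  have iA := rintegrable_continuous cv.
  have := Rintegral_FTC n1 dF cv; rewrite /Rintegral => H.
  rewrite -[leLHS]fineK; last exact: (integrable_fin_num _ iA).
  rewrite H.
  rewrite lee_fin addrAC subrr add0r sqrtr1 mulr1 gerBl.
  by rewrite mulr_ge0 // sqrtr_ge0.
have cvA : (\int[leb]_(x in A n) `|isqr c x|%:E)%E @[n --> \oo] -->
    (\int[leb]_(x in \bigcup_n A n) `|isqr c x|%:E)%E.
  apply: ge0_nondecreasing_set_cvg_integral.
  - apply/nondecreasing_seqP => n; apply/subsetPset => x; rewrite /A /= !in_itv /=.
    move=> /andP[cx ->]; rewrite andbT (le_trans _ cx)// lerD2l lef_pV2 ?posrE//.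
    by rewrite ler_nat.
  - by move=> n; exact: measurable_itv.
  - move=> n; apply/measurable_EFinP; apply: measurable_funTS.
    exact: (measurableT_comp (@normr_measurable R setT)).
  - by move=> n x _; rewrite lee_fin.
have le2 : (\int[leb]_(x in \bigcup_n A n) `|isqr c x|%:E <= 2%:E)%E.
  by apply: cvge_le cvA; near=> n; exact: fA.
apply: le_lt_trans (ltry 2); apply: le_trans le2.
rewrite AE [leRHS]integral_mkcond; apply: ge0_le_integral => //.
- by apply/measurable_EFinP; apply: (measurableT_comp (@normr_measurable R setT)).
- apply/(measurable_restrictT (fun x => `|isqr c x|%:E)) => //.
  apply/measurable_EFinP; apply: measurable_funTS.
  exact: (measurableT_comp (@normr_measurable R setT)).
- move=> x _; rewrite patchE; case: ifPn => // xn.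
  rewrite /= /isqr ifF ?normr0//.
  by apply: contraNF xn; rewrite inE /= in_itv.
Unshelve. all: by end_near. Qed.

End Isq.

Section Weights.
Context {R : realType}.
Local Notation leb := (@lebesgue_measure R).

Lemma isq_le (c x : R) : isq (x - c) <= 1 + (isqr c x + isqr (- c) (- x)).
Proof.
have [h|h] := leP 1 `|x - c|.
  by rewrite (le_trans (isq_le1 h)) // lerDl addr_ge0 ?isqr_ge0.
move: h; rewrite ltr_norml => /andP[h1 h2].
have [xc|cx] := leP x c; last first.
  have -> : isqr c x = isq (x - c) by rewrite /isqr cx /= ifT //; lra.
  have := isqr_ge0 (- c) (- x); lra.
have [->|xc'] := eqVneq x c.
  rewrite subrr /isq normr0 sqrtr0 invr0.
  have := isqr_ge0 (- c) (- c); have := isqr_ge0 c c; lra.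
have -> : isqr (- c) (- x) = isq (x - c).
  rewrite /isqr ifT; first by rewrite -isqN; congr isq; ring.
  rewrite ltrN2 lt_neqAle xc' xc /=; lra.
have := isqr_ge0 c x; lra.
Qed.

Lemma integrable_isqrN (c : R) : leb.-integrable setT (fun x => (isqr (- c) (- x))%:E).
Proof. by apply: (@integrable_opp R (isqr (- c))); exact: integrable_isqr. Qed.

Lemma integrable_isq (a b c : R) : leb.-integrable `[a, b] (fun x => (isq (x - c))%:E).
Proof.
have mD : measurable (`[a, b]%classic : set (measurableTypeR R)) by exact: measurable_itv.
have i1 : leb.-integrable `[a, b] (EFin \o (fun x => isqr c x + isqr (- c) (- x))).
  apply: (@integrableS _ _ _ leb setT) => //.
  exact: (rintegrableD measurableT (integrable_isqr c) (integrable_isqrN c)).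
have i0 : leb.-integrable `[a, b] (EFin \o (fun=> 1)).
  by apply: rintegrable_continuous => x _; exact: cvg_cst.
apply: (integrable_le_real mD _ _ (rintegrableD mD i0 i1)).
- apply: measurable_funTS; apply: (measurableT_comp measurable_isq).
  by apply: measurable_funB; [exact: measurable_id|exact: measurable_cst].
- by move=> x _; rewrite ger0_norm ?isq_ge0 // isq_le.
Qed.

Lemma measurable_expRabs : measurable_fun setT (fun s : R => expR (- `|s|)).
Proof.
apply: (measurableT_comp (@measurable_expR R)); apply: measurable_funN.
exact: normr_measurable.
Qed.

Lemma integrable_expRabs : leb.-integrable setT (fun s => (expR (- `|s|))%:E).
Proof.
have i1 := integrable_exponential_pdf (@ltr01 R).
have i2 := integrable_opp i1.
apply: (@integrable_le_real _ _ _ leb _ measurableT _ _ _ _ (rintegrableD measurableT i1 i2)) => [|s _].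
  exact: measurable_expRabs.
rewrite ger0_norm ?expR_ge0 //.
have [s0|s0] := leP 0 s.
  rewrite [X in _ <= X + _]exponential_pdfE //= mul1r mulN1r ger0_norm // lerDl.
  by rewrite exponential_pdf_ge0.
rewrite [X in _ <= _ + X]exponential_pdfE ?oppr_ge0 ?(ltW s0)//= mul1r mulN1r ltr0_norm // lerDr.
by rewrite exponential_pdf_ge0.
Qed.

Definition wexp (d s : R) : R := expR (- `|s|) * isq (`|s| - d).

Lemma wexp_ge0 d s : 0 <= wexp d s.
Proof. by rewrite mulr_ge0 ?expR_ge0 ?isq_ge0. Qed.

Lemma measurable_wexp d : measurable_fun setT (wexp d).
Proof.
apply: measurable_funM; first exact: measurable_expRabs.
apply: (measurableT_comp measurable_isq).
by apply: measurable_funB; [exact: normr_measurable|exact: measurable_cst].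
Qed.

Lemma integrable_wexp d : leb.-integrable setT (fun s => (wexp d s)%:E).
Proof.
have i1 := rintegrableD measurableT (integrable_isqr d) (integrable_isqrN d).
have i2 := rintegrableD measurableT (integrable_isqr (- d)) (integrable_isqrN (- d)).
have i3 := rintegrableD measurableT integrable_expRabs (rintegrableD measurableT i1 i2).
apply: (@integrable_le_real _ _ _ leb _ measurableT _ _ _ _ i3) => [|s _].
  exact: measurable_wexp.
rewrite ger0_norm ?wexp_ge0 // /wexp.
have e1 : expR (- `|s|) <= 1 by rewrite -expR0 ler_expR oppr_le0.
have e0 : 0 <= expR (- `|s|) by exact: expR_ge0.
have k1 := isqr_ge0 d s; have k2 := isqr_ge0 (- d) (- s).
have k3 := isqr_ge0 (- d) s; have k4 := isqr_ge0 (- - d) (- s).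
(* This replaces a product of weights by a sum, whose terms are already known to be integrable. *)
have H (e A q : R) : 0 <= e -> e <= 1 -> 0 <= A -> q <= 1 + A -> e * q <= e + A.
  move=> ? ? ? ?; apply: (@le_trans _ _ (e * (1 + A))); first by rewrite ler_wpM2l.
  by rewrite mulrDr mulr1 lerD2l ler_piMl.
have [s0|s0] := leP 0 s.
  have := isq_le d s; rewrite (ger0_norm s0) in e1 e0 *.
  by move=> /(H _ _ _ e0 e1 (addr_ge0 k1 k2)) h; lra.
have := isq_le (- d) s; rewrite -isqN.
rewrite (_ : - (s - - d) = `|s| - d); last by rewrite ltr0_norm //; ring.
by move=> /(H _ _ _ e0 e1 (addr_ge0 k3 k4)) h; lra.
Qed.

End Weights.

Section Rectangle.
Context {R : realType}.

Definition rect (u0 u1 y0 y1 : R) (z : R * R) : bool :=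
  (u0 <= z.1 <= u1) && (y0 <= z.2 <= y1).

Lemma measurable_rect u0 u1 y0 y1 : measurable_fun setT (rect u0 u1 y0 y1).
Proof.
apply: measurable_and; apply: measurable_and; apply: measurable_fun_ler;
  (exact: measurable_cst || exact: measurable_fst || exact: measurable_snd).
Qed.

Lemma rect_bounded (f : R * R -> R) u0 u1 y0 y1 :
  (forall z, rect u0 u1 y0 y1 z -> f @ z --> f z) ->
  exists2 M, 0 < M & forall z, rect u0 u1 y0 y1 z -> `|f z| <= M.
Proof.
move=> cf.
have cK : compact (`[u0, u1]%classic `*` `[y0, y1]%classic : set (R * R)).
  by apply: compact_setX; exact: segment_compact.
have rK z : (`[u0, u1]%classic `*` `[y0, y1]%classic) z <-> rect u0 u1 y0 y1 z.
  by rewrite /rect /= !in_itv /=; split=> [[-> ->]|/andP[-> ->]].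
have cfK : {within (`[u0, u1]%classic `*` `[y0, y1]%classic : set (R * R)), continuous f}.
  by apply: continuous_in_subspaceT => z; rewrite inE => /rK; exact: cf.
have := compact_bounded (continuous_compact cfK cK).
move=> [M [Mr hM]].
exists (`|M| + 1); first by rewrite ltr_pwDr.
move=> z /rK rz; apply: (hM (`|M| + 1)); first by rewrite ltr_pwDr // ler_norm.
by exists z.
Qed.

Lemma integrable_rect_bounded (f : R * R -> R) u0 u1 y0 y1 M :
  measurable_fun setT f ->
  (forall z, rect u0 u1 y0 y1 z -> `|f z| <= M) ->
  (leb2 R).-integrable setT (fun z => (if rect u0 u1 y0 y1 z then f z else 0)%:E).
Proof.
move=> mf fM.
have ic a b : (@lebesgue_measure R).-integrable setT (EFin \o \1_(`[a, b]%classic : set R)).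
  apply/integrableP; split; first exact/measurable_EFinP/measurable_indic.
  under eq_integral do rewrite /= ger0_norm //.
  by rewrite integral_indic //= setIT lebesgue_measure_itv /=; case: ifP => _; rewrite ?ltry.
have i0 (A : set (measurableTypeR R)) x : 0 <= \1_A x :> R by rewrite indicE.
have ii := @integrable_prod_mul _ _ _ (measurableTypeR R) (measurableTypeR R)
  (@lebesgue_measure R) (@lebesgue_measure R) _ _ (i0 _) (i0 _) (ic u0 u1) (ic y0 y1).
have iM := rintegrableZ measurableT M ii.
apply: (@integrable_le_real _ _ _ (leb2 R) _ measurableT _ _ _ _ iM) => [|z _].
  by apply: measurable_fun_ifT => //; exact: measurable_rect.
rewrite !indicE !mem_setE /= !in_itv /=; case: ifPn => [rz|].
  by move: (rz); rewrite /rect => /andP[-> ->]; rewrite !mulr1; exact: fM.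
rewrite /rect negb_and normr0 => /orP[/negbTE ->|/negbTE ->];
  by rewrite ?mul0r ?mulr0 ?mul0r ?mulr0.
Qed.

End Rectangle.

(** * Cauchy's theorem on parallelograms *)

Section Green.
Context {R : realType}.
Local Notation leb := (@lebesgue_measure R).

Local Notation TR := (measurableTypeR R).
Definition leb_prod12 := @Rintegral_prod12 R _ _ TR TR leb leb.
Definition leb_prod21 := @Rintegral_prod21 R _ _ TR TR leb leb.
Definition measurable_leb_prod2 := @measurable_Rintegral_prod2 R _ _ TR TR leb leb.

Lemma Rintegral_if (P : R -> bool) (f : R -> R) a b :
  (forall x, P x = (a <= x <= b)) ->
  \int[leb]_x (if P x then f x else 0) = \int[leb]_(x in `[a, b]) f x.
Proof.
move=> Pab; rewrite [RHS]Rintegral_mkcond; apply: eq_Rintegral => x _.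
by rewrite patchE mem_setE in_itv /= Pab.
Qed.

(* The abscissa [us] and the ordinate [ys] are exempted so that a pole may sit at [(us, ys)]. *)
Lemma green (P Q h : R -> R -> R) (u0 u1 y0 y1 us ys : R) :
  u0 <= u1 -> y0 <= y1 ->
  (leb2 R).-integrable setT
    (fun z => (if rect u0 u1 y0 y1 z then h z.1 z.2 else 0)%:E) ->
  (forall u y, u0 <= u <= u1 -> y0 <= y <= y1 -> y != ys ->
    is_derive u (1 : R) (P^~ y) (h u y) /\ (h^~ y) @ u --> h u y) ->
  (forall u y, u0 <= u <= u1 -> y0 <= y <= y1 -> u != us ->
    is_derive y (1 : R) (Q u) (h u y) /\ h u @ y --> h u y) ->
  \int[leb]_(y in `[y0, y1]) (P u1 y - P u0 y) =
  \int[leb]_(u in `[u0, u1]) (Q u y1 - Q u y0).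
Proof.
move=> u01 y01 iH dP dQ.
pose H z := if rect u0 u1 y0 y1 z then h z.1 z.2 else 0.
(* [h] is the derivative of [P] in [u] and that of [Q] in [y]; the two orders of integration give
   the two sides. *)
have H12 := @leb_prod12 H iH.
have H21 := @leb_prod21 H iH.
have m12 : measurable_fun setT (fun u => \int[leb]_y H (u, y)).
  have := @measurable_fubini_F _ _ TR TR R leb leb (EFin \o H) iH.
  exact: (measurableT_comp (@fine_measurable R setT measurableT)).
have m21 := @measurable_leb_prod2 H iH.
rewrite -(Rintegral_if (P := fun y => y0 <= y <= y1)) //.
rewrite -(Rintegral_if (P := fun u => u0 <= u <= u1)) //.
have <- := (Rintegral_eq_off (s := [:: us]) m12
  (g := fun u => if u0 <= u <= u1 then Q u y1 - Q u y0 else 0) _).2; last first.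
  move=> u; rewrite inE => uus.
  case: ifPn => uI; last first.
    rewrite (_ : (fun y => _) = cst 0) ?Rintegral_cst ?mul0r//.
    by apply/funext => y; rewrite /H /rect /= (negbTE uI).
  rewrite -(Rintegral_FTC y01 (fun y yI => (dQ u y uI yI uus).1)
    (fun y yI => (dQ u y uI yI uus).2)).
  rewrite -(Rintegral_if (P := fun y => y0 <= y <= y1)) //.
  by apply: eq_Rintegral => y _; rewrite /H /rect /= uI.
have <- := (Rintegral_eq_off (s := [:: ys]) m21
  (g := fun y => if y0 <= y <= y1 then P u1 y - P u0 y else 0) _).2; last first.
  move=> y; rewrite inE => yys.
  case: ifPn => yI; last first.
    rewrite (_ : (fun y => _) = cst 0) ?Rintegral_cst ?mul0r//.
    by apply/funext => u; rewrite /H /rect /= (negbTE yI) andbF.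
  rewrite -(@Rintegral_FTC _ (P^~ y) (h^~ y) _ _ u01 (fun u uI => (dP u y uI yI yys).1)
    (fun u uI => (dP u y uI yI yys).2)).
  rewrite -(Rintegral_if (P := fun u => u0 <= u <= u1)) //.
  by apply: eq_Rintegral => u _; rewrite /H /rect /= yI andbT.
by rewrite -H12 -H21.
Qed.

End Green.

(** * Domination off finitely many lines *)

Section OffLines.
Context {R : realType}.
Local Notation leb := (@lebesgue_measure R).
Local Notation TR := (measurableTypeR R).

Lemma lebesgue_seq0 (s : seq R) : leb [set x | x \in s] = 0%E.
Proof. by apply: countable_lebesgue_measure0; apply: finite_set_countable; exact: finite_seq. Qed.

Lemma measurable_seq (s : seq R) : measurable ([set x | x \in s] : set TR).
Proof.
elim: s => [|a s ih]; first by rewrite (_ : [set x | _] = set0)// -subset0 => x.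
rewrite (_ : [set x | _] = [set a] `|` [set x | x \in s]); first exact: measurableU.
apply/seteqP; split => x /=; rewrite inE; first by case/orP => [/eqP ->|xs]; [left|right].
by case=> [->|->]; rewrite ?eqxx ?orbT.
Qed.

Lemma negligible_lines (s t : seq R) : exists N : set (TR * TR),
  [/\ measurable N, leb2 R N = 0%E & forall z, ~ N z -> z.1 \notin s /\ z.2 \notin t].
Proof.
pose N1 : set (TR * TR) := [set x | x \in s] `*` setT.
pose N2 : set (TR * TR) := setT `*` [set x | x \in t].
have mN1 : measurable N1 by apply: measurableX => //; exact: measurable_seq.
have mN2 : measurable N2 by apply: measurableX => //; exact: measurable_seq.
exists (N1 `|` N2); split; first exact: measurableU.
- have N10 : leb2 R N1 = 0%E.
    rewrite product_measure1E //; last exact: measurable_seq.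
    by rewrite [X in (X * _)%E]lebesgue_seq0 mul0e.
  have N20 : leb2 R N2 = 0%E.
    rewrite product_measure1E //; last exact: measurable_seq.
    by rewrite [X in (_ * X)%E]lebesgue_seq0 mule0.
  by rewrite measureU0.
- move=> z /not_orP[n1 n2]; split.
    by apply/negP => z1; apply: n1; split.
  by apply/negP => z2; apply: n2; split.
Qed.

Lemma ae_off_lines (s t : seq R) (P : R * R -> Prop) :
  (forall z, z.1 \notin s -> z.2 \notin t -> P z) -> \forall z \ae leb2 R, P z.
Proof.
move=> hP; have [N [mN N0 hN]] := negligible_lines s t; exists N; split=> //.
by move=> z /=; apply: contra_notP => /hN[]; exact: hP.
Qed.

Lemma integrable2_off (s t : seq R) (f g : R * R -> R) : measurable_fun setT f ->
  (leb2 R).-integrable setT (EFin \o g) ->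
  (forall z, z.1 \notin s -> z.2 \notin t -> `|f z| <= g z) ->
  (leb2 R).-integrable setT (EFin \o f).
Proof.
move=> mf ig fg; have [N [mN N0 hN]] := negligible_lines s t.
apply/(negligible_integrable mN) => //; first exact/measurable_EFinP.
have mD : measurable (setT `\` N) by exact: measurableD.
apply: (@integrable_le_real _ _ _ (leb2 R) _ mD f g).
- exact: measurable_funTS.
- by move=> z [_ /hN[]]; exact: fg.
- exact: (integrableS measurableT).
Qed.

End OffLines.

Section ComplexGreen.
Context {R : realType}.
Local Notation leb := (@lebesgue_measure R).
Local Notation Re := (@complex.Re R).
Local Notation Im := (@complex.Im R).

(** A bilinear patch. With [s = 0] it is a parallelogram; a nonzero [s] allows one side to shrink to
    a point, which gives the triangles of [wint_vint]. *)
Definition bilin (p q r s : R[i]) (u y : R) : R[i] :=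
  p + u%:C * q + y%:C * (r + u%:C * s).

Lemma cder_bilin1 p q r s u y : cder (fun u => bilin p q r s u y) (q + y%:C * s) u.
Proof.
have -> : (fun u => bilin p q r s u y) = (fun u => (p + y%:C * r) + u%:C * (q + y%:C * s)).
  by apply/funext => v; rewrite /bilin; ring.
exact: cder_lin.
Qed.

Lemma cder_bilin2 p q r s u y : cder (bilin p q r s u) (r + u%:C * s) y.
Proof. exact: cder_lin. Qed.

(** With [gam_u = q + y s] and [gam_y = r + u s], the function [h] is both the derivative of
    [g(gam) gam_y] in [u] and that of [g(gam) gam_u] in [y]. Green's formula is applied to its real
    and imaginary parts. *)
Lemma cgreen (p q r s : R[i]) (g dg : R[i] -> R[i]) (u0 u1 y0 y1 us ys : R) :
  let gam := bilin p q r s in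
  let h u y := dg (gam u y) * (q + y%:C * s) * (r + u%:C * s) + g (gam u y) * s in
  u0 <= u1 -> y0 <= y1 ->
  (forall u y, u0 <= u <= u1 -> y0 <= y <= y1 -> (u != us) || (y != ys) ->
    chol g dg (gam u y)) ->
  Cintegrable (leb2 R) setT (fun z => if rect u0 u1 y0 y1 z then h z.1 z.2 else 0) ->
  Cintegral leb `[y0, y1]
    (fun y => g (gam u1 y) * (r + u1%:C * s) - g (gam u0 y) * (r + u0%:C * s)) =
  Cintegral leb `[u0, u1]
    (fun u => g (gam u y1) * (q + y1%:C * s) - g (gam u y0) * (q + y0%:C * s)).
Proof.
move=> gam h u01 y01 gh [iR iI].
pose P u y := g (gam u y) * (r + u%:C * s).
pose Q u y := g (gam u y) * (q + y%:C * s).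
have cr (T : topologicalType) (f : T -> R) (x : T) : f @ x --> f x -> ccont (fun y => (f y)%:C) x.
  exact: ccont_real.
have dP u y : u0 <= u <= u1 -> y0 <= y <= y1 -> (u != us) || (y != ys) ->
    cder (P^~ y) (h u y) u /\ ccont (h^~ y) u.
  move=> uI yI uy; have [gd gc gdc] := gh u y uI yI uy.
  have gmc : ccont (gam^~ y) u.
    apply: ccontD; first apply: ccontD.
    - exact: ccont_cst.
    - by apply: ccontM; [apply: cr|exact: ccont_cst].
    - apply: ccontM; first exact: ccont_cst.
      by apply: ccontD; [exact: ccont_cst|apply: ccontM; [apply: cr|exact: ccont_cst]].
  split.
  - have d1 := gd (gam^~ y) u _ erefl (cder_bilin1 p q r s u y).
    apply: cder_eq; first exact: (cderM d1 (cder_lin r s u)).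
    by rewrite /h; ring.
  - apply: ccontD; last by apply: ccontM; [exact: gc|exact: ccont_cst].
    apply: ccontM; first by apply: ccontM; [exact: gdc|exact: ccont_cst].
    by apply: ccontD; [exact: ccont_cst|apply: ccontM; [apply: cr|exact: ccont_cst]].
have dQ u y : u0 <= u <= u1 -> y0 <= y <= y1 -> (u != us) || (y != ys) ->
    cder (Q u) (h u y) y /\ ccont (h u) y.
  move=> uI yI uy; have [gd gc gdc] := gh u y uI yI uy.
  have gmc : ccont (gam u) y.
    by apply: ccontD; [exact: ccont_cst|apply: ccontM; [apply: cr|exact: ccont_cst]].
  split.
  - have d1 := gd (gam u) y _ erefl (cder_bilin2 p q r s u y).
    apply: cder_eq; first exact: (cderM d1 (cder_lin q s y)).
    by rewrite /h; ring.
  - apply: ccontD; last by apply: ccontM; [exact: gc|exact: ccont_cst].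
    apply: ccontM; last exact: ccont_cst.
    apply: ccontM; first exact: gdc.
    by apply: ccontD; [exact: ccont_cst|apply: ccontM; [apply: cr|exact: ccont_cst]].
rewrite /Cintegral; congr (_ +i* _).
- have := @green R (fun u y => Re (P u y)) (fun u y => Re (Q u y)) (fun u y => Re (h u y))
    u0 u1 y0 y1 us ys u01 y01.
  rewrite -/(P _ _) -/(Q _ _) => H.
  under eq_Rintegral do rewrite cReD cReN.
  under [RHS]eq_Rintegral do rewrite cReD cReN.
  apply: H.
  + by move: iR; congr (_.-integrable _ _); apply/funext => z; case: ifP.
  + move=> u y uI yI yys; have [|[d _] [c _]] := dP u y uI yI; first by rewrite yys orbT.
    by split.
  + move=> u y uI yI uus; have [|[d _] [c _]] := dQ u y uI yI; first by rewrite uus.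
    by split.
- have := @green R (fun u y => Im (P u y)) (fun u y => Im (Q u y)) (fun u y => Im (h u y))
    u0 u1 y0 y1 us ys u01 y01.
  rewrite -/(P _ _) -/(Q _ _) => H.
  under eq_Rintegral do rewrite cImD cImN.
  under [RHS]eq_Rintegral do rewrite cImD cImN.
  apply: H.
  + by move: iI; congr (_.-integrable _ _); apply/funext => z; case: ifP.
  + move=> u y uI yI yys; have [|[_ d] [_ c]] := dP u y uI yI; first by rewrite yys orbT.
    by split.
  + move=> u y uI yI uus; have [|[_ d] [_ c]] := dQ u y uI yI; first by rewrite uus.
    by split.
Qed.

End ComplexGreen.

Section CauchyRectangle.
Context {R : realType}.
Local Notation leb := (@lebesgue_measure R).
Local Notation Re := (@complex.Re R).
Local Notation Im := (@complex.Im R).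

Lemma cmeas_bilin (p q r s : R[i]) : cmeas setT (fun z : R * R => bilin p q r s z.1 z.2).
Proof.
apply: cmeasD; first apply: cmeasD; first exact: cmeas_cst.
- by apply: cmeasM; [apply: cmeas_real; exact: measurable_fst|exact: cmeas_cst].
- apply: cmeasM; first by apply: cmeas_real; exact: measurable_snd.
  apply: cmeasD; first exact: cmeas_cst.
  by apply: cmeasM; [apply: cmeas_real; exact: measurable_fst|exact: cmeas_cst].
Qed.

Lemma ccont_fst (z : R * R) : ccont (fun z : R * R => z.1%:C) z.
Proof. by apply: ccont_real; exact: cvg_fst. Qed.

Lemma ccont_snd (z : R * R) : ccont (fun z : R * R => z.2%:C) z.
Proof. by apply: ccont_real; exact: cvg_snd. Qed.

Lemma ccont_bilin (p q r s : R[i]) z : ccont (fun z : R * R => bilin p q r s z.1 z.2) z.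
Proof.
apply: ccontD; first apply: ccontD; first exact: ccont_cst.
- by apply: ccontM; [exact: ccont_fst|exact: ccont_cst].
- apply: ccontM; first exact: ccont_snd.
  apply: ccontD; first exact: ccont_cst.
  by apply: ccontM; [exact: ccont_fst|exact: ccont_cst].
Qed.

Lemma crect_bounded (f : R * R -> R[i]) u0 u1 y0 y1 :
  (forall z, rect u0 u1 y0 y1 z -> ccont f z) ->
  exists2 M, 0 < M & forall z, rect u0 u1 y0 y1 z -> nm (f z) <= M.
Proof.
move=> cf.
have [M M0 hM] := @rect_bounded R (fun z => Re (f z)) u0 u1 y0 y1 (fun z rz => (cf z rz).1).
have [N N0 hN] := @rect_bounded R (fun z => Im (f z)) u0 u1 y0 y1 (fun z rz => (cf z rz).2).
exists (M + N); first exact: addr_gt0.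
by move=> z rz; rewrite (le_trans (nm_le _)) // lerD ?hM ?hN.
Qed.

(** Here the common derivative [h] is continuous on a compact rectangle, hence bounded and
    integrable. *)
Lemma cauchy_rect (D : set R[i]) (p q r s : R[i]) (G : R[i] -> R[i]) (u0 u1 y0 y1 : R) :
  hol D G ->
  let gam := bilin p q r s in
  u0 <= u1 -> y0 <= y1 ->
  (forall u y, u0 <= u <= u1 -> y0 <= y <= y1 -> D (gam u y)) ->
  Cintegral leb `[y0, y1]
    (fun y => G (gam u1 y) * (r + u1%:C * s) - G (gam u0 y) * (r + u0%:C * s)) =
  Cintegral leb `[u0, u1]
    (fun u => G (gam u y1) * (q + y1%:C * s) - G (gam u y0) * (q + y0%:C * s)).
Proof.
move=> [dG [mG mdG hG]] gam u01 y01 Dg.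
apply: (cgreen (dg := dG) (us := 0) (ys := 0)) => // [u y uI yI _|].
  by apply: hG; exact: Dg.
pose h (z : R * R) := dG (gam z.1 z.2) * (q + z.2%:C * s) * (r + z.1%:C * s) + G (gam z.1 z.2) * s.
have mh : cmeas setT h.
  have mgam := @cmeas_bilin p q r s.
  apply: cmeasD; last by apply: cmeasM; [exact: mG|exact: cmeas_cst].
  apply: cmeasM; first (apply: cmeasM; first exact: mdG).
  - apply: cmeasD; first exact: cmeas_cst.
    by apply: cmeasM; [apply: cmeas_real; exact: measurable_snd|exact: cmeas_cst].
  - apply: cmeasD; first exact: cmeas_cst.
    by apply: cmeasM; [apply: cmeas_real; exact: measurable_fst|exact: cmeas_cst].
have [M M0 hM] : exists2 M, 0 < M & forall z, rect u0 u1 y0 y1 z -> nm (h z) <= M.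
  apply: crect_bounded => z rz.
  have /hG[_ gc gdc] : D (gam z.1 z.2) by move/andP: rz => [? ?]; exact: Dg.
  have cgam := @ccont_bilin p q r s z.
  apply: ccontD; last by apply: ccontM; [exact: gc|exact: ccont_cst].
  apply: ccontM; first (apply: ccontM; first exact: gdc).
  - apply: ccontD; first exact: ccont_cst.
    by apply: ccontM; [exact: ccont_snd|exact: ccont_cst].
  - apply: ccontD; first exact: ccont_cst.
    by apply: ccontM; [exact: ccont_fst|exact: ccont_cst].
split.
- have := @integrable_rect_bounded R (fun z => Re (h z)) u0 u1 y0 y1 M mh.1
    (fun z rz => le_trans (nm_Re _) (hM z rz)).
  by congr (_.-integrable _ _); apply/funext => z; case: ifP.
- have := @integrable_rect_bounded R (fun z => Im (h z)) u0 u1 y0 y1 M mh.2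
    (fun z rz => le_trans (nm_Im _) (hM z rz)).
  by congr (_.-integrable _ _); apply/funext => z; case: ifP.
Qed.

(** The real mean value theorem is applied to each component along the segment from [W] to [Z],
    whence the factor 2. *)
Lemma nm_increment (G dG : R[i] -> R[i]) (W Z : R[i]) (M : R) :
  (forall t, 0 <= t <= 1 -> chol G dG (W + t%:C * (Z - W))) ->
  (forall t, 0 <= t <= 1 -> nm (dG (W + t%:C * (Z - W))) <= M) ->
  nm (G Z - G W) <= 2 * M * nm (Z - W).
Proof.
move=> cG bG; pose f t := G (W + t%:C * (Z - W)).
have df t : 0 <= t <= 1 -> cder f (dG (W + t%:C * (Z - W)) * (Z - W)) t.
  move=> tI; have [d _ _] := cG t tI.
  by apply: (d (fun t => W + t%:C * (Z - W))) => //; exact: cder_lin.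
have f1 : f 1 = G Z by rewrite /f mul1r addrC subrK.
have f0 : f 0 = G W by rewrite /f mul0r addr0.
have mvt (phi dphi : R -> R) : (forall t : R, 0 <= t <= 1 -> is_derive t (1 : R) phi (dphi t)) ->
    (forall t : R, 0 <= t <= 1 -> `|dphi t| <= M * nm (Z - W)) ->
    `|phi 1 - phi 0| <= M * nm (Z - W).
  move=> dp bp.
  have [c cI ->] : exists2 c : R, c \in `]0, 1[ & phi 1 - phi 0 = dphi c * (1 - 0).
    apply: MVT => //.
      by move=> t; rewrite in_itv /= => /andP[t0 t1]; apply: dp; rewrite !ltW.
    apply: continuous_in_subspaceT => t; rewrite inE /= in_itv /= => tI.
    apply: differentiable_continuous; apply/derivable1_diffP.
    by have [] := dp t tI.
  rewrite subr0 mulr1; apply: bp.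
  by move: cI; rewrite in_itv /= => /andP[c0 c1]; rewrite !ltW.
rewrite -f1 -f0 -mulrA mulr_natl mulr2n (le_trans (nm_le _)) // lerD // ?cReD ?cReN ?cImD ?cImN.
- apply: (mvt (fun t => Re (f t)) (fun t => Re (dG (W + t%:C * (Z - W)) * (Z - W)))).
    by move=> t /df[].
  move=> t tI; rewrite (le_trans (nm_Re _)) // nmM ler_wpM2r ?nm_ge0 //; exact: bG.
- apply: (mvt (fun t => Im (f t)) (fun t => Im (dG (W + t%:C * (Z - W)) * (Z - W)))).
    by move=> t /df[].
  move=> t tI; rewrite (le_trans (nm_Im _)) // nmM ler_wpM2r ?nm_ge0 //; exact: bG.
Qed.

(** This turns a separation estimate into domination by a product of one-variable functions, which
    Tonelli can integrate. *)
Lemma inv_nm_isq (x y n : R) : x != 0 -> y != 0 -> 0 < n -> `|x| * `|y| <= 4 * n ^+ 2 ->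
  n^-1 <= 2 * (isq x * isq y).
Proof.
move=> x0 y0 n0 h; rewrite /isq -invfM -sqrtrM ?normr_ge0//.
have xy0 : 0 < `|x| * `|y| by rewrite mulr_gt0 ?normr_gt0.
have : Num.sqrt (`|x| * `|y|) <= 2 * n.
  have -> : 2 * n = Num.sqrt ((2 * n) ^+ 2).
    by rewrite sqrtr_sqr ger0_norm // mulr_ge0 // ltW.
  by rewrite ler_wsqrtr //; rewrite exprMn; lra.
move=> hs; rewrite ler_pdivlMr ?sqrtr_gt0//.
by rewrite mulrC ler_pdivrMr.
Qed.

(** The singularity at [W] is removable, but the derivative of the difference quotient is only
    estimated by a multiple of 1 / |Z - W|. By [sep] this is dominated by a product of inverse
    square roots in the two parameters, so the common derivative is still integrable and [cgreen]
    applies with the two lines through [W] exempted. *)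
Lemma cauchy_rect_pole (D : set R[i]) (p r : R[i]) (G : R[i] -> R[i]) (u0 u1 y0 y1 us ys : R) :
  hol D G ->
  let gam := bilin p 1 r 0 in
  let W := gam us ys in
  let g Z := (G Z - G W) / (Z - W) in
  (forall x y, `|x| * `|y| <= 4 * nm (x%:C + y%:C * r) ^+ 2) -> nm r <= 1 ->
  u0 <= us <= u1 -> y0 <= ys <= y1 ->
  (forall u y, u0 <= u <= u1 -> y0 <= y <= y1 -> D (gam u y)) ->
  Cintegral leb `[y0, y1] (fun y => g (gam u1 y) * r - g (gam u0 y) * r) =
  Cintegral leb `[u0, u1] (fun u => g (gam u y1) - g (gam u y0)).
Proof.
move=> [dG [mG mdG hG]] gam W g sep r1 usI ysI Dg.
have u01 : u0 <= u1 by case/andP: usI; exact: le_trans.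
have y01 : y0 <= y1 by case/andP: ysI; exact: le_trans.
have gamB u y : gam u y - W = (u - us)%:C + (y - ys)%:C * r.
  by rewrite /W /gam /bilin !rmorphB; ring.
have r0 : r != 0.
  (* For [r = 0] this instance of [sep] would read [8 <= 4]. *)
  apply/eqP => r0; have := sep 1 8.
  rewrite r0 mulr0 addr0 nm_real normr1 expr1n mul1r mulr1 ger0_norm //; lra.
have nz u y : (u != us) || (y != ys) -> gam u y - W != 0.
  rewrite gamB -(subr_eq0 u) -(subr_eq0 y) => xy.
  have [y0'|y0'] := eqVneq (y - ys) 0.
    rewrite y0' mul0r addr0; move: xy; rewrite y0' eqxx orbF.
    by rewrite -nm_eq0 nm_real normr_eq0.
  have [x0'|x0'] := eqVneq (u - us) 0.
    by rewrite x0' add0r mulf_neq0 // -nm_eq0 nm_real normr_eq0.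
  apply/eqP => e0; have := sep (u - us) (y - ys).
  by rewrite e0 nm0 expr0n /= mulr0 leNgt mulr_gt0 ?normr_gt0.
pose dg Z := (G Z - G W) * (- 1 / (Z - W) ^+ 2) + dG Z * (Z - W)^-1.
have gE : g = fun Z => (G Z + - G W) * (Z + - W)^-1 by [].
have cg Z : D Z -> Z - W != 0 -> chol g dg Z.
  move=> DZ ZW.
  have c1 := cholD (hG Z DZ) (chol_cst (- G W) Z).
  have c2 := @cholV _ (fun w => w + - W) _ _ ZW (cholD (chol_id Z) (chol_cst (- W) Z)).
  apply: chol_ext (cholM c1 c2) => // Z'.
  by rewrite /dg !addr0.
have [M M0 hM] : exists2 M, 0 < M & forall z, rect u0 u1 y0 y1 z -> nm (dG (gam z.1 z.2)) <= M.
  apply: crect_bounded => z rz.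
  have /hG[_ _ gdc] : D (gam z.1 z.2) by move/andP: rz => [? ?]; exact: Dg.
  by apply: gdc => //; exact: ccont_bilin.
have inc u y : u0 <= u <= u1 -> y0 <= y <= y1 -> nm (G (gam u y) - G W) <= 2 * M * nm (gam u y - W).
  move=> uI yI.
  have seg t : 0 <= t <= 1 -> exists u' y', [/\ W + t%:C * (gam u y - W) = gam u' y',
      u0 <= u' <= u1 & y0 <= y' <= y1].
    move=> /andP[t0 t1]; exists (us + t * (u - us)), (ys + t * (y - ys)); split.
    - by rewrite gamB /W /gam /bilin !(rmorphD, rmorphM, rmorphN) /=; ring.
    - move: uI usI => /andP[h1 h2] /andP[h3 h4]; apply/andP; split; nra.
    - move: yI ysI => /andP[h1 h2] /andP[h3 h4]; apply/andP; split; nra.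
  apply: (@nm_increment _ dG) => t /seg[u' [y' [-> u'I y'I]]].
    by apply: hG; exact: Dg.
  by apply: (hM (u', y')); rewrite /rect u'I y'I.
have -> : (fun y => g (gam u1 y) * r - g (gam u0 y) * r) =
    (fun y => g (gam u1 y) * (r + u1%:C * 0) - g (gam u0 y) * (r + u0%:C * 0)).
  by apply/funext => y; rewrite !mulr0 !addr0.
have -> : (fun u => g (gam u y1) - g (gam u y0)) =
    (fun u => g (gam u y1) * (1 + y1%:C * 0) - g (gam u y0) * (1 + y0%:C * 0)).
  by apply/funext => y; rewrite !mulr0 !addr0 !mulr1.
apply: (@cgreen R p 1 r 0 g dg u0 u1 y0 y1 us ys u01 y01).
  + by move=> u y uI yI uy; apply: cg; [exact: Dg|exact: nz].
  + pose h (z : R * R) := dg (gam z.1 z.2) * (1 + z.2%:C * 0) * (r + z.1%:C * 0) + g (gam z.1 z.2) * 0.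
    have mgam := @cmeas_bilin p 1 r 0.
    have mG' : cmeas setT (fun z : R * R => G (gam z.1 z.2) - G W).
      by apply: cmeasB; [exact: mG|exact: cmeas_cst].
    have mW : cmeas setT (fun z : R * R => gam z.1 z.2 - W).
      by apply: cmeasB => //; exact: cmeas_cst.
    have mdg : cmeas setT (fun z : R * R => dg (gam z.1 z.2)).
      apply: cmeasD; apply: cmeasM => //.
      * by apply: cmeasM; [exact: cmeas_cst|apply: cmeasV; exact: cmeasX].
      * exact: mdG.
      * exact: cmeasV.
    have hE z : h z = dg (gam z.1 z.2) * r by rewrite /h; ring.
    have mh : cmeas setT h.
      rewrite (_ : h = fun z => dg (gam z.1 z.2) * r); last exact/funext.
      by apply: cmeasM => //; exact: cmeas_cst.
    have mrh : cmeas setT (fun z => if rect u0 u1 y0 y1 z then h z else 0).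
      have mr := measurable_rect u0 u1 y0 y1.
      split.
      * have -> : (fun z => Re (if rect u0 u1 y0 y1 z then h z else 0)) =
          (fun z => if rect u0 u1 y0 y1 z then Re (h z) else 0).
          by apply/funext => z; case: ifP.
        by apply: measurable_fun_ifT => //; exact: mh.1.
      * have -> : (fun z => Im (if rect u0 u1 y0 y1 z then h z else 0)) =
          (fun z => if rect u0 u1 y0 y1 z then Im (h z) else 0).
          by apply/funext => z; case: ifP.
        by apply: measurable_fun_ifT => //; exact: mh.2.
    pose k c a b x := if a <= x <= b then isq (x - c) else 0 : R.
    have k0 c a b x : 0 <= k c a b x by rewrite /k; case: ifP => // _; exact: isq_ge0.
    have ik c a b : leb.-integrable setT (EFin \o k c a b).
      have mab : measurable (`[a, b]%classic : set (measurableTypeR R)) by exact: measurable_itv.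
      have := (@integrable_mkcond _ _ _ leb _ _ mab).1 (integrable_isq a b c); congr (_.-integrable _ _).
      by apply/funext => x; rewrite patchE mem_setE in_itv /= /k; case: ifP.
    have ikk := @integrable_prod_mul _ _ _ (measurableTypeR R) (measurableTypeR R)
      leb leb _ _ (k0 us u0 u1) (k0 ys y0 y1) (ik us u0 u1) (ik ys y0 y1).
    have iM := rintegrableZ measurableT (12 * M) ikk.
    have bd z : z.1 \notin [:: us] -> z.2 \notin [:: ys] ->
        nm (if rect u0 u1 y0 y1 z then h z else 0) <= 12 * M * (k us u0 u1 z.1 * k ys y0 y1 z.2).
      rewrite !inE => z1 z2; case: ifPn => [rz|_]; last first.
        by rewrite nm0 !mulr_ge0 // ltW.
      move: (rz) => /andP[uI yI]; rewrite hE nmM /k uI yI.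
      have nz' : gam z.1 z.2 - W != 0 by apply: nz; rewrite z1.
      have n0 : 0 < nm (gam z.1 z.2 - W) by rewrite nm_gt0.
      have := @inv_nm_isq (z.1 - us) (z.2 - ys) (nm (gam z.1 z.2 - W)).
      rewrite !subr_eq0 => /(_ z1 z2 n0); rewrite {1}gamB => /(_ (sep _ _)).
      set n := nm _ in n0 *; set i := isq _ * isq _ => ni.
      (* The two terms of [dg] are at most [2 * M / n] and [4 * M / n]; the factor 2 of [inv_nm_isq]
         then gives [12 * M]. *)
      have hdg : nm (dg (gam z.1 z.2)) <= 6 * M * n^-1.
        rewrite /dg (le_trans (nmD _ _)) // !nmM !nmV nmX nmN nm1 mul1r.
        have h1 := inc z.1 z.2 uI yI; have h2 := hM z rz; rewrite -/n in h1 *.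
        have nV : 0 < n^-1 by rewrite invr_gt0.
        have -> : 6 * M / n = (2 * M * n) * (n ^+ 2)^-1 + 4 * M * n^-1.
          by field; rewrite gt_eqF.
        apply: lerD; first by rewrite ler_wpM2r // invr_ge0 exprn_ge0 // ltW.
        apply: ler_wpM2r; [exact: ltW|apply: (le_trans h2); lra].
      apply: le_trans (_ : 6 * M * n^-1 * 1 <= _).
        by rewrite ler_pM ?nm_ge0.
      have : 6 * M * n^-1 <= 6 * M * (2 * i) by rewrite ler_wpM2l // mulr_ge0 // ltW.
      by rewrite mulr1 => /le_trans; apply; lra.
    split.
    * apply: (integrable2_off (s := [:: us]) (t := [:: ys]) mrh.1 iM) => z z1 z2.
      exact: le_trans (nm_Re _) (bd z z1 z2).
    * apply: (integrable2_off (s := [:: us]) (t := [:: ys]) mrh.2 iM) => z z1 z2.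
      exact: le_trans (nm_Im _) (bd z z1 z2).
Qed.

End CauchyRectangle.

(** * The contours *)

Section Kappa.
Context {R : realType}.

(** This is 1 / sqrt 2; computations use it through the polynomial identity [kap2]. *)
Definition kap : R := cos (pi / 4).

Lemma kap_gt0 : 0 < kap.
Proof.
apply: cos_gt0_pihalf; have := pi_gt0 R; lra.
Qed.

Lemma kap2 : 2 * kap ^+ 2 = 1.
Proof.
have := cos_pihalf R; rewrite (_ : pi / 2 = pi / 4 + pi / 4); last by field.
rewrite cosD -!expr2 sin2cos2 -/kap; lra.
Qed.

Lemma sin_pi4 : sin (pi / 4) = kap.
Proof.
have s0 : 0 < sin (pi / 4 : R) by apply: sin_gt0_pi; have := pi_gt0 R; lra.
apply/eqP; rewrite -(@eqrXn2 _ 2) ?ltW ?kap_gt0//; apply/eqP.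
rewrite sin2cos2 -/kap; have := kap2; lra.
Qed.

Lemma kap_lt1 : kap < 1.
Proof. have := kap2; have := kap_gt0; nra. Qed.

Lemma kap_gt12 : 1 / 2 < kap.
Proof. have := kap2; have := kap_gt0; nra. Qed.

Lemma kap_lt34 : kap < 3 / 4.
Proof. have := kap2; have := kap_gt0; nra. Qed.

End Kappa.

(** * Arctangent identities and limits *)

Section AtanInv.
Context {R : realType}.

Lemma atanV (x : R) : 0 < x -> atan x + atan x^-1 = pi / 2.
Proof.
move=> x0; have [/andP[l u] tx] := atan_def x.
have t0 : 0 < atan x.
  by rewrite -atan0; exact: lt_atan.
suff -> : atan x^-1 = pi / 2 - atan x by rewrite addrC subrK.
rewrite -[RHS]tanK; last by rewrite in_itv /=; apply/andP; split; lra.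
congr atan; rewrite -{1}tx /tan invf_div.
have -> : pi / 2 - atan x = - (atan x - pi / 2) by rewrite opprB.
by rewrite sinN cosN sinBpihalf cosBpihalf opprK.
Qed.

(** The case [p = 0] fits in: division by 0 gives 0, and so does [Num.sg 0]. *)
Lemma atan_limit (m p k : R) : 0 < k ->
  atan ((m + k * n.+1%:R) / p) @[n --> \oo] --> Num.sg p * (pi / 2).
Proof.
move=> k0.
have h p' : 0 < p' -> forall m', atan ((m' + k * n.+1%:R) / p') @[n --> \oo] --> pi / 2.
  move=> p0 m'; apply: (@cvg_comp _ _ _ (fun n => (m' + k * n.+1%:R) / p') atan); last exact: cvgy_atan.
  apply/cvgryPge => A; near=> n.
  have : (A * p' - m') / k <= n%:R by near: n; exact: nbhs_infty_ger.
  rewrite ler_pdivrMr // ler_pdivlMr // -natr1; nra.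
have [->|p0] := eqVneq p 0.
  by rewrite sgr0 mul0r; under eq_fun do rewrite invr0 mulr0 atan0; exact: cvg_cst.
have [pl|pg] := ltP p 0; last first.
  rewrite gtr0_sg ?mul1r; last by rewrite lt_neqAle eq_sym p0.
  by apply: h; rewrite lt_neqAle eq_sym p0.
rewrite ltr0_sg // mulN1r.
have -> : (fun n => atan ((m + k * n.+1%:R) / p)) = (fun n => - atan ((m + k * n.+1%:R) / - p)).
  by apply/funext => n; rewrite invrN mulrN atanN opprK.
by apply: cvgN; apply: h; rewrite oppr_gt0.
Unshelve. all: by end_near. Qed.

Lemma atanV_lt0 (x : R) : x < 0 -> atan x + atan x^-1 = - (pi / 2).
Proof.
move=> x0; have /atanV : 0 < - x by rewrite oppr_gt0.
by rewrite invrN !atanN => <-; rewrite opprD !opprK.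
Qed.

(** This and [atan_sum_lt0] add up the arguments swept along the two rays, as seen from a point
    outside, respectively inside, the wedge; see [Hpm_limit]. *)
Lemma atan_sum (p m : R) : (0 < p) || (0 < m) ->
  Num.sg p * (pi / 2) - atan (m / p) + (Num.sg m * (pi / 2) - atan (p / m)) = pi / 2.
Proof.
have [p0|p0|->] := ltgtP p 0; have [m0|m0|->] := ltgtP m 0 => //= _.
- rewrite (ltr0_sg p0) (gtr0_sg m0).
  have : m / p < 0 by rewrite pmulr_rlt0 // invr_lt0.
  by move/atanV_lt0; rewrite invf_div; lra.
- rewrite (gtr0_sg p0) (ltr0_sg m0).
  have : m / p < 0 by rewrite nmulr_rlt0 // invr_gt0.
  by move/atanV_lt0; rewrite invf_div; lra.
- rewrite (gtr0_sg p0) (gtr0_sg m0).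
  have : 0 < m / p by rewrite divr_gt0.
  by move/atanV; rewrite invf_div; lra.
- by rewrite (gtr0_sg p0) sgr0 invr0 !mul0r !mulr0 !atan0; lra.
- by rewrite (gtr0_sg m0) sgr0 invr0 !mul0r !mulr0 !atan0; lra.
Qed.

Lemma atan_sum_lt0 (p m : R) : p < 0 -> m < 0 ->
  Num.sg p * (pi / 2) - atan (m / p) + (Num.sg m * (pi / 2) - atan (p / m)) = - (3 * (pi / 2)).
Proof.
move=> p0 m0; rewrite (ltr0_sg p0) (ltr0_sg m0).
have : 0 < m / p by rewrite nmulr_rgt0 // invr_lt0.
by move/atanV; rewrite invf_div; lra.
Qed.

End AtanInv.

Section Wedge.
Context {R : realType}.
Local Notation Re := (@complex.Re R).
Local Notation Im := (@complex.Im R).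
Local Notation kap := (@kap R).
Implicit Types (u s : R) (z W : R[i]).

Definition Gm (a s : R) : R[i] := (a + kap * `|s|) +i* (kap * s).
Definition dGm (s : R) : R[i] := (kap * Num.sg s) +i* (kap * Num.sg s ^+ 2).

(** The directions of travel on the two rays. The lower ray is run towards the vertex, so [omm]
    points up and to the left. *)
Definition omp : R[i] := kap +i* kap.
Definition omm : R[i] := (- kap) +i* kap.

(** Coordinates adapted to the half strips: the first is the vertex, the second runs along the ray,
    so that the sides of constant vertex lie on contours. *)
Definition gp := bilin (0 : R[i]) 1 omp 0.
Definition gm := bilin (0 : R[i]) 1 omm 0.

Lemma gpE u s : gp u s = (u + kap * s) +i* (kap * s).
Proof. by rewrite /gp /bilin /omp; apply: complex_eq => /=; ring. Qed.

Lemma gmE u s : gm u s = (u - kap * s) +i* (kap * s).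
Proof. by rewrite /gm /bilin /omm; apply: complex_eq => /=; ring. Qed.

Lemma Gm_ge0 a s : 0 <= s -> Gm a s = gp a s.
Proof. by move=> s0; rewrite /Gm gpE ger0_norm. Qed.

Lemma Gm_le0 a s : s <= 0 -> Gm a s = gm a s.
Proof. by move=> s0; rewrite /Gm gmE ler0_norm // mulrN. Qed.

Lemma dGm_gt0 s : 0 < s -> dGm s = omp.
Proof. by move=> s0; rewrite /dGm gtr0_sg // expr1n !mulr1. Qed.

Lemma dGm_lt0 s : s < 0 -> dGm s = omm.
Proof. by move=> s0; rewrite /dGm ltr0_sg // sqrrN expr1n mulrN !mulr1. Qed.

Lemma dGm0 : dGm 0 = 0.
Proof. by rewrite /dGm sgr0 expr0n !mulr0. Qed.

(* The vertex of the contour [Gm] that passes through [z]. *)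
Definition rho z := Re z - `|Im z|.

Lemma rho_Gm a s : rho (Gm a s) = a.
Proof. by rewrite /rho /Gm /= normrM (gtr0_norm kap_gt0) addrK. Qed.

Lemma Gm_rho z : Gm (rho z) (Im z / kap) = z.
Proof.
have k0 := @kap_gt0 R.
have kV : kap * (Im z / kap) = Im z by rewrite mulrC divfK // gt_eqF.
rewrite /Gm kV -[X in X * `|_|]gtr0_norm // -normrM kV /rho subrK.
by case: z {kV}.
Qed.

Lemma rho_lip z w : `|rho z - rho w| <= 2 * nm (z - w).
Proof.
have h1 := nm_Re (z - w); have h2 := nm_Im (z - w).
have h3 := ler_dist_dist (Im w) (Im z).
rewrite cReD cReN in h1; rewrite cImD cImN in h2.
rewrite /rho (_ : _ - _ = (Re z - Re w) + (`|Im w| - `|Im z|)); last by ring.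
rewrite mulr_natl mulr2n (le_trans (ler_normD _ _)) // lerD //.
by rewrite (le_trans h3) // distrC.
Qed.

(** Two unit vectors with angle of cosine [c] are quantitatively independent when [|c|] stays away
    from 1; the bound 3/4 is chosen to exceed [kap]. *)
Lemma sep_real (x y c : R) : `|c| <= 3 / 4 -> `|x| * `|y| <= 4 * (x ^+ 2 + y ^+ 2 + 2 * c * (x * y)).
Proof.
move=> c34.
have h1 : `|c * (x * y)| <= 3 / 4 * (`|x| * `|y|) by rewrite !normrM ler_wpM2r // mulr_ge0.
have h2 : - `|c * (x * y)| <= c * (x * y) by rewrite lerNl -normrN ler_norm.
have h3 := sqr_ge0 (`|x| - `|y|).
have h4 := real_normK (num_real x); have h5 := real_normK (num_real y).
have h6 : 0 <= `|x| * `|y| by rewrite mulr_ge0.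
by rewrite -h4 -h5; nra.
Qed.

Lemma sep_omp (x y : R) : `|x| * `|y| <= 4 * nm (x%:C + y%:C * omp) ^+ 2.
Proof.
have c34 : `|kap| <= 3 / 4 by rewrite gtr0_norm ?kap_gt0 // ltW // kap_lt34.
have := sep_real x y c34; congr (_ <= 4 * _).
rewrite nm_sqr /=; have := @kap2 R => k2.
have -> : y ^+ 2 = y ^+ 2 * (2 * kap ^+ 2) by rewrite k2 mulr1.
by ring.
Qed.

Lemma sep_omm (x y : R) : `|x| * `|y| <= 4 * nm (x%:C + y%:C * omm) ^+ 2.
Proof.
have c34 : `|- kap| <= 3 / 4 by rewrite normrN gtr0_norm ?kap_gt0 // ltW // kap_lt34.
have := sep_real x y c34; congr (_ <= 4 * _).
rewrite nm_sqr /=; have := @kap2 R => k2.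
have -> : y ^+ 2 = y ^+ 2 * (2 * kap ^+ 2) by rewrite k2 mulr1.
by ring.
Qed.

Lemma nm_omp : nm omp = 1.
Proof.
apply/eqP; rewrite -(@eqrXn2 _ 2) ?nm_ge0//; apply/eqP.
by rewrite nm_sqr /= expr1n -mulr2n -mulr_natl kap2.
Qed.

Lemma nm_omm : nm omm = 1.
Proof.
apply/eqP; rewrite -(@eqrXn2 _ 2) ?nm_ge0//; apply/eqP.
by rewrite nm_sqr /= sqrrN expr1n -mulr2n -mulr_natl kap2.
Qed.

Lemma der_atan_div (A : R -> R) (dA c s : R) : is_derive s (1 : R) A dA ->
  is_derive s (1 : R) (fun s => atan (A s / c)) (dA * c / (A s ^+ 2 + c ^+ 2)).
Proof.
move=> hA; have [->|c0] := eqVneq c 0.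
  under eq_fun do rewrite invr0 mulr0.
  by rewrite mulr0 mul0r; exact: is_derive_cst.
have h1 := derM hA (der_cst c^-1 s).
have h2 := @der_comp _ atan (fun s => A s / c) s _ _ (is_derive1_atan _) h1.
have n0 : A s ^+ 2 + c ^+ 2 != 0.
  by rewrite gt_eqF // ltr_wpDl ?sqr_ge0 // exprn_even_gt0.
apply: (is_derive_eq h2); rewrite mulr0 add0r; field.
by rewrite c0 ?n0 ?[c ^+ 2 + _]addrC ?n0.
Qed.

Lemma der_ln_half (q : R -> R) (dq s : R) : 0 < q s -> is_derive s (1 : R) q dq ->
  is_derive s (1 : R) (fun s => 1 / 2 * ln (q s)) (dq / (2 * q s)).
Proof.
move=> q0 hq; have h1 := @der_comp _ (@ln R) q s _ _ (is_derive1_ln q0) hq.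
have h2 := derM (der_cst (1 / 2) s) h1.
by apply: (is_derive_eq h2); rewrite mul0r addr0; field; rewrite gt_eqF.
Qed.

Lemma cvg_real_fun (f : R -> R) (d s : R) : is_derive s (1 : R) f d -> f @ s --> f s.
Proof.
move=> [d1 _]; apply: differentiable_continuous; exact/derivable1_diffP.
Qed.

End Wedge.

(** * The integral of 1 / (Z - W) along a wedge *)

Section LogLimit.
Context {R : realType}.
Local Notation kap := (@kap R).

(** Each logarithm diverges. Dividing both arguments by [n.+1%:R ^+ 2] leaves their difference
    unchanged, and each quotient tends to [2 * kap ^+ 2 = 1]. *)
Lemma log_limit (e V : R) :
  1 / 2 * ln ((e + kap * n.+1%:R) ^+ 2 + (kap * n.+1%:R - V) ^+ 2) -
  1 / 2 * ln ((e - kap * - n.+1%:R) ^+ 2 + (kap * - n.+1%:R - V) ^+ 2) @[n --> \oo] --> (0 : R).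
Proof.
have k0 := @kap_gt0 R.
pose N (v h : R) := (e * h + kap) ^+ 2 + (kap - v * h) ^+ 2.
have hc : (fun n => n.+1%:R^-1 : R) @ \oo --> (0 : R) by exact: cvg_harmonic.
have cN v : (fun n => N v n.+1%:R^-1) @ \oo --> (1 : R).
  have h1 : (fun n => e * n.+1%:R^-1 + kap) @ \oo --> e * 0 + kap.
    by apply: cvgD; [apply: cvgM => //; exact: cvg_cst|exact: cvg_cst].
  have h2 : (fun n => kap - v * n.+1%:R^-1) @ \oo --> kap - v * 0.
    by apply: cvgB; [exact: cvg_cst|apply: cvgM => //; exact: cvg_cst].
  have h3 : (fun n => N v n.+1%:R^-1) @ \oo -->
      (e * 0 + kap) * (e * 0 + kap) + (kap - v * 0) * (kap - v * 0).
    by rewrite /N; under eq_fun do rewrite !expr2; apply: cvgD; exact: cvgM.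
  have e1 : (e * 0 + kap) * (e * 0 + kap) + (kap - v * 0) * (kap - v * 0) = 1.
    by rewrite !mulr0 add0r subr0 -!expr2 -mulr2n -mulr_natl kap2.
  by rewrite e1 in h3.
have cL v : (fun n => ln (N v n.+1%:R^-1)) @ \oo --> (0 : R).
  have h : (fun n => ln (N v n.+1%:R^-1)) @ \oo --> ln (1 : R).
    apply: continuous_cvg; last exact: cN.
    by apply: (@cvg_real_fun R _ (1^-1)); exact: is_derive1_ln.
  by rewrite ln1 in h.
have pos v : \forall n \near \oo, 0 < N v n.+1%:R^-1.
  by apply: (cvgr_gt _ (cN v)); exact: ltr01.
have E : \forall n \near \oo, 1 / 2 * ln (N V n.+1%:R^-1) - 1 / 2 * ln (N (- V) n.+1%:R^-1) =
  1 / 2 * ln ((e + kap * n.+1%:R) ^+ 2 + (kap * n.+1%:R - V) ^+ 2) -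
  1 / 2 * ln ((e - kap * - n.+1%:R) ^+ 2 + (kap * - n.+1%:R - V) ^+ 2).
  near=> n.
  have p1 : 0 < N V n.+1%:R^-1 by near: n; exact: pos.
  have p2 : 0 < N (- V) n.+1%:R^-1 by near: n; exact: pos.
  have n0 : 0 < n.+1%:R ^+ 2 :> R by rewrite exprn_gt0.
  have -> : (e + kap * n.+1%:R) ^+ 2 + (kap * n.+1%:R - V) ^+ 2 = N V n.+1%:R^-1 * n.+1%:R ^+ 2.
    by rewrite /N; field.
  have -> : (e - kap * - n.+1%:R) ^+ 2 + (kap * - n.+1%:R - V) ^+ 2 = N (- V) n.+1%:R^-1 * n.+1%:R ^+ 2.
    by rewrite /N; field.
  by rewrite !lnM ?posrE//; ring.
apply: (cvg_trans (near_eq_cvg E)).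
have h v : (fun n => 1 / 2 * ln (N v n.+1%:R^-1)) @ \oo --> 1 / 2 * (0 : R).
  by apply: cvgM => //; exact: cvg_cst.
have h' : (fun n => 1 / 2 * ln (N V n.+1%:R^-1) - 1 / 2 * ln (N (- V) n.+1%:R^-1)) @ \oo -->
    1 / 2 * (0 : R) - 1 / 2 * (0 : R) by apply: cvgB.
by rewrite subrr in h'.
Unshelve. all: by end_near. Qed.

End LogLimit.

Section LogIntegral.
Context {R : realType}.
Local Notation leb := (@lebesgue_measure R).
Local Notation Re := (@complex.Re R).
Local Notation Im := (@complex.Im R).
Local Notation kap := (@kap R).
Local Notation gp := (@gp R).
Local Notation gm := (@gm R).
Local Notation omp := (@omp R).
Local Notation omm := (@omm R).

(** [Hp] and [Hm] together are the integral of dZ / (Z - W) along the contour with vertex [u],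
    truncated at parameter [Y]. *)
Definition Hp (u : R) (W : R[i]) (Y : R) : R[i] :=
  Cintegral leb `[0, Y] (fun s => omp / (gp u s - W)).
Definition Hm (u : R) (W : R[i]) (Y : R) : R[i] :=
  Cintegral leb `[- Y, 0] (fun s => omm / (gm u s - W)).

Lemma gp_neq u s W : 0 <= s -> u != rho W -> gp u s - W != 0.
Proof.
move=> s0 uW; rewrite subr_eq0; apply: contraNneq uW => <-.
by rewrite -Gm_ge0 // rho_Gm.
Qed.

Lemma gm_neq u s W : s <= 0 -> u != rho W -> gm u s - W != 0.
Proof.
move=> s0 uW; rewrite subr_eq0; apply: contraNneq uW => <-.
by rewrite -Gm_le0 // rho_Gm.
Qed.

Lemma ccont_id (s : R) : ccont (fun s : R => s%:C) s.
Proof. by apply: ccont_real; exact: cvg_id. Qed.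

Lemma ccont_bilin2 (p q r t : R[i]) u (s : R) : ccont (bilin p q r t u) s.
Proof.
by apply: ccontD; [exact: ccont_cst|apply: ccontM; [exact: ccont_id|exact: ccont_cst]].
Qed.

Lemma ccont_bilin1 (p q r t : R[i]) s (u : R) : ccont ((bilin p q r t)^~ s) u.
Proof.
apply: ccontD; first apply: ccontD.
- exact: ccont_cst.
- by apply: ccontM; [exact: ccont_id|exact: ccont_cst].
- apply: ccontM; first exact: ccont_cst.
  by apply: ccontD; [exact: ccont_cst|apply: ccontM; [exact: ccont_id|exact: ccont_cst]].
Qed.

(** The real part integrates to the logarithm of |Z - W|, the imaginary part to the argument of Z -
    W after a rotation by pi/4. The rotation makes the abscissa proportional to the constant [p], so
    a single branch of [atan] serves the whole ray. *)
Lemma Hp_val u W Y : 0 <= Y -> u != rho W ->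
  let p := u - Re W + Im W in let m := u - Re W - Im W in
  let q s := (u - Re W + kap * s) ^+ 2 + (kap * s - Im W) ^+ 2 in
  Hp u W Y = (1 / 2 * ln (q Y) - 1 / 2 * ln (q 0)) +i*
    (atan ((m + 2 * kap * Y) / p) - atan (m / p)).
Proof.
move=> Y0 uW p m q.
have n0 s : 0 <= s <= Y -> gp u s - W != 0 by move=> /andP[s0 _]; exact: gp_neq.
have cc s : 0 <= s <= Y -> ccont (fun s => omp / (gp u s - W)) s.
  move=> sI; apply: ccontM; first exact: ccont_cst.
  apply: ccontV; first exact: n0.
  by apply: ccontD; [exact: ccont_bilin2|exact: ccont_cst].
have q0 s : 0 <= s <= Y -> 0 < q s.
  move=> /n0; rewrite -nm_gt0 => h; have := exprn_gt0 2 h.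
  by rewrite nm_sqr gpE cReD cImD cReN cImN /= addrAC.
have dlin (a : R) s : is_derive s (1 : R) (fun s => a + kap * s) kap.
  apply: (is_derive_eq (derD (der_cst a s) (derM (der_cst kap s) (der_id s)))).
  by ring.
have dq s : is_derive s (1 : R) q (2 * kap * ((u - Re W + kap * s) + (kap * s - Im W))).
  have -> : q = fun s => (u - Re W + kap * s) * (u - Re W + kap * s) +
      (- Im W + kap * s) * (- Im W + kap * s).
    by apply/funext => t; rewrite /q; ring.
  apply: (is_derive_eq (derD (derM (dlin _ s) (dlin _ s)) (derM (dlin _ s) (dlin _ s)))).
  by ring.
have WE s : gp u s - W = (u - Re W + kap * s) +i* (kap * s - Im W).
  by rewrite gpE; apply: complex_eq; rewrite ?cReD ?cImD ?cReN ?cImN /=; ring.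
rewrite /Hp /Cintegral; congr (_ +i* _).
- apply: (Rintegral_FTC (F := fun s => 1 / 2 * ln (q s))) => // s sI; last by have [] := cc s sI.
  apply: (is_derive_eq (der_ln_half (q0 s sI) (dq s))).
  rewrite WE cReM cReV cImV /=; have := q0 s sI; rewrite /q => /lt0r_neq0 h.
  by field.
- have -> : atan ((m + 2 * kap * Y) / p) - atan (m / p) =
      atan ((m + 2 * kap * Y) / p) - atan ((m + 2 * kap * 0) / p).
    by rewrite mulr0 addr0.
  apply: (Rintegral_FTC (F := fun s => atan ((m + 2 * kap * s) / p))) => // s sI; last by have [] := cc s sI.
  have dA : is_derive s (1 : R) (fun s => m + 2 * kap * s) (2 * kap).
    apply: (is_derive_eq (derD (der_cst m s) (derM (der_cst (2 * kap) s) (der_id s)))).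
    by ring.
  apply: (is_derive_eq (der_atan_div p dA)).
  rewrite WE cImM cReV cImV /=; have := q0 s sI; rewrite /q => /lt0r_neq0 h.
  have -> : (m + 2 * kap * s) ^+ 2 + p ^+ 2 = 2 * ((u - Re W + kap * s) ^+ 2 + (kap * s - Im W) ^+ 2).
    by rewrite /m /p; ring.
  by rewrite /p; field.
Qed.

Lemma Hm_val u W Y : 0 <= Y -> u != rho W ->
  let p := u - Re W + Im W in let m := u - Re W - Im W in
  let q s := (u - Re W - kap * s) ^+ 2 + (kap * s - Im W) ^+ 2 in
  Hm u W Y = (1 / 2 * ln (q 0) - 1 / 2 * ln (q (- Y))) +i*
    (atan ((p + 2 * kap * Y) / m) - atan (p / m)).
Proof.
move=> Y0 uW p m q.
have Y0' : - Y <= 0 by rewrite oppr_le0.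
have n0 s : - Y <= s <= 0 -> gm u s - W != 0 by move=> /andP[_ s0]; exact: gm_neq.
have cc s : - Y <= s <= 0 -> ccont (fun s => omm / (gm u s - W)) s.
  move=> sI; apply: ccontM; first exact: ccont_cst.
  apply: ccontV; first exact: n0.
  by apply: ccontD; [exact: ccont_bilin2|exact: ccont_cst].
have q0 s : - Y <= s <= 0 -> 0 < q s.
  move=> /n0; rewrite -nm_gt0 => h; have := exprn_gt0 2 h.
  by rewrite nm_sqr gmE cReD cImD cReN cImN /= addrAC.
have dlin (a k s : R) : is_derive s (1 : R) (fun s => a + k * s) k.
  apply: (is_derive_eq (derD (der_cst a s) (derM (der_cst k s) (der_id s)))).
  by ring.
have dq s : is_derive s (1 : R) q (2 * kap * (- (u - Re W - kap * s) + (kap * s - Im W))).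
  have -> : q = fun s => (u - Re W + (- kap) * s) * (u - Re W + (- kap) * s) +
      (- Im W + kap * s) * (- Im W + kap * s).
    by apply/funext => t; rewrite /q; ring.
  apply: (is_derive_eq (derD (derM (dlin _ _ s) (dlin _ _ s)) (derM (dlin _ _ s) (dlin _ _ s)))).
  by ring.
have WE s : gm u s - W = (u - Re W - kap * s) +i* (kap * s - Im W).
  by rewrite gmE; apply: complex_eq; rewrite ?cReD ?cImD ?cReN ?cImN /=; ring.
rewrite /Hm /Cintegral; congr (_ +i* _).
- apply: (Rintegral_FTC (F := fun s => 1 / 2 * ln (q s))) => // s sI; last by have [] := cc s sI.
  apply: (is_derive_eq (der_ln_half (q0 s sI) (dq s))).
  rewrite WE cReM cReV cImV /=; have := q0 s sI; rewrite /q => /lt0r_neq0 h.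
  by field.
- have -> : atan ((p + 2 * kap * Y) / m) - atan (p / m) =
      - atan ((p - 2 * kap * 0) / m) - - atan ((p - 2 * kap * - Y) / m).
    by rewrite mulr0 subr0 mulrN !opprK addrC.
  apply: (Rintegral_FTC (F := fun s => - atan ((p - 2 * kap * s) / m))) => // s sI; last by have [] := cc s sI.
  have dA : is_derive s (1 : R) (fun s => p - 2 * kap * s) (- (2 * kap)).
    have -> : (fun s => p - 2 * kap * s) = (fun s => p + (- (2 * kap)) * s).
      by apply/funext => t; rewrite mulNr.
    exact: dlin.
  apply: (is_derive_eq (derN (der_atan_div m dA))).
  rewrite WE cImM cReV cImV /=; have := q0 s sI; rewrite /q => /lt0r_neq0 h.
  have -> : (p - 2 * kap * s) ^+ 2 + m ^+ 2 = 2 * ((u - Re W - kap * s) ^+ 2 + (kap * s - Im W) ^+ 2).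
    by rewrite /m /p; ring.
  by rewrite /m; field.
Qed.

End LogIntegral.

Section LogIntegralLimit.
Context {R : realType}.
Local Notation Re := (@complex.Re R).
Local Notation Im := (@complex.Im R).
Local Notation kap := (@kap R).

(** Seen from outside the wedge the contour sweeps a quarter turn; seen from inside it sweeps three
    quarters of a turn, clockwise. *)
Lemma Hpm_limit u W : u != rho W ->
  Re (Hp u W n.+1%:R + Hm u W n.+1%:R) @[n --> \oo] --> (0 : R) /\
  Im (Hp u W n.+1%:R + Hm u W n.+1%:R) @[n --> \oo] -->
    (if rho W < u then pi / 2 else - (3 * (pi / 2))).
Proof.
move=> uW; have k0 := @kap_gt0 R.
have k2 : 0 < 2 * kap by rewrite mulr_gt0.
have Y0 n : 0 <= n.+1%:R :> R by [].
split.
  have E n : Re (Hp u W n.+1%:R + Hm u W n.+1%:R) =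
      1 / 2 * ln ((u - Re W + kap * n.+1%:R) ^+ 2 + (kap * n.+1%:R - Im W) ^+ 2) -
      1 / 2 * ln ((u - Re W - kap * - n.+1%:R) ^+ 2 + (kap * - n.+1%:R - Im W) ^+ 2).
    by rewrite cReD Hp_val // Hm_val //= !mulr0 addr0 subr0 addrA subrK.
  by under eq_fun do rewrite E; exact: log_limit.
under eq_fun do rewrite cImD Hp_val // Hm_val //=.
set p := _ + Im W; set m := _ - Im W.
have h1 : (fun n => atan ((m + 2 * kap * n.+1%:R) / p) - atan (m / p)) @ \oo -->
    Num.sg p * (pi / 2) - atan (m / p).
  by apply: cvgB; [exact: atan_limit|exact: cvg_cst].
have h2 : (fun n => atan ((p + 2 * kap * n.+1%:R) / m) - atan (p / m)) @ \oo -->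
    Num.sg m * (pi / 2) - atan (p / m).
  by apply: cvgB; [exact: atan_limit|exact: cvg_cst].
suff <- : Num.sg p * (pi / 2) - atan (m / p) + (Num.sg m * (pi / 2) - atan (p / m)) =
    (if rho W < u then pi / 2 else - (3 * (pi / 2))) by exact: cvgD.
case: ltP => h.
- apply: atan_sum; move: h; rewrite /rho /p /m; case: (ger0P (Im W)) => V0 h; apply/orP.
  + by left; lra.
  + by right; lra.
- have {}h : u < rho W by rewrite lt_neqAle uW h.
  apply: atan_sum_lt0; move: h; rewrite /rho /p /m; case: (ger0P (Im W)) => V0; lra.
Unshelve. all: by end_near. Qed.

End LogIntegralLimit.

(** * Limits of complex sequences and truncated integrals *)

Section CCvg.
Context {R : realType}.
Local Notation leb := (@lebesgue_measure R).
Local Notation Re := (@complex.Re R).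
Local Notation Im := (@complex.Im R).
Implicit Types f g : nat -> R[i].

Definition ccvg f (l : R[i]) : Prop :=
  Re (f n) @[n --> \oo] --> Re l /\ Im (f n) @[n --> \oo] --> Im l.

Lemma ccvg_cst c : ccvg (fun=> c) c.
Proof. by split; exact: cvg_cst. Qed.

Lemma ccvgD f g a b : ccvg f a -> ccvg g b -> ccvg (fun n => f n + g n) (a + b).
Proof.
move=> [f1 f2] [g1 g2]; split; rewrite ?cReD ?cImD.
- by under eq_fun do rewrite cReD; apply: cvgD.
- by under eq_fun do rewrite cImD; apply: cvgD.
Qed.

Lemma ccvgM f g a b : ccvg f a -> ccvg g b -> ccvg (fun n => f n * g n) (a * b).
Proof.
move=> [f1 f2] [g1 g2]; split; rewrite ?cReM ?cImM.
- by under eq_fun do rewrite cReM; apply: cvgB; apply: cvgM.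
- by under eq_fun do rewrite cImM; apply: cvgD; apply: cvgM.
Qed.

Lemma ccvgZ c f a : ccvg f a -> ccvg (fun n => c * f n) (c * a).
Proof. by apply: ccvgM; exact: ccvg_cst. Qed.

Lemma ccvgB f g a b : ccvg f a -> ccvg g b -> ccvg (fun n => f n - g n) (a - b).
Proof.
move=> fa gb; apply: ccvgD => //; rewrite -mulN1r.
by under eq_fun do rewrite -mulN1r; exact: ccvgZ.
Qed.

Lemma ccvg_unique f a b : ccvg f a -> ccvg f b -> a = b.
Proof.
move=> [f1 f2] [g1 g2]; apply: complex_eq.
- by rewrite -(cvg_lim (@Rhausdorff R) f1) -(cvg_lim (@Rhausdorff R) g1).
- by rewrite -(cvg_lim (@Rhausdorff R) f2) -(cvg_lim (@Rhausdorff R) g2).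
Qed.

Lemma ccvg_near f g a : (\forall n \near \oo, f n = g n) -> ccvg f a -> ccvg g a.
Proof.
move=> fg [f1 f2]; split.
- apply: cvg_trans f1; apply: near_eq_cvg; near=> n.
  by have -> : f n = g n by near: n; exact: fg.
- apply: cvg_trans f2; apply: near_eq_cvg; near=> n.
  by have -> : f n = g n by near: n; exact: fg.
Unshelve. all: by end_near. Qed.

Lemma cvg0_le (h e : nat -> R) : (\forall n \near \oo, `|h n| <= e n) ->
  e n @[n --> \oo] --> (0 : R) -> h n @[n --> \oo] --> (0 : R).
Proof.
move=> he e0; apply: norm_cvg0.
apply: (@squeeze_cvgr _ _ _ _ (cst 0) e); [|exact: cvg_cst|exact: e0].
by near=> n; rewrite normr_ge0 /=; near: n; exact: he.
Unshelve. all: by end_near. Qed.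

Lemma ccvg0_le f (e : nat -> R) : (\forall n \near \oo, nm (f n) <= e n) ->
  e n @[n --> \oo] --> (0 : R) -> ccvg f 0.
Proof.
move=> fe e0; split.
- by apply: (@cvg0_le _ e) => //; apply: filterS fe => n; apply: le_trans; exact: nm_Re.
- by apply: (@cvg0_le _ e) => //; apply: filterS fe => n; apply: le_trans; exact: nm_Im.
Qed.

Lemma cvg_nm (T : Type) (F : set_system T) {FF : Filter F} (g : T -> R[i]) (l : R[i]) :
  (fun x => Re (g x)) @ F --> Re l -> (fun x => Im (g x)) @ F --> Im l ->
  (fun x => nm (g x)) @ F --> nm l.
Proof.
move=> g1 g2; rewrite nmE; under eq_fun do rewrite nmE.
apply: continuous_cvg; first exact: sqrt_continuous.
by apply: cvgD; apply: cvgM.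
Qed.

Lemma cintegrable_cont (f : R -> R[i]) (a b : R) : (forall x, a <= x <= b -> ccont f x) ->
  Cintegrable leb `[a, b] f.
Proof.
by move=> cf; split; apply: rintegrable_continuous => x /cf[].
Qed.

Lemma Cintegral_if (P : R -> bool) (f : R -> R[i]) a b :
  (forall x, P x = (a <= x <= b)) ->
  Cintegral leb `[a, b] f = Cintegral leb setT (fun x => if P x then f x else 0).
Proof.
move=> Pab; rewrite /Cintegral -!(Rintegral_if _ Pab); congr (_ +i* _);
  by apply: eq_Rintegral => x _; case: ifP.
Qed.

Lemma cmeas_if (P : R -> bool) (f : R -> R[i]) : measurable_fun setT P ->
  cmeas setT f -> cmeas setT (fun x => if P x then f x else 0).
Proof.
move=> mP [f1 f2]; split.
- have -> : (fun x => Re (if P x then f x else 0)) = (fun x => if P x then Re (f x) else 0).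
    by apply/funext => z; case: ifP.
  exact: measurable_fun_ifT.
- have -> : (fun x => Im (if P x then f x else 0)) = (fun x => if P x then Im (f x) else 0).
    by apply/funext => z; case: ifP.
  exact: measurable_fun_ifT.
Qed.

Lemma measurable_itvb (a b : R) : measurable_fun setT (fun x => a <= x <= b).
Proof.
by apply: measurable_and; apply: measurable_fun_ler;
  (exact: measurable_cst || exact: measurable_id).
Qed.

Lemma Cintegral_itv_off (s : seq R) (f g : R -> R[i]) a b : cmeas setT f ->
  (forall x, x \notin s -> a <= x <= b -> f x = g x) ->
  Cintegral leb `[a, b] f = Cintegral leb `[a, b] g.
Proof.
move=> mf fg; rewrite !(@Cintegral_if (fun x => a <= x <= b)) //.
apply: (Cintegral_eq_off (s := s)); first by apply: cmeas_if => //; exact: measurable_itvb.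
by move=> x xs; case: ifPn => // xI; exact: fg.
Qed.

Lemma Cintegral_split (f : R -> R[i]) a b c : a <= b -> b <= c ->
  Cintegrable leb setT f ->
  Cintegral leb `[a, c] f = Cintegral leb `[a, b] f + Cintegral leb `[b, c] f.
Proof.
move=> ab bc fi.
have ci x y : Cintegrable leb setT (fun z => if x <= z <= y then f z else 0).
  apply: (@cintegrable_dom _ _ _ leb setT measurableT _ (fun z => nm (f z))).
  - by apply: cmeas_if; [exact: measurable_itvb|exact: cintegrable_cmeas fi].
  - by move=> z _; case: ifP => // _; rewrite nm0 nm_ge0.
  - exact: rintegrable_nm.
rewrite (@Cintegral_if (fun x => a <= x <= c)) // (@Cintegral_if (fun x => a <= x <= b)) //
  (@Cintegral_if (fun x => b <= x <= c)) // -CintegralD //.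
apply: (Cintegral_eq_off (s := [:: b])).
  exact: cintegrable_cmeas (ci a c).
move=> x; rewrite inE => xb /=.
have [bx|bx] := ltP x b.
  by rewrite /= addr0 (ltW bx) (le_trans (ltW bx) bc).
rewrite (le_trans ab bx) (leNgt x b) lt_neqAle eq_sym xb bx /=.
by rewrite add0r.
Qed.

Lemma Cintegral_trunc (f : R -> R[i]) : Cintegrable leb setT f ->
  ccvg (fun n => Cintegral leb `[- n.+1%:R, n.+1%:R] f) (Cintegral leb setT f).
Proof.
move=> fi; under eq_fun => n do rewrite (@Cintegral_if (fun x => - n.+1%:R <= x <= n.+1%:R)) //.
have cv x : \forall n \near \oo, (if - n.+1%:R <= x <= n.+1%:R then f x else 0) = f x.
  near=> n; rewrite ifT // -ler_norml (@le_trans _ _ n%:R) ?ler_nat//.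
  by near: n; exact: nbhs_infty_ger.
apply: (@Cintegral_dct _ _ _ leb setT measurableT _ _ (fun x => nm (f x))).
- by move=> n; apply: cmeas_if; [exact: measurable_itvb|exact: cintegrable_cmeas fi].
- exact: cintegrable_cmeas fi.
- apply: aeW => x _; apply: (cvg_trans (near_eq_cvg _)); last exact: (cvg_cst (Re (f x))).
  by apply: filterS (cv x) => n ->.
- apply: aeW => x _; apply: (cvg_trans (near_eq_cvg _)); last exact: (cvg_cst (Im (f x))).
  by apply: filterS (cv x) => n ->.
- by apply: aeW => x n _; case: ifP => // _; rewrite nm0 nm_ge0.
- exact: rintegrable_nm.
Unshelve. all: by end_near. Qed.

End CCvg.

(** * The jump of the inner integral *)

Section InnerIntegral.
Context {R : realType}.
Local Notation leb := (@lebesgue_measure R).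
Implicit Types (G : R[i] -> R[i]) (W : R[i]) (a u s : R).

Lemma measurable_sg : measurable_fun setT (@Num.sg R).
Proof.
have -> : @Num.sg R = (fun x => if x == 0 then 0 else if x < 0 then -1 else 1).
  by apply/funext => x; rewrite /Num.sg; case: eqP.
apply: measurable_fun_ifT.
- exact: (measurable_fun_eqr (@measurable_id _ _ setT) (@measurable_cst _ _ _ _ setT (0 : R))).
- exact: measurable_cst.
- apply: measurable_fun_ifT; [|exact: measurable_cst..].
  exact: (measurable_fun_ltr (@measurable_id _ _ setT) (@measurable_cst _ _ _ _ setT (0 : R))).
Qed.

Lemma cmeas_Gm a : cmeas setT (Gm a).
Proof.
split=> /=.
- apply: measurable_funD; first exact: measurable_cst.
  by apply: measurable_funM; [exact: measurable_cst|exact: normr_measurable].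
- by apply: measurable_funM; [exact: measurable_cst|exact: measurable_id].
Qed.

Lemma cmeas_dGm : cmeas setT (@dGm R).
Proof.
have ms := measurable_sg; split=> /=.
- by apply: measurable_funM; [exact: measurable_cst|].
- by apply: measurable_funM; [exact: measurable_cst|exact: measurable_funX].
Qed.

Lemma nm_dGm s : nm (@dGm R s) <= 1.
Proof.
have [s0|s0|->] := ltgtP s 0.
- by rewrite dGm_lt0 // nm_omm.
- by rewrite dGm_gt0 // nm_omp.
- by rewrite dGm0 nm0.
Qed.

(** [rho] is 2-Lipschitz and takes the constant value [u] on the contour. *)
Lemma Gm_dist u s W : `|u - rho W| / 2 <= nm (Gm u s - W).
Proof.
have := rho_lip (Gm u s) W; rewrite rho_Gm => h.
by rewrite ler_pdivrMr // mulrC.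
Qed.

Lemma inner_integrable G u W C : u != rho W ->
  cmeas setT (fun s => G (Gm u s)) ->
  (forall s, nm (G (Gm u s)) <= C * expR (- `|s|)) ->
  Cintegrable leb setT (fun s => G (Gm u s) * dGm s / (Gm u s - W)).
Proof.
move=> uW mG bG.
have d0 : 0 < `|u - rho W| / 2 by rewrite divr_gt0 // normr_gt0 subr_eq0.
apply: (@cintegrable_dom _ _ _ leb setT measurableT _
  (fun s => (C / (`|u - rho W| / 2)) * expR (- `|s|))).
- apply: cmeasM; first by apply: cmeasM => //; exact: cmeas_dGm.
  by apply: cmeasV; apply: cmeasB; [exact: cmeas_Gm|exact: cmeas_cst].
- move=> s _; rewrite !nmM nmV.
  rewrite [leRHS]mulrAC; apply: ler_pM.
  + by rewrite mulr_ge0 ?nm_ge0.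
  + by rewrite invr_ge0 nm_ge0.
  + rewrite -[leRHS]mulr1; apply: ler_pM; rewrite ?nm_ge0 //; exact: nm_dGm.
  + rewrite lef_pV2 ?posrE //; first exact: Gm_dist.
    exact: lt_le_trans d0 (Gm_dist _ _ _).
- by apply: (rintegrableZ measurableT); exact: integrable_expRabs.
Qed.

(** Cauchy's theorem on one truncated half strip: either [W] is in it and [k = G W] makes the
    singularity removable, or [W] is not in it and [k] may be anything. *)
Lemma half_diff (D : set R[i]) G (r W k : R[i]) (u0 u1 y0 y1 : R) :
  hol D G ->
  (forall x y, `|x| * `|y| <= 4 * nm (x%:C + y%:C * r) ^+ 2) -> nm r <= 1 ->
  u0 <= u1 -> y0 <= y1 ->
  let gam := bilin 0 1 r 0 in
  let g Z := (G Z - k) / (Z - W) in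
  (forall u y, u0 <= u <= u1 -> y0 <= y <= y1 -> D (gam u y)) ->
  (exists us ys, [/\ u0 <= us <= u1, y0 <= ys <= y1, W = gam us ys & k = G W]) \/
  (forall u y, u0 <= u <= u1 -> y0 <= y <= y1 -> gam u y != W) ->
  Cintegral leb `[y0, y1] (fun y => g (gam u1 y) * r - g (gam u0 y) * r) =
  Cintegral leb `[u0, u1] (fun u => g (gam u y1) - g (gam u y0)).
Proof.
move=> hG sep r1 u01 y01 gam g Dg [[us [ys [usI ysI WE kE]]]|nW].
  rewrite /g kE WE.
  exact: (cauchy_rect_pole hG sep r1 usI ysI Dg).
pose D' := [set z | D z /\ z != W].
have hg : hol D' g.
  apply: holM.
    apply: holB; last exact: hol_cst.
    by apply: hol_sub hG => z [].
  apply: holV; first by move=> z [_]; rewrite subr_eq0.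
  by apply: holB; [exact: hol_id|exact: hol_cst].
have D'g u y : u0 <= u <= u1 -> y0 <= y <= y1 -> D' (gam u y).
  by move=> uI yI; split; [exact: Dg|exact: nW].
have := cauchy_rect hg u01 y01 D'g.
have -> : (fun y => g (bilin 0 1 r 0 u1 y) * (r + u1%:C * 0) - g (bilin 0 1 r 0 u0 y) * (r + u0%:C * 0)) =
    (fun y => g (gam u1 y) * r - g (gam u0 y) * r).
  by apply/funext => y; rewrite !mulr0 !addr0.
by move=> ->; apply: eq_Cintegral => u _; rewrite !mulr0 !addr0 !mulr1.
Qed.

End InnerIntegral.

Section InnerDiff.
Context {R : realType}.
Local Notation leb := (@lebesgue_measure R).
Local Notation Im := (@complex.Im R).
Local Notation kap := (@kap R).
Local Notation omp := (@omp R).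
Local Notation omm := (@omm R).
Local Notation gp := (@gp R).
Local Notation gm := (@gm R).

Definition strip (a a' : R) : set R[i] :=
  [set z | exists u s, a <= u <= a' /\ z = Gm u s].

Definition inner (G : R[i] -> R[i]) (u : R) (W : R[i]) : R[i] :=
  Cintegral leb setT (fun s => G (Gm u s) * dGm s / (Gm u s - W)).

Variables (G : R[i] -> R[i]) (a a' C : R) (W : R[i]).
Hypotheses (aa' : a <= a') (hG : hol (strip a a') G)
  (bG : forall u, a <= u <= a' -> forall s, nm (G (Gm u s)) <= C * expR (- `|s|))
  (aW : a != rho W) (aW' : a' != rho W) (IW : Im W != 0).

(* Subtracting [k] from [G] removes the pole of [G Z / (Z - W)] between the two
   contours, at the cost of [k] times a logarithmic integral. *)
Let k := if a < rho W < a' then G W else 0.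
Let g Z := (G Z - k) / (Z - W).
Let Dp u y : a <= u <= a' -> 0 <= y -> strip a a' (gp u y).
Proof. by move=> uI y0; exists u, y; rewrite Gm_ge0. Qed.
Let Dm u y : a <= u <= a' -> y <= 0 -> strip a a' (gm u y).
Proof. by move=> uI y0; exists u, y; rewrite Gm_le0. Qed.

(** Beyond this truncation the far horizontal sides pass strictly above and below [W]. *)
Let big (Y : R) := `|Im W| < kap * Y.

Let big_ge0 Y : big Y -> 0 <= Y.
Proof.
move=> h; rewrite -(pmulr_rge0 _ (@kap_gt0 R)); apply: le_trans (ltW h).
exact: normr_ge0.
Qed.

(** If [W] lies between the two contours, the sign of [Im W] tells which half strip contains it, and
    the other contains no pole. Otherwise neither does. The same [k] serves both halves. *)
Let side_eq Y : big Y ->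
  Cintegral leb `[0, Y] (fun y => g (gp a' y) * omp - g (gp a y) * omp) =
    Cintegral leb `[a, a'] (fun u => g (gp u Y) - g (gp u 0)) /\
  Cintegral leb `[- Y, 0] (fun y => g (gm a' y) * omm - g (gm a y) * omm) =
    Cintegral leb `[a, a'] (fun u => g (gm u 0) - g (gm u (- Y))).
Proof.
move=> bY; have Y0 := big_ge0 bY; have k0 := @kap_gt0 R.
have NY0 : - Y <= 0 by rewrite oppr_le0.
have [lo up] : - Y <= Im W / kap /\ Im W / kap <= Y.
  move: (ltW bY); rewrite ler_norml => /andP[h1 h2].
  split; first by rewrite ler_pdivlMr // mulrC mulrN.
  by rewrite ler_pdivrMr // mulrC.
have np u : ~~ (a < rho W < a') -> a <= u <= a' -> u != rho W.
  move=> nI /andP[au ua']; apply: contraNneq nI => ur.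
  by rewrite !lt_neqAle aW eq_sym aW' -ur au ua'.
have WE := Gm_rho W.
split.
- apply: (half_diff hG (@sep_omp R)) => //.
  + by rewrite nm_omp.
  + by move=> u y uI /andP[y0 _]; exact: Dp.
  + rewrite /k; case: ifPn => rI; last first.
      right=> u y uI /andP[y0 _]; apply: contraNneq (np u rI uI) => <-.
      by rewrite -[bilin _ _ _ _ _ _]Gm_ge0 // rho_Gm.
    move: IW; rewrite neq_lt => /orP[I0|I0]; [right|left].
      move=> u y uI /andP[y0 _]; apply/negP => /eqP yW.
      move: I0; rewrite -yW -/gp gpE /= ltNge => /negP; apply.
      by rewrite mulr_ge0 // ltW.
    exists (rho W), (Im W / kap); split=> //.
    * by move: rI => /andP[h1 h2]; rewrite !ltW.
    * by rewrite up divr_ge0 // ltW.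
    * by rewrite -[RHS]Gm_ge0 ?WE // divr_ge0 // ltW.
- apply: (half_diff hG (@sep_omm R)) => //.
  + by rewrite nm_omm.
  + by move=> u y uI /andP[_ y0]; exact: Dm.
  + rewrite /k; case: ifPn => rI; last first.
      right=> u y uI /andP[_ y0]; apply: contraNneq (np u rI uI) => <-.
      by rewrite -[bilin _ _ _ _ _ _]Gm_le0 // rho_Gm.
    move: IW; rewrite neq_lt => /orP[I0|I0]; [left|right]; last first.
      move=> u y uI /andP[_ y0]; apply/negP => /eqP yW.
      move: I0; rewrite -yW -/gm gmE /= ltNge => /negP; apply.
      by rewrite mulr_ge0_le0 // ltW.
    have IWk : Im W / kap <= 0 by rewrite pmulr_lle0 ?invr_gt0 // ltW.
    exists (rho W), (Im W / kap); split=> //.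
    * by move: rI => /andP[h1 h2]; rewrite !ltW.
    * by rewrite lo.
    * by rewrite -[RHS]Gm_le0 ?WE.
Qed.

Let ccont_g (T : topologicalType) (f : T -> R[i]) x : strip a a' (f x) -> f x != W ->
  ccont f x -> ccont (fun y => g (f y)) x.
Proof.
move=> fD fW cf; have [dG [_ _ hdG]] := hG; have [_ cG _] := hdG _ fD.
apply: ccontM; first by apply: ccontD; [exact: cG|exact: ccont_cst].
by apply: ccontV; [rewrite subr_eq0|apply: ccontD => //; exact: ccont_cst].
Qed.

Let ccont_G (T : topologicalType) (f : T -> R[i]) x : strip a a' (f x) ->
  ccont f x -> ccont (fun y => G (f y)) x.
Proof.
by move=> fD cf; have [dG [_ _ hdG]] := hG; have [_ cG _] := hdG _ fD; exact: cG.
Qed.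

Let Tp u Y := Cintegral leb `[0, Y] (fun s => G (gp u s) * omp / (gp u s - W)).
Let Tm u Y := Cintegral leb `[- Y, 0] (fun s => G (gm u s) * omm / (gm u s - W)).

Let gpW u y : 0 <= y -> u != rho W -> gp u y != W.
Proof. by move=> y0 uW; rewrite -subr_eq0; exact: gp_neq. Qed.
Let gmW u y : y <= 0 -> u != rho W -> gm u y != W.
Proof. by move=> y0 uW; rewrite -subr_eq0; exact: gm_neq. Qed.

Let Ap_eq u Y : 0 <= Y -> a <= u <= a' -> u != rho W ->
  Cintegrable leb `[0, Y] (fun y => g (gp u y) * omp) /\
  Cintegral leb `[0, Y] (fun y => g (gp u y) * omp) = Tp u Y - k * Hp u W Y.
Proof.
move=> Y0 uI uW.
have mD : measurable (`[0, Y]%classic : set (measurableTypeR R)) by exact: measurable_itv.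
have cinv s : 0 <= s <= Y -> ccont (fun s => (gp u s - W)^-1) s.
  move=> /andP[s0 _]; apply: ccontV; first exact: gp_neq.
  by apply: ccontD; [exact: ccont_bilin2|exact: ccont_cst].
split.
  apply: cintegrable_cont => s /andP[s0 _]; apply: ccontM; last exact: ccont_cst.
  by apply: ccont_g; [exact: Dp|exact: gpW|exact: ccont_bilin2].
rewrite /Tp /Hp -(CintegralZ mD); last first.
  by apply: cintegrable_cont => s sI; apply: ccontM; [exact: ccont_cst|exact: cinv].
rewrite -(CintegralB mD).
- by apply: eq_Cintegral => s _; rewrite /g; ring.
- apply: cintegrable_cont => s sI; apply: ccontM; last exact: cinv.
  apply: ccontM; last exact: ccont_cst.
  by apply: ccont_G; [apply: Dp => //; case/andP: sI|exact: ccont_bilin2].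
- apply: (cintegrableZ mD).
  by apply: cintegrable_cont => s sI; apply: ccontM; [exact: ccont_cst|exact: cinv].
Qed.

Let Am_eq u Y : 0 <= Y -> a <= u <= a' -> u != rho W ->
  Cintegrable leb `[- Y, 0] (fun y => g (gm u y) * omm) /\
  Cintegral leb `[- Y, 0] (fun y => g (gm u y) * omm) = Tm u Y - k * Hm u W Y.
Proof.
move=> Y0 uI uW.
have mD : measurable (`[- Y, 0]%classic : set (measurableTypeR R)) by exact: measurable_itv.
have cinv s : - Y <= s <= 0 -> ccont (fun s => (gm u s - W)^-1) s.
  move=> /andP[_ s0]; apply: ccontV; first exact: gm_neq.
  by apply: ccontD; [exact: ccont_bilin2|exact: ccont_cst].
split.
  apply: cintegrable_cont => s /andP[_ s0]; apply: ccontM; last exact: ccont_cst.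
  by apply: ccont_g; [exact: Dm|exact: gmW|exact: ccont_bilin2].
rewrite /Tm /Hm -(CintegralZ mD); last first.
  by apply: cintegrable_cont => s sI; apply: ccontM; [exact: ccont_cst|exact: cinv].
rewrite -(CintegralB mD).
- by apply: eq_Cintegral => s _; rewrite /g; ring.
- apply: cintegrable_cont => s sI; apply: ccontM; last exact: cinv.
  apply: ccontM; last exact: ccont_cst.
  by apply: ccont_G; [apply: Dm => //; case/andP: sI|exact: ccont_bilin2].
- apply: (cintegrableZ mD).
  by apply: cintegrable_cont => s sI; apply: ccontM; [exact: ccont_cst|exact: cinv].
Qed.

(** The difference of the truncated contour integrals of [g], with the [k] term split off as a
    logarithmic integral. *)
Let total Y := (Tp a' Y + Tm a' Y) - (Tp a Y + Tm a Y)
  - k * ((Hp a' W Y + Hm a' W Y) - (Hp a W Y + Hm a W Y)).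

Let aI : a <= a <= a'. Proof. by rewrite lexx. Qed.
Let aI' : a <= a' <= a'. Proof. by rewrite lexx aa'. Qed.

(** The two half strips share their side on the real axis, where the contributions cancel; only the
    far sides remain. *)
Let total_eq Y : big Y ->
  Cintegrable leb `[a, a'] (fun u => g (gp u Y) - g (gm u (- Y))) /\
  total Y = Cintegral leb `[a, a'] (fun u => g (gp u Y) - g (gm u (- Y))).
Proof.
move=> bY; have Y0 := big_ge0 bY; have k0 := @kap_gt0 R.
have NY0 : - Y <= 0 by rewrite oppr_le0.
have [Ep Em] := side_eq bY.
have mDp : measurable (`[0, Y]%classic : set (measurableTypeR R)) by exact: measurable_itv.
have mDm : measurable (`[- Y, 0]%classic : set (measurableTypeR R)) by exact: measurable_itv.
have mA : measurable (`[a, a']%classic : set (measurableTypeR R)) by exact: measurable_itv.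
have [i1 e1] := Ap_eq Y0 aI aW; have [i2 e2] := Ap_eq Y0 aI' aW'.
have [i3 e3] := Am_eq Y0 aI aW; have [i4 e4] := Am_eq Y0 aI' aW'.
rewrite (CintegralB mDp i2 i1) e1 e2 in Ep.
rewrite (CintegralB mDm i4 i3) e3 e4 in Em.
have IWY : Im W < kap * Y := le_lt_trans (ler_norm _) bY.
have IWY' : - (kap * Y) < Im W.
  by rewrite ltrNl; apply: le_lt_trans bY; rewrite -normrN ler_norm.
have cp y u : 0 <= y -> kap * y != Im W -> a <= u <= a' -> ccont (fun u => g (gp u y)) u.
  move=> y0 yW uI; apply: ccont_g; [exact: Dp| |exact: ccont_bilin1].
  by apply: contraNneq yW => <-; rewrite gpE.
have cm y u : y <= 0 -> kap * y != Im W -> a <= u <= a' -> ccont (fun u => g (gm u y)) u.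
  move=> y0 yW uI; apply: ccont_g; [exact: Dm| |exact: ccont_bilin1].
  by apply: contraNneq yW => <-; rewrite gmE.
have n0 : kap * 0 != Im W by rewrite mulr0 eq_sym.
have nY : kap * Y != Im W by rewrite gt_eqF.
have nY' : kap * - Y != Im W by rewrite mulrN lt_eqF.
have gp0 u : gp u 0 = gm u 0 by rewrite gpE gmE mulr0 addr0 subr0.
split.
  apply: (cintegrableB mA); apply: cintegrable_cont => u uI; [exact: cp|exact: cm].
transitivity (Cintegral leb `[a, a'] (fun u => g (gp u Y) - g (gp u 0)) +
  Cintegral leb `[a, a'] (fun u => g (gm u 0) - g (gm u (- Y)))).
  by rewrite -Ep -Em /total; ring.
rewrite -(CintegralD mA).
- by apply: eq_Cintegral => u _; rewrite gp0; ring.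
- apply: (cintegrableB mA); apply: cintegrable_cont => u uI; apply: cp => //.
- apply: (cintegrableB mA); apply: cintegrable_cont => u uI; apply: cm => //.
Qed.

Let total_cvg : ccvg (fun n => total n.+1%:R) 0.
Proof.
have k0 := @kap_gt0 R.
have C0 : 0 <= C.
  by have := le_trans (nm_ge0 _) (bG aI 0); rewrite pmulr_lge0 // expR_gt0.
(* Numerator at most [C + nm k], distance to [W] at least [kap / 2 * Y], two far sides of length
   [a' - a], and the factor 2 of [nm_Cintegral]. *)
pose K := 2 * ((C + nm k) * (kap / 2)^-1 * 2 * (a' - a)).
apply: (@ccvg0_le _ _ (fun n => K * n.+1%:R^-1)); last first.
  have h : (fun n => K * n.+1%:R^-1) @ \oo --> K * 0.
    by apply: cvgM; [exact: cvg_cst|exact: cvg_harmonic].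
  by rewrite mulr0 in h.
near=> n; set Y := n.+1%:R.
have Y0 : 0 < Y by [].
have h1 : `|Im W| <= kap / 2 * Y.
  rewrite -ler_pdivrMl ?divr_gt0// (@le_trans _ _ n%:R) ?ler_nat//.
  by near: n; exact: nbhs_infty_ger.
have bY : big Y by rewrite /big; have := mulr_gt0 k0 Y0; lra.
have [iT ->] := total_eq bY.
have mA : measurable (`[a, a']%classic : set (measurableTypeR R)) by exact: measurable_itv.
have pb Z : nm (G Z) <= C -> kap * Y - `|Im W| <= nm (Z - W) -> nm (g Z) <= (C + nm k) * (kap / 2)^-1 * Y^-1.
  move=> h2 h3; rewrite /g nmM nmV -mulrA -invfM; apply: ler_pM.
  - exact: nm_ge0.
  - by rewrite invr_ge0 nm_ge0.
  - by rewrite (le_trans (nmB _ _)) // lerD2r.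
  - have h4 : 0 < kap / 2 * Y by rewrite mulr_gt0 // divr_gt0.
    rewrite lef_pV2 ?posrE //; last by apply: lt_le_trans h3; lra.
    by apply: le_trans h3; lra.
have e1 y : expR (- `|y|) <= 1 :> R by rewrite -expR0 ler_expR oppr_le0.
have bp u y : a <= u <= a' -> nm (G (Gm u y)) <= C.
  by move=> uI; rewrite (le_trans (bG uI y)) // ler_piMr.
have dist Z : kap * Y = `|Im Z| -> kap * Y - `|Im W| <= nm (Z - W).
  move=> ->; apply: le_trans (nm_Im _); rewrite cImD cImN.
  exact: lerB_dist.
have Y0' : 0 <= Y by exact: ltW.
pose B := (C + nm k) * (kap / 2)^-1 * Y^-1 * 2.
have Bu u : `[a, a']%classic u -> nm (g (gp u Y) - g (gm u (- Y))) <= B.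
  rewrite /= in_itv /= => uI; rewrite (le_trans (nmB _ _)) // /B mulr_natr mulr2n lerD //.
  - apply: pb; first by rewrite -Gm_ge0 //; exact: bp.
    by apply: dist; rewrite gpE /= ger0_norm // mulr_ge0 // ltW.
  - apply: pb; first by rewrite -Gm_le0 ?oppr_le0//; exact: bp.
    by apply: dist; rewrite gmE /= mulrN normrN ger0_norm // mulr_ge0 // ltW.
have iB : leb.-integrable `[a, a'] (EFin \o (fun=> B)).
  by apply: rintegrable_continuous => x _; exact: cvg_cst.
have := nm_Cintegral mA (cintegrable_cmeas iT) Bu iB.
have la : fine (leb `[a, a']) = a' - a.
  rewrite lebesgue_measure_itv /= lte_fin; case: ifPn => //.
  by rewrite -leNgt => h; apply/eqP; rewrite eq_sym subr_eq0 eq_le h aa'.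
rewrite Rintegral_cst // [X in _ * (_ * X)]la => /le_trans; apply.
by rewrite /K /B -/Y le_eqVlt; apply/orP; left; apply/eqP; ring.
Unshelve. all: by end_near. Qed.

Let T_cvg u : a <= u <= a' -> u != rho W ->
  ccvg (fun n => Tp u n.+1%:R + Tm u n.+1%:R) (inner G u W).
Proof.
move=> uI uW.
have mG : cmeas setT (fun s => G (Gm u s)).
  by have [dG [m _ _]] := hG; apply: m; exact: cmeas_Gm.
have ii := inner_integrable uW mG (bG uI).
apply: ccvg_near (Cintegral_trunc ii); near=> n.
rewrite (@Cintegral_split _ _ _ 0) ?oppr_le0 // addrC.
have mi := cintegrable_cmeas ii.
congr (_ + _); apply: (Cintegral_itv_off (s := [:: 0]) mi) => s; rewrite inE => s0.
- move=> /andP[s0' _]; have sp : 0 < s by rewrite lt_neqAle eq_sym s0.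
  by rewrite Gm_ge0 // dGm_gt0.
- move=> /andP[_ s0']; have sp : s < 0 by rewrite lt_neqAle s0.
  by rewrite Gm_le0 // dGm_lt0.
Unshelve. all: by end_near. Qed.

(** The limit of [total] gives the difference as [k] times the jump of the logarithmic integral,
    whose imaginary part passes from -3 pi/2 to pi/2 when the vertex moves to the right past
    [rho W]. *)
Lemma inner_diff : inner G a' W - inner G a W =
  if a < rho W < a' then (0 +i* (2 * pi)) * G W else 0.
Proof.
pose L u := 0 +i* (if rho W < u then pi / 2 else - (3 * (pi / 2))) : R[i].
have lim := ccvgB (ccvgB (T_cvg aI' aW') (T_cvg aI aW))
  (ccvgZ k (ccvgB (Hpm_limit aW' : ccvg _ (L a')) (Hpm_limit aW : ccvg _ (L a)))).
have := ccvg_unique lim total_cvg.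
move/eqP; rewrite subr_eq0 => /eqP ->; rewrite /k.
case: ifPn => [/andP[h1 h2]|_]; last by rewrite mul0r.
rewrite /L h2 ltNge (ltW h1) /= mulrC; congr (_ * _).
by apply: complex_eq => /=; lra.
Qed.

End InnerDiff.

(** * From arcs of a contour to vertical segments *)

Section Triangle.
Context {R : realType}.
Local Notation leb := (@lebesgue_measure R).
Local Notation Re := (@complex.Re R).
Local Notation Im := (@complex.Im R).
Local Notation kap := (@kap R).
Local Notation omp := (@omp R).
Local Notation omm := (@omm R).
Implicit Types (E : R[i] -> R[i]).

Lemma Rintegral_scale (f : R -> R) (c a b : R) : 0 < c -> a <= b -> continuous f ->
  \int[leb]_(x in `[c * a, c * b]) f x = c * \int[leb]_(x in `[a, b]) f (c * x).
Proof.
move=> c0 ab cf.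
have dc (x : R) : is_derive x (1 : R) (fun y => c * y) c.
  by apply: (is_derive_eq (derM (der_cst c x) (der_id x))); ring.
have d1 : (fun y : R => c * y)^`()%classic = cst c.
  by apply/funext => x; rewrite derive1E; apply: derive_val.
have cc : continuous (fun y : R => f (c * y)).
  move=> x; apply: continuous_comp; last exact: cf.
  exact: cvg_real_fun (dc x).
rewrite -RintegralZl; [|exact: measurable_itv|]; last first.
  by apply: rintegrable_continuous => x _; exact: cc.
rewrite /Rintegral; congr fine.
rewrite (@integration_by_substitution_increasing _ (fun y => c * y) f a b) //.
- by rewrite d1; apply: eq_integral => x _; rewrite /= mulrC.
- by move=> x y _ _ xy; rewrite ltr_pM2l.
- by move=> x _; rewrite d1; exact: cvg_cst.
- by rewrite d1; exact: is_cvg_cst.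
- by rewrite d1; exact: is_cvg_cst.
- split.
  + by move=> x _; have [] := dc x.
  + by apply: cvg_at_right_filter; exact: cvg_real_fun (dc a).
  + by apply: cvg_at_left_filter; exact: cvg_real_fun (dc b).
- exact: continuous_subspaceT.
Qed.

Definition wint E (b r : R) : R[i] :=
  Cintegral leb `[- r, r] (fun s => E (Gm b s) * dGm s).

Definition vint E (m h : R) : R[i] :=
  'i%C * Cintegral leb `[- h, h] (fun t => E (m +i* t)).

Lemma ccont_hol E (T : topologicalType) (f : T -> R[i]) x : hol setT E ->
  ccont f x -> ccont (fun y => E (f y)) x.
Proof. by move=> [dE [_ _ hE]] cf; have [_ cE _] := hE (f x) I; exact: cE. Qed.

Lemma ccont_vert (m t : R) : ccont (fun t => m +i* t) t.
Proof. by split => /=; [exact: cvg_cst|exact: cvg_id]. Qed.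

(** Parametrizes the segment by the contour parameter, to match the sides of the triangles in
    [wint_vint]. *)
Lemma vint_scale E (m r : R) : hol setT E -> 0 <= r ->
  vint E m (kap * r) = ('i%C * kap%:C) * Cintegral leb `[- r, r] (fun s => E (m +i* (kap * s))).
Proof.
move=> hE r0; rewrite /vint -mulrA; congr (_ * _).
have rr : - r <= r by apply: (@le_trans _ _ 0) => //; rewrite oppr_le0.
rewrite -mulrN /Cintegral.
have cE : continuous (fun t => Re (E (m +i* t))) /\ continuous (fun t => Im (E (m +i* t))).
  by split=> t; have [] := ccont_hol hE (ccont_vert m t).
rewrite (Rintegral_scale kap_gt0 rr cE.1) (Rintegral_scale kap_gt0 rr cE.2).
by apply: complex_eq => /=; ring.
Qed.

Lemma Cintegral_split_itv (f : R -> R[i]) a b c : a <= b -> b <= c ->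
  Cintegrable leb `[a, c] f ->
  Cintegral leb `[a, c] f = Cintegral leb `[a, b] f + Cintegral leb `[b, c] f.
Proof.
move=> ab bc fi.
pose f' x := if a <= x <= c then f x else 0.
have mac : measurable (`[a, c]%classic : set (measurableTypeR R)) by exact: measurable_itv.
have fi' : Cintegrable leb setT f'.
  split.
  - have := (@integrable_mkcond _ _ _ leb _ _ mac).1 fi.1; congr (_.-integrable _ _).
    by apply/funext => x; rewrite patchE mem_setE in_itv /= /f'; case: ifP.
  - have := (@integrable_mkcond _ _ _ leb _ _ mac).1 fi.2; congr (_.-integrable _ _).
    by apply/funext => x; rewrite patchE mem_setE in_itv /= /f'; case: ifP.
have ff' x y : a <= x -> y <= c -> Cintegral leb `[x, y] f = Cintegral leb `[x, y] f'.
  move=> ax yc; apply: eq_Cintegral => t /=; rewrite in_itv /= /f' => /andP[h1 h2].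
  by rewrite (le_trans ax h1) (le_trans h2 yc).
by rewrite !ff' //; exact: Cintegral_split.
Qed.

Lemma cmeas_E E : hol setT E -> forall d (T : measurableType d) (f : T -> R[i]),
  cmeas setT f -> cmeas setT (fun s => E (f s)).
Proof. by move=> [dE [mE _ _]] d T f mf; exact: mE. Qed.

Lemma ccont_Gm (b s : R) : ccont (Gm b) s.
Proof.
split=> /=.
- apply: cvgD; [exact: cvg_cst|apply: cvgM; [exact: cvg_cst|]].
  by apply: cvg_norm; exact: cvg_id.
- by apply: cvgM; [exact: cvg_cst|exact: cvg_id].
Qed.

Lemma wint_integrable E (b x y : R) : hol setT E ->
  Cintegrable leb `[x, y] (fun s => E (Gm b s) * dGm s).
Proof.
move=> hE.
have mxy : measurable (`[x, y]%classic : set (measurableTypeR R)) by exact: measurable_itv.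
have iE : Cintegrable leb `[x, y] (fun s => E (Gm b s)).
  by apply: cintegrable_cont => s _; apply: ccont_hol => //; exact: ccont_Gm.
apply: (@cintegrable_dom _ _ _ leb _ mxy _ (fun s => nm (E (Gm b s)))).
- apply: cmeasM; first exact: cintegrable_cmeas iE.
  by apply: (@cmeasS _ _ _ _ setT) => //; exact: cmeas_dGm.
- by move=> s _; rewrite nmM ler_piMr ?nm_ge0 // nm_dGm.
- exact: rintegrable_nm.
Qed.

(** Cauchy's theorem on the two triangles cut out by the arc, the vertical chord and the real axis.
    In each patch the side [y = r], respectively [y = - r], collapses to the end point of the arc,
    and the common side [z] on the real axis cancels. *)
Lemma wint_vint E (b r : R) : hol setT E -> 0 <= r ->
  wint E b r = vint E (b + kap * r) (kap * r).
Proof.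
move=> hE r0; rewrite vint_scale //.
have rr : - r <= 0 by rewrite oppr_le0.
have mDp : measurable (`[0, r]%classic : set (measurableTypeR R)) by exact: measurable_itv.
have mDm : measurable (`[- r, 0]%classic : set (measurableTypeR R)) by exact: measurable_itv.
have mD1 : measurable (`[0, 1]%classic : set (measurableTypeR R)) by exact: measurable_itv.
have mDr : measurable (`[- r, r]%classic : set (measurableTypeR R)) by exact: measurable_itv.
pose q := (kap * r)%:C.
have Hp := cauchy_rect (p := b%:C) (q := q) (r := omp) (s := - kap%:C) hE (@ler01 R) r0 (fun _ _ _ _ => I).
have Hm := cauchy_rect (p := b%:C) (q := q) (r := omm) (s := kap%:C) hE (@ler01 R) rr (fun _ _ _ _ => I).
pose v s := E ((b + kap * r) +i* (kap * s)) * ('i%C * kap%:C).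
have cv s : ccont v s.
  apply: ccontM; last exact: ccont_cst; apply: ccont_hol => //.
  split => /=; [exact: cvg_cst|].
  by apply: cvgM; [exact: cvg_cst|exact: cvg_id].
have cgp s : ccont (fun s => E (gp b s) * omp) s.
  apply: ccontM; last exact: ccont_cst; apply: ccont_hol => //; exact: ccont_bilin2.
have cgm s : ccont (fun s => E (gm b s) * omm) s.
  apply: ccontM; last exact: ccont_cst; apply: ccont_hol => //; exact: ccont_bilin2.
pose z := fun u : R => E (b%:C + u%:C * q) * q.
have cz u : ccont z u.
  apply: ccontM; last exact: ccont_cst; apply: ccont_hol => //.
  by apply: ccontD; [exact: ccont_cst|apply: ccontM; [exact: ccont_id|exact: ccont_cst]].
have ip f x y : (forall s, ccont f s) -> Cintegrable leb `[x, y] f.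
  by move=> cf; apply: cintegrable_cont => s _; exact: cf.
have Ep : Cintegral leb `[0, r] v - Cintegral leb `[0, r] (fun s => E (gp b s) * omp) =
    - Cintegral leb `[0, 1] z.
  rewrite -(CintegralB mDp (ip _ _ _ cv) (ip _ _ _ cgp)) -(CintegralN mD1 (ip _ _ _ cz)).
  move: Hp; congr (_ = _); apply: eq_Cintegral => t _.
    rewrite /v; congr (E _ * _ - E _ * _).
    + by rewrite /bilin /q; apply: complex_eq => /=; ring.
    + by apply: complex_eq => /=; ring.
    + by rewrite /gp /bilin; apply: complex_eq => /=; ring.
    + by apply: complex_eq => /=; ring.
  have -> : q + r%:C * - kap%:C = 0 by apply: complex_eq => /=; ring.
  by rewrite mulr0 sub0r /z /bilin !mul0r addr0 addr0.
have Em : Cintegral leb `[- r, 0] v - Cintegral leb `[- r, 0] (fun s => E (gm b s) * omm) =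
    Cintegral leb `[0, 1] z.
  rewrite -(CintegralB mDm (ip _ _ _ cv) (ip _ _ _ cgm)).
  move: Hm; congr (_ = _); apply: eq_Cintegral => t _.
    rewrite /v; congr (E _ * _ - E _ * _).
    + by rewrite /bilin /q; apply: complex_eq => /=; ring.
    + by apply: complex_eq => /=; ring.
    + by rewrite /gm /bilin; apply: complex_eq => /=; ring.
    + by apply: complex_eq => /=; ring.
  have -> : q + (- r)%:C * kap%:C = 0 by apply: complex_eq => /=; ring.
  by rewrite mulr0 subr0 /z /bilin !mul0r addr0 addr0.
have mE : cmeas setT (fun s => E (Gm b s) * dGm s).
  by apply: cmeasM; [apply: cmeas_E => //; exact: cmeas_Gm|exact: cmeas_dGm].
have -> : wint E b r = Cintegral leb `[- r, 0] (fun s => E (gm b s) * omm) +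
    Cintegral leb `[0, r] (fun s => E (gp b s) * omp).
  rewrite /wint (Cintegral_split_itv rr r0); last exact: wint_integrable.
  congr (_ + _); apply: (Cintegral_itv_off (s := [:: 0]) mE) => s; rewrite inE => s0.
  - move=> /andP[_ s0']; have sp : s < 0 by rewrite lt_neqAle s0.
    by rewrite Gm_le0 // dGm_lt0.
  - move=> /andP[s0' _]; have sp : 0 < s by rewrite lt_neqAle eq_sym s0.
    by rewrite Gm_ge0 // dGm_gt0.
rewrite -(CintegralZ mDr); last first.
  apply: cintegrable_cont => s _; apply: ccont_hol => //.
  split => /=; [exact: cvg_cst|].
  by apply: cvgM; [exact: cvg_cst|exact: cvg_id].
have -> : (fun x => 'i%C * kap%:C * E ((b + kap * r) +i* (kap * x))) = v.
  by apply/funext => s; rewrite /v mulrC.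
rewrite (Cintegral_split_itv rr r0 (ip _ _ _ cv)).
move/eqP: Ep; rewrite subr_eq => /eqP ->.
by move/eqP: Em; rewrite subr_eq => /eqP ->; ring.
Qed.

Lemma vintN E (m h : R) : hol setT E ->
  vint (fun z => E (- z)) (- m) h = vint E m h.
Proof.
move=> hE; rewrite /vint; congr (_ * _).
rewrite !(@Cintegral_if _ (fun x => - h <= x <= h)) //.
rewrite -[RHS]Cintegral_opp; last first.
  have mac : measurable (`[- h, h]%classic : set (measurableTypeR R)) by exact: measurable_itv.
  have fi : Cintegrable leb `[- h, h] (fun t => E (m +i* t)).
    by apply: cintegrable_cont => t _; apply: ccont_hol => //; exact: ccont_vert.
  split.
  - have := (@integrable_mkcond _ _ _ leb _ _ mac).1 fi.1; congr (_.-integrable _ _).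
    by apply/funext => x; rewrite patchE mem_setE in_itv /=; case: ifP.
  - have := (@integrable_mkcond _ _ _ leb _ _ mac).1 fi.2; congr (_.-integrable _ _).
    by apply/funext => x; rewrite patchE mem_setE in_itv /=; case: ifP.
apply: eq_Cintegral => t _.
rewrite (_ : (- h <= - t <= h) = (- h <= t <= h)); last by rewrite lerN2 lerNl andbC.
case: ifP => // _; congr (E _).
by apply: complex_eq => /=; rewrite ?opprK.
Qed.

End Triangle.

(** * Moving the contours of a double integral *)

Section DoubleIntegral.
Context {R : realType}.
Local Notation leb := (@lebesgue_measure R).
Local Notation TR := (measurableTypeR R).
Local Notation Im := (@complex.Im R).
Local Notation kap := (@kap R).
Implicit Types (G E : R[i] -> R[i]) (a b : R).

(** The factors decay cubically in the exponent; this weaker form is what the weights [wexp]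
    absorb. *)
Definition decay G a C : Prop :=
  cmeas setT (fun s => G (Gm a s)) /\ forall s, nm (G (Gm a s)) <= C * expR (- `|s|).

(* The integrand of K^3 after w -> -w. *)
Definition pullS G1 a G2 b (s : R * R) : R[i] :=
  G1 (Gm a s.1) * dGm s.1 * (G2 (Gm b s.2) * dGm s.2) / (Gm a s.1 + Gm b s.2).

Definition Sint G1 a G2 b : R[i] := Cintegral (leb2 R) setT (pullS G1 a G2 b).

(** When positive, [d] is the parameter of the crossing points. With X = |s| - d and Y = |t| - d,
    the squared modulus is at least kap^2 ((X + Y)^2 + (X - Y)^2) = X^2 + Y^2, because |s + t| is at
    least the distance between |s| and |t|. *)
Lemma Gm_sum_sep a b s t d : d = - ((a + b) * kap) ->
  `| `|s| - d| * `| `|t| - d| <= 4 * nm (Gm a s + Gm b t) ^+ 2.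
Proof.
move=> dE; rewrite nm_sqr /=.
have k2 := @kap2 R.
have ab : a + b = - (2 * kap * d).
  rewrite dE; have -> : - (2 * kap * - ((a + b) * kap)) = (a + b) * (2 * kap ^+ 2) by ring.
  by rewrite k2 mulr1.
have -> : a + kap * `|s| + (b + kap * `|t|) = kap * (`|s| + `|t| - 2 * d).
  by rewrite addrACA ab; ring.
have -> : kap * s + kap * t = kap * (s + t) by ring.
rewrite !exprMn -mulrDr.
have -> : kap ^+ 2 = 1 / 2 by lra.
have h1 : `| `|s| - d| * `| `|t| - d| <= ((`|s| - d) ^+ 2 + (`|t| - d) ^+ 2) / 2.
  have := sqr_ge0 (`| `|s| - d| - `| `|t| - d|).
  have := real_normK (num_real (`|s| - d)); have := real_normK (num_real (`|t| - d)).
  by move=> <- <-; lra.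
have h2 : (s + t) ^+ 2 >= `|s| ^+ 2 + `|t| ^+ 2 - 2 * (`|s| * `|t|).
  have h3 : - (s * t) <= `|s| * `|t| by rewrite -normrM -normrN ler_norm.
  by rewrite !real_normK ?num_real //; lra.
have h4 := sqr_ge0 (`|s| - d); have h5 := sqr_ge0 (`|t| - d).
by apply: (le_trans h1); nra.
Qed.

Lemma pullS_cmeas G1 a G2 b C1 C2 : decay G1 a C1 -> decay G2 b C2 ->
  cmeas setT (pullS G1 a G2 b).
Proof.
move=> [m1 _] [m2 _].
have f1 : measurable_fun setT (fst : TR * TR -> TR) by exact: measurable_fst.
have f2 : measurable_fun setT (snd : TR * TR -> TR) by exact: measurable_snd.
apply: cmeasM.
  apply: cmeasM; apply: cmeasM.
  - exact: (cmeas_comp m1 f1).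
  - exact: (cmeas_comp cmeas_dGm f1).
  - exact: (cmeas_comp m2 f2).
  - exact: (cmeas_comp cmeas_dGm f2).
apply: cmeasV; apply: cmeasD.
- exact: (cmeas_comp (cmeas_Gm a) f1).
- exact: (cmeas_comp (cmeas_Gm b) f2).
Qed.

Definition dom2 a b (s : R * R) : R :=
  wexp (- ((a + b) * kap)) s.1 * wexp (- ((a + b) * kap)) s.2.

Lemma integrable_dom2 a b : (leb2 R).-integrable setT (EFin \o dom2 a b).
Proof.
exact: (@integrable_prod_mul _ _ _ TR TR leb leb _ _ (@wexp_ge0 R _) (@wexp_ge0 R _)
  (@integrable_wexp R _) (@integrable_wexp R _)).
Qed.

(** Outside these values the weights [wexp] in [dom2] do not take the default value of [isq] at 0,
    and the domination is valid. *)
Definition exc a b : seq R := [:: - ((a + b) * kap); (a + b) * kap].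

Lemma excP a b s : s \notin exc a b -> `|s| - - ((a + b) * kap) != 0.
Proof.
rewrite !inE negb_or => /andP[h1 h2]; rewrite subr_eq0.
have [s0|s0] := leP 0 s; first by rewrite ger0_norm.
by rewrite ltr0_norm // eqr_opp.
Qed.

Lemma inv_sum_le a b s t : s \notin exc a b -> t \notin exc a b ->
  expR (- `|s|) * expR (- `|t|) * (nm (Gm a s + Gm b t))^-1 <= 2 * dom2 a b (s, t).
Proof.
move=> /excP hs /excP ht; rewrite /dom2 /wexp /=.
set d := - ((a + b) * kap) in hs ht *.
have sep := Gm_sum_sep s t (erefl d).
have n0 : 0 < nm (Gm a s + Gm b t).
  rewrite lt_neqAle nm_ge0 andbT eq_sym; apply/negP => /eqP n0.
  by move: sep; rewrite n0 expr0n /= mulr0 leNgt mulr_gt0 ?normr_gt0.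
have := inv_nm_isq hs ht n0 sep.
have e : 0 <= expR (- `|s|) * expR (- `|t|) by rewrite mulr_ge0 ?expR_ge0.
move=> /(ler_wpM2l e) /le_trans; apply.
by rewrite le_eqVlt; apply/orP; left; apply/eqP; ring.
Qed.

Lemma pullS_bound G1 a G2 b C1 C2 s : decay G1 a C1 -> decay G2 b C2 ->
  s.1 \notin exc a b -> s.2 \notin exc a b ->
  nm (pullS G1 a G2 b s) <= C1 * C2 * (2 * dom2 a b s).
Proof.
move=> [_ b1] [_ b2] s1 s2.
have C10 : 0 <= C1.
  by have := le_trans (nm_ge0 _) (b1 0); rewrite pmulr_lge0 // expR_gt0.
have C20 : 0 <= C2.
  by have := le_trans (nm_ge0 _) (b2 0); rewrite pmulr_lge0 // expR_gt0.
case: s s1 s2 => s t /= s1 s2; have := inv_sum_le s1 s2.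
move=> /(ler_wpM2l (mulr_ge0 C10 C20)) /(le_trans _); apply.
rewrite /pullS !nmM nmV /= [leRHS]mulrA ler_wpM2r ?invr_ge0 ?nm_ge0 //.
have -> : C1 * C2 * (expR (- `|s|) * expR (- `|t|)) =
  (C1 * expR (- `|s|) * 1) * (C2 * expR (- `|t|) * 1) by ring.
by apply: ler_pM; rewrite ?mulr_ge0 ?nm_ge0 //; apply: ler_pM; rewrite ?nm_ge0 ?nm_dGm ?b1 ?b2.
Qed.

Lemma cintegrable2_off (e1 e2 : seq R) (f : R * R -> R[i]) (g : R * R -> R) :
  cmeas setT f -> (leb2 R).-integrable setT (EFin \o g) ->
  (forall s, s.1 \notin e1 -> s.2 \notin e2 -> nm (f s) <= g s) ->
  Cintegrable (leb2 R) setT f.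
Proof.
move=> [m1 m2] ig fg; split.
- apply: (integrable2_off m1 ig (s := e1) (t := e2)) => z h1 h2.
  exact: le_trans (nm_Re _) (fg _ h1 h2).
- apply: (integrable2_off m2 ig (s := e1) (t := e2)) => z h1 h2.
  exact: le_trans (nm_Im _) (fg _ h1 h2).
Qed.

Lemma pullS_integrable G1 a G2 b C1 C2 : decay G1 a C1 -> decay G2 b C2 ->
  Cintegrable (leb2 R) setT (pullS G1 a G2 b).
Proof.
move=> d1 d2; apply: (@cintegrable2_off (exc a b) (exc a b) _ (fun s => C1 * C2 * (2 * dom2 a b s))).
- exact: pullS_cmeas d1 d2.
- apply: (@rintegrableZ _ _ _ (leb2 R) _ measurableT _ (fun s => 2 * dom2 a b s)).
  apply: (@rintegrableZ _ _ _ (leb2 R) _ measurableT _ (dom2 a b)).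
  exact: integrable_dom2.
- by move=> s s1 s2; exact: pullS_bound.
Qed.

Lemma Sint_swap G1 a G2 b C1 C2 : decay G1 a C1 -> decay G2 b C2 ->
  Sint G1 a G2 b = Sint G2 b G1 a.
Proof.
move=> d1 d2; rewrite /Sint.
rewrite (@Cintegral_prod12 _ _ _ TR TR leb leb _ (pullS_integrable d1 d2)).
rewrite (@Cintegral_prod21 _ _ _ TR TR leb leb _ (pullS_integrable d2 d1)).
apply: eq_Cintegral => s _; apply: eq_Cintegral => t _.
by rewrite /pullS /= [Gm a s + _]addrC; ring.
Qed.

Lemma rho_NGm b t : rho (- Gm b t) = - b - 2 * kap * `|t|.
Proof.
rewrite /rho cReN cImN /= normrN normrM (gtr0_norm kap_gt0); ring.
Qed.

(** Fubini with the moved contour innermost, then [inner_diff] at [W = - Gm b t]. The list [ex]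
    contains the parameters for which [W] is real or lies on one of the two contours. *)
Lemma Sint_diff G1 a a' G2 b C1 C2 : a <= a' -> hol (strip a a') G1 ->
  (forall u, a <= u <= a' -> forall s, nm (G1 (Gm u s)) <= C1 * expR (- `|s|)) ->
  decay G2 b C2 ->
  Sint G1 a' G2 b - Sint G1 a G2 b = (0 +i* (2 * pi)) *
    Cintegral leb setT (fun t => if a < - b - 2 * kap * `|t| < a'
      then G1 (- Gm b t) * G2 (Gm b t) * dGm t else 0).
Proof.
move=> aa' hG bG d2; have k0 := @kap_gt0 R.
have dec u : a <= u <= a' -> decay G1 u C1.
  move=> uI; split; last exact: bG.
  by have [dG [m _ _]] := hG; apply: m; exact: cmeas_Gm.
have aI : a <= a <= a' by rewrite lexx.
have aI' : a <= a' <= a' by rewrite lexx aa'.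
have i1 := pullS_integrable (dec _ aI) d2.
have i2 := pullS_integrable (dec _ aI') d2.
have m2 : measurable (setT : set (TR * TR)) by [].
rewrite /Sint -(CintegralB m2 i2 i1).
rewrite (@Cintegral_prod21 _ _ _ TR TR leb leb _ (cintegrableB m2 i2 i1)).
have mL := @cmeas_Cintegral_prod2 _ _ _ TR TR leb leb _ (cintegrableB m2 i2 i1).
set F := fun t => if _ then _ else 0.
have inn u t : a <= u <= a' -> u != rho (- Gm b t) ->
  Cintegrable leb setT (fun s => pullS G1 u G2 b (s, t)) /\
  Cintegral leb setT (fun s => pullS G1 u G2 b (s, t)) =
  (G2 (Gm b t) * dGm t) * inner G1 u (- Gm b t).
  move=> uI uW; have [mG bG'] := dec u uI.
  have ii := inner_integrable uW mG bG'.
  have E s : pullS G1 u G2 b (s, t) =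
      (G2 (Gm b t) * dGm t) * (G1 (Gm u s) * dGm s / (Gm u s - - Gm b t)).
    by rewrite /pullS /= opprK; ring.
  split.
    by rewrite (funext E); exact: cintegrableZ.
  by rewrite (funext E) CintegralZ.
pose ex := [:: 0; - ((a + b) * kap); (a + b) * kap; - ((a' + b) * kap); (a' + b) * kap].
have k2 := @kap2 R.
have ne u t : t \notin exc u b -> u != rho (- Gm b t).
  move=> /excP; apply: contraNneq; rewrite rho_NGm => ->.
  rewrite subr_eq0; apply/eqP.
  have -> : - ((- b - 2 * kap * `|t| + b) * kap) = `|t| * (2 * kap ^+ 2) by ring.
  by rewrite k2 mulr1.
transitivity (Cintegral leb setT (fun t => (0 +i* (2 * pi)) * F t)); last first.
  have C10 : 0 <= C1.
    by have := le_trans (nm_ge0 _) (bG a aI 0); rewrite pmulr_lge0 // expR_gt0.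
  apply: (CintegralZ measurableT).
  apply: (@cintegrable_dom _ _ _ leb setT measurableT _ (fun t => C1 * C2 * expR (- `|t|))).
  - apply: cmeas_if.
      apply: measurable_and; apply: measurable_fun_ltr; try exact: measurable_cst.
        apply: measurable_funB; first exact: measurable_cst.
        by apply: measurable_funM; [exact: measurable_cst|exact: normr_measurable].
      apply: measurable_funB; first exact: measurable_cst.
      by apply: measurable_funM; [exact: measurable_cst|exact: normr_measurable].
    apply: cmeasM; last exact: cmeas_dGm.
    apply: cmeasM; last exact: d2.1.
    by have [dG [m _ _]] := hG; apply: m; apply: cmeasN; exact: cmeas_Gm.
  - move=> t _; rewrite /F; have b2 := d2.2 t; case: ifPn => [/andP[r1 r2]|_]; last first.
      rewrite nm0; have := le_trans (nm_ge0 _) b2 => h.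
      by rewrite -mulrA mulr_ge0.
    rewrite !nmM -[leRHS]mulr1; apply: ler_pM; rewrite ?mulr_ge0 ?nm_ge0 ?nm_dGm //.
    rewrite -mulrA; apply: ler_pM; rewrite ?nm_ge0 //.
    rewrite -rho_NGm in r1 r2.
    rewrite -(Gm_rho (- Gm b t)) (le_trans (bG _ _ _)) ?(ltW r1) ?(ltW r2) //.
    by rewrite ler_piMr // -expR0 ler_expR oppr_le0.
  - by apply: (rintegrableZ measurableT); exact: integrable_expRabs.
apply: (Cintegral_eq_off (s := ex) mL) => t.
rewrite !inE !negb_or => /and5P[t0 h1 h2 h3 h4].
have na : a != rho (- Gm b t) by apply: ne; rewrite !inE negb_or h1 h2.
have na' : a' != rho (- Gm b t) by apply: ne; rewrite !inE negb_or h3 h4.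
have IW : Im (- Gm b t) != 0 by rewrite cImN /= oppr_eq0 mulf_neq0 // gt_eqF.
have [j1 e1] := inn a t aI na; have [j2 e2] := inn a' t aI' na'.
rewrite (CintegralB measurableT j2 j1) e1 e2 -mulrBr.
rewrite (inner_diff aa' hG bG na na' IW) rho_NGm /F.
by case: ifP => _; rewrite ?mulr0 //; ring.
Qed.

(** The parameter at which [- Gm b] meets [Gm a], clipped at 0 when they do not cross. *)
Definition rcross a b : R := Num.max 0 (- ((a + b) * kap)).

(** Up to finitely many points, [- Gm b t] lies between the contours exactly when [|t|] is between
    [rcross a' b] and [rcross a b]: the two arcs are the difference of two central arcs. *)
Lemma Sint_diff_wint G1 a a' G2 b E C1 C2 : a <= a' -> hol (strip a a') G1 ->
  (forall u, a <= u <= a' -> forall s, nm (G1 (Gm u s)) <= C1 * expR (- `|s|)) ->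
  decay G2 b C2 -> hol setT E ->
  (forall t, a < rho (- Gm b t) < a' -> G1 (- Gm b t) * G2 (Gm b t) = E (Gm b t)) ->
  Sint G1 a' G2 b - Sint G1 a G2 b =
    (0 +i* (2 * pi)) * (wint E b (rcross a b) - wint E b (rcross a' b)).
Proof.
move=> aa' hG bG d2 hE GE; rewrite (Sint_diff aa' hG bG d2); congr (_ * _).
have k0 := @kap_gt0 R; have k2 := @kap2 R.
pose f t := E (Gm b t) * dGm t.
have mf : cmeas setT f.
  by apply: cmeasM; [apply: cmeas_E => //; exact: cmeas_Gm|exact: cmeas_dGm].
pose fr r t := if - r <= t <= r then f t else 0.
have ifr r : Cintegrable leb setT (fr r).
  have mac : measurable (`[- r, r]%classic : set TR) by exact: measurable_itv.
  have fi := @wint_integrable R E b (- r) r hE.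
  split.
  - have := (@integrable_mkcond _ _ _ leb _ _ mac).1 fi.1; congr (_.-integrable _ _).
    by apply/funext => x; rewrite patchE mem_setE in_itv /= /fr; case: ifP.
  - have := (@integrable_mkcond _ _ _ leb _ _ mac).1 fi.2; congr (_.-integrable _ _).
    by apply/funext => x; rewrite patchE mem_setE in_itv /= /fr; case: ifP.
have wE r : wint E b r = Cintegral leb setT (fr r).
  by rewrite /wint (@Cintegral_if _ (fun t => - r <= t <= r)).
rewrite !wE -(CintegralB measurableT) //; apply/esym.
have rr (x : R) : Num.max 0 x = if x <= 0 then 0 else x by rewrite /Num.max; case: (ltP 0 x).
apply: (Cintegral_eq_off (s := 0 :: [:: rcross a b; - rcross a b; rcross a' b; - rcross a' b])).
  exact: (cintegrable_cmeas (cintegrableB measurableT (ifr _) (ifr _))).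
move=> t; rewrite !inE !negb_or => /and5P[t0 h1 h2 h3 h4].
have at0 : 0 < `|t| by rewrite normr_gt0.
have key u : t != rcross u b -> t != - rcross u b ->
    (- rcross u b <= t <= rcross u b) = (u < - b - 2 * kap * `|t|).
  move=> n1 n2; rewrite -ler_norml.
  have -> : (u < - b - 2 * kap * `|t|) = (`|t| < - ((u + b) * kap)).
    have e : (- b - 2 * kap * `|t| - u) * kap = - ((u + b) * kap) - `|t|.
      have : 2 * kap ^+ 2 * `|t| = `|t| by rewrite k2 mul1r.
      by move=> {2}<-; ring.
    by rewrite -subr_gt0 -(pmulr_lgt0 _ k0) e subr_gt0.
  have nt : `|t| != rcross u b.
    by have [s0|s0] := leP 0 t; [rewrite ger0_norm|rewrite ltr0_norm // eqr_oppLR].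
  rewrite le_eqVlt (negbTE nt) /= /rcross rr; case: ifPn => // x0.
  by rewrite ltNge (ltW at0) /=; apply/esym; apply: contraTF at0 => /lt_le_trans/(_ x0); rewrite -leNgt => /ltW.
rewrite /fr !key //.
have xx : (a' < - b - 2 * kap * `|t|) -> (a < - b - 2 * kap * `|t|) by exact: le_lt_trans.
have [z|z|z] := ltgtP a' (- b - 2 * kap * `|t|).
- by rewrite xx // subrr andbF.
- case: ifPn => az; rewrite ?subr0 //= /f -GE // rho_NGm; by rewrite az z.
- have : rcross a' b = `|t|.
    have -> : rcross a' b = Num.max 0 (`|t| * (2 * kap ^+ 2)) by rewrite /rcross z; congr Num.max; ring.
    by rewrite k2 mulr1 rr leNgt at0.
  have [s0|s0] := leP 0 t.
    by rewrite ger0_norm // => e; rewrite e eqxx in h3.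
  by rewrite ltr0_norm // => e; rewrite e opprK eqxx in h4.
Qed.

End DoubleIntegral.

(** * Invariance of the sum of single and double integral *)

Section Total.
Context {R : realType}.
Local Notation leb := (@lebesgue_measure R).
Local Notation kap := (@kap R).
Implicit Types (G E : R[i] -> R[i]) (a b : R).

Lemma vint0 E (m : R) : vint E m 0 = 0.
Proof.
by rewrite /vint /Cintegral oppr0 set_itv1 !Rintegral_set1 mulr0.
Qed.

(* Half the length of the vertical segment joining the crossing points of [Gm a]
   and [- Gm b], and 0 if there are none. *)
Definition hcross a b : R := Num.max 0 (- ((a + b) / 2)).
Definition vcross E a b : R[i] := vint E ((b - a) / 2) (hcross a b).

Lemma wint_vcross E a b : hol setT E -> wint E b (rcross a b) = vcross E a b.
Proof.
move=> hE; have k0 := @kap_gt0 R; have k2 := @kap2 R.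
have r0 : 0 <= rcross a b by rewrite /rcross le_max lexx.
rewrite (wint_vint _ hE r0) /vcross.
have kk : kap * - ((a + b) * kap) = - ((a + b) / 2).
  have -> : kap * - ((a + b) * kap) = - (a + b) / 2 * (2 * kap ^+ 2) by field.
  by rewrite k2 mulr1 mulNr.
have -> : kap * rcross a b = hcross a b.
  by rewrite /rcross /hcross maxr_pMr ?ltW // mulr0 kk.
rewrite /hcross; have [h|h] := leP (- ((a + b) / 2)) 0.
  by rewrite !vint0.
by congr vint; field.
Qed.

Lemma vcross_swap E a b : hol setT E -> vcross (fun z => E (- z)) b a = vcross E a b.
Proof.
move=> hE; rewrite /vcross -(vintN ((b - a) / 2) (hcross a b) hE); congr vint.
  by field.
by rewrite /hcross addrC.
Qed.

Definition twoipi : R[i] := (2 * pi)%:C * 'i%C.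

Lemma twoipi_neq0 : twoipi != 0.
Proof.
rewrite mulf_neq0 //; last by rewrite eq_complex /= oner_eq0 andbF.
by rewrite eq_complex /= negb_and mulf_neq0 // gt_eqF // pi_gt0.
Qed.

(* K^1 + K^3, for [E w = G1 (- w) * G2 w]. *)
Definition Ttot G1 a G2 b E : R[i] :=
  twoipi^-1 * vcross E a b + (twoipi ^+ 2)^-1 * Sint G1 a G2 b.

(** The double integral gains [twoipi] times what [vcross] loses, which the two normalizing powers
    of [twoipi] balance. *)
Lemma Ttot_move G1 a a' G2 b E C1 C2 : a <= a' -> hol (strip a a') G1 ->
  (forall u, a <= u <= a' -> forall s, nm (G1 (Gm u s)) <= C1 * expR (- `|s|)) ->
  decay G2 b C2 -> hol setT E ->
  (forall t, a < rho (- Gm b t) < a' -> G1 (- Gm b t) * G2 (Gm b t) = E (Gm b t)) ->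
  Ttot G1 a G2 b E = Ttot G1 a' G2 b E.
Proof.
move=> aa' hG bG d2 hE GE.
have H := Sint_diff_wint aa' hG bG d2 hE GE.
rewrite !wint_vcross // in H.
have tE : (0 +i* (2 * pi)) = twoipi by apply: complex_eq => /=; ring.
rewrite tE in H.
have t0 := twoipi_neq0.
rewrite /Ttot.
have -> : Sint G1 a' G2 b = Sint G1 a G2 b + twoipi * (vcross E a b - vcross E a' b).
  by rewrite -H addrC subrK.
by field.
Qed.

Lemma Ttot_swap G1 a G2 b E C1 C2 : decay G1 a C1 -> decay G2 b C2 -> hol setT E ->
  Ttot G1 a G2 b E = Ttot G2 b G1 a (fun z => E (- z)).
Proof.
by move=> d1 d2 hE; rewrite /Ttot (Sint_swap d1 d2) vcross_swap.
Qed.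

(** The substitution w -> -w also reverses the parameter of the second contour, see [Gamma_minusE].
    The reversal is undone inside the iterated integral, for almost every [s.1]. *)
Lemma pull_opp G1 a G2 b C1 C2 : decay G1 a C1 -> decay G2 b C2 ->
  Cintegrable (leb2 R) setT (fun s : R * R => pullS G1 a G2 b (s.1, - s.2)) /\
  Cintegral (leb2 R) setT (fun s : R * R => pullS G1 a G2 b (s.1, - s.2)) = Sint G1 a G2 b.
Proof.
move=> d1 d2; have i0 := pullS_integrable d1 d2.
pose TR := measurableTypeR R.
have mO : measurable_fun setT (fun s : TR * TR => (s.1, - s.2) : TR * TR).
  apply: measurable_fun_pair; first exact: measurable_fst.
  by apply: measurable_funN; exact: measurable_snd.
have mo : cmeas setT (fun s : R * R => pullS G1 a G2 b (s.1, - s.2)).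
  exact: (cmeas_comp (pullS_cmeas d1 d2) mO).
have io : Cintegrable (leb2 R) setT (fun s : R * R => pullS G1 a G2 b (s.1, - s.2)).
  apply: (@cintegrable2_off _ (exc a b) (exc a b) _ (fun s => C1 * C2 * (2 * dom2 a b s))) => //.
  - apply: (@rintegrableZ _ _ _ (leb2 R) _ measurableT _ (fun s => 2 * dom2 a b s)).
    apply: (@rintegrableZ _ _ _ (leb2 R) _ measurableT _ (dom2 a b)).
    exact: integrable_dom2.
  - move=> s s1 s2.
    have -> : dom2 a b s = dom2 a b (s.1, - s.2).
      by rewrite /dom2 /wexp /= normrN.
    apply: pullS_bound => //=.
    by move: s2; rewrite !inE !eqr_oppLR opprK orbC.
split=> //; rewrite /Sint.
rewrite (@Cintegral_prod12 _ _ _ TR TR leb leb _ io).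
rewrite (@Cintegral_prod12 _ _ _ TR TR leb leb _ i0).
apply: (@Cintegral_ae_eq _ _ _ leb setT measurableT).
- have [f1 f2] := io; split.
  + have := @measurable_fubini_F _ _ TR TR R leb leb _ f1.
    exact: (measurableT_comp (@fine_measurable R setT measurableT)).
  + have := @measurable_fubini_F _ _ TR TR R leb leb _ f2.
    exact: (measurableT_comp (@fine_measurable R setT measurableT)).
- have [f1 f2] := i0; split.
  + have := @measurable_fubini_F _ _ TR TR R leb leb _ f1.
    exact: (measurableT_comp (@fine_measurable R setT measurableT)).
  + have := @measurable_fubini_F _ _ TR TR R leb leb _ f2.
    exact: (measurableT_comp (@fine_measurable R setT measurableT)).
- have a1 := @ae_integrable1 _ _ TR TR R leb leb _ i0.1.
  have a2 := @ae_integrable1 _ _ TR TR R leb leb _ i0.2.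
  apply: filterS2 a1 a2 => s h1 h2 _.
  exact: (@Cintegral_opp R (fun t => pullS G1 a G2 b (s, t)) (conj h1 h2)).
Qed.

End Total.

(** * The function Phi *)

Section InfiniteProduct.
Context {R : realType}.
Local Notation Re := (@complex.Re R).
Local Notation Im := (@complex.Im R).

Lemma nm1D_exp (w : R[i]) : nm (1 + w) <= expR (nm w).
Proof. by rewrite (le_trans (nmD _ _)) // nm1 expR_ge1Dx. Qed.

(** Write 1 / (1 - w) as 1 + w / (1 - w) and apply the bound for factors 1 + w. *)
Lemma nm_inv1B_exp (w : R[i]) (d : R) : 0 < d -> d <= nm (1 - w) ->
  nm (1 - w)^-1 <= expR (nm w / d).
Proof.
move=> d0 dw; have n0 : 0 < nm (1 - w) by exact: lt_le_trans dw.
have w0 : 1 - w != 0 by rewrite -nm_gt0.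
have -> : (1 - w)^-1 = 1 + w / (1 - w).
  by apply: (mulIf w0); rewrite mulVf // mulrDl divfK // mul1r subrK.
rewrite (le_trans (nm1D_exp _)) // ler_expR nmM nmV ler_wpM2l ?nm_ge0 //.
by rewrite lef_pV2 ?posrE.
Qed.

Variables (x : nat -> R) (S : R).
Hypotheses (x0 : forall i, 0 <= x i) (xS : forall n, \sum_(i < n) x i <= S).

Lemma cvg_summable : cvgn (series x).
Proof.
apply: nondecreasing_is_cvgn.
  apply/nondecreasing_seqP => n; rewrite /series /= big_nat_recr //= lerDl.
  exact: x0.
by exists S => _ [n _ <-]; rewrite /series /= big_mkord; exact: xS.
Qed.

Lemma nm_prod_exp (f : nat -> R[i]) (K : R) n :
  (forall i, nm (f i) <= expR (K * x i)) -> 0 <= K ->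
  nm (\prod_(i < n) f i) <= expR (K * S).
Proof.
move=> fK K0; apply: (@le_trans _ _ (expR (K * \sum_(i < n) x i))); last first.
  by rewrite ler_expR ler_wpM2l.
elim: n => [|n ih]; first by rewrite !big_ord0 nm1 mulr0 expR0.
rewrite !big_ord_recr /= mulrDr expRD nmM; apply: ler_pM; rewrite ?nm_ge0 //.
Qed.

(** The increments of the partial products [P] are [P n * w n]; as [P] is bounded, they form an
    absolutely convergent series. *)
Lemma prod_ccvg (w : nat -> R[i]) (K : R) : (forall i, nm (w i) <= K * x i) ->
  exists l, ccvg (fun n => \prod_(i < n) (1 + w i)) l.
Proof.
move=> wK.
have [K0|K0] := leP 0 K; last first.
  exists 1; have w0 i : w i = 0.
    apply/eqP; rewrite -nm_eq0 eq_le nm_ge0 andbT (le_trans (wK i)) //.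
    by rewrite mulr_le0_ge0 // ltW.
  by under eq_fun do under eq_bigr do rewrite w0 addr0;
    under eq_fun do rewrite big1 //; exact: ccvg_cst.
pose P n := \prod_(i < n) (1 + w i).
have Pb n : nm (P n) <= expR (K * S).
  apply: (@nm_prod_exp (fun i => 1 + w i) K n) => // i; apply: (le_trans (nm1D_exp _)).
  by rewrite ler_expR.
have Pw n : nm (P n * w n) <= expR (K * S) * K * x n.
  by rewrite nmM -mulrA ler_pM ?nm_ge0.
have cs (phi : R[i] -> R) : (forall z, `|phi z| <= nm z) ->
    cvgn (series (fun n => phi (P n * w n))).
  move=> hphi; apply: normed_cvg.
  apply: (@series_le_cvg _ _ (fun n => expR (K * S) * K * x n)).
  - by move=> n; exact: normr_ge0.
  - by move=> n; rewrite !mulr_ge0 ?expR_ge0.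
  - by move=> n; exact: le_trans (hphi _) (Pw n).
  - have -> : (fun n => expR (K * S) * K * x n) = (expR (K * S) * K) *: x by apply/funext => n.
    exact: is_cvg_seriesZ cvg_summable.
have PS n : P n = 1 + \sum_(i < n) P i * w i.
  elim: n => [|n ih]; first by rewrite /P !big_ord0 addr0.
  by rewrite big_ord_recr /= addrA -ih /P big_ord_recr /= mulrDr mulr1.
have RS n : Re (\sum_(i < n) P i * w i) = series (fun n => Re (P n * w n)) n.
  rewrite /series /= big_mkord; elim: n => [|n ih]; first by rewrite !big_ord0.
  by rewrite !big_ord_recr /= cReD ih.
have IS n : Im (\sum_(i < n) P i * w i) = series (fun n => Im (P n * w n)) n.
  rewrite /series /= big_mkord; elim: n => [|n ih]; first by rewrite !big_ord0.
  by rewrite !big_ord_recr /= cImD ih.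
exists ((1 + limn (series (fun n => Re (P n * w n)))) +i* limn (series (fun n => Im (P n * w n)))).
split => /=.
- under eq_fun do rewrite -/(P _) PS cReD RS.
  by apply: cvgD; [exact: cvg_cst|exact: cs _ (@nm_Re R)].
- under eq_fun do rewrite -/(P _) PS cImD IS /= add0r.
  exact: cs _ (@nm_Im R).
Qed.

(** The factor equals 1 + x / (1/v - x), and for real x the modulus of 1/v - x is at least |Im
    (1/v)|, uniformly in x. *)
Lemma prod_inv_ccvg (v : R[i]) : Im v != 0 ->
  exists l, ccvg (fun n => \prod_(i < n) (1 - (x i)%:C * v)^-1) l.
Proof.
move=> v0; have vn0 : v != 0 by apply: contraNneq v0 => ->.
have iv : Im v^-1 != 0.
  by rewrite cImV mulf_neq0 ?oppr_eq0 // invr_neq0 // neq0_sqr.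
have h i : `|Im v^-1| <= nm (v^-1 - (x i)%:C).
  by apply: le_trans (nm_Im _); rewrite cImD cImN /= subr0.
have n0 i : v^-1 - (x i)%:C != 0.
  by rewrite -nm_gt0 (lt_le_trans _ (h i)) // normr_gt0.
have E i : (1 - (x i)%:C * v)^-1 = 1 + (x i)%:C / (v^-1 - (x i)%:C).
  have -> : 1 - (x i)%:C * v = (v^-1 - (x i)%:C) * v by rewrite mulrBl mulVf.
  have vv : v^-1 != 0 by rewrite invr_neq0.
  apply: (mulIf (mulf_neq0 (n0 i) vn0)); rewrite mulVf ?mulf_neq0 // mulrDl mul1r.
  by rewrite mulrA divfK // mulrBl mulVf // subrK.
have -> : (fun n => \prod_(i < n) (1 - (x i)%:C * v)^-1) =
    (fun n => \prod_(i < n) (1 + (x i)%:C / (v^-1 - (x i)%:C))).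
  by apply/funext => n; apply: eq_bigr => i _; exact: E.
apply: (@prod_ccvg (fun i => (x i)%:C / (v^-1 - (x i)%:C)) `|Im v^-1|^-1) => i.
rewrite nmM nmV nm_real ger0_norm // mulrC ler_wpM2r // lef_pV2 ?posrE ?normr_gt0//.
by rewrite nm_gt0.
Qed.

End InfiniteProduct.

Section ComplexTopology.
Context {R : realType}.
Local Notation Re := (@complex.Re R).
Local Notation Im := (@complex.Im R).

Lemma cvg_complex (T : Type) (F : set_system T) (FF : Filter F) (f : T -> R[i]) (l : R[i]) :
  (fun x => Re (f x)) @ F --> Re l -> (fun x => Im (f x)) @ F --> Im l ->
  (f : T -> R[i]^o) @ F --> (l : R[i]^o).
Proof.
move=> cR cI; apply/cvgrPdist_lt => e e0.
have [e1 e2] : Im e = 0 /\ 0 < Re e.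
  by move: e0; rewrite ltcE /= => /andP[/eqP -> ->].
have h : 0 < Re e / 2 by rewrite divr_gt0.
near=> x.
have -> : e = (Re e)%:C by apply: complex_eq.
rewrite normc_def ltcR -/(nm (l - f x)) -nmE.
have h1 : `|Re l - Re (f x)| < Re e / 2 by near: x; exact: cvgr_dist_lt.
have h2 : `|Im l - Im (f x)| < Re e / 2 by near: x; exact: cvgr_dist_lt.
rewrite (le_lt_trans (nm_le _)) // cReD cReN cImD cImN; lra.
Unshelve. all: by end_near. Qed.

Lemma ccvg_lim (f : nat -> R[i]) l : ccvg f l -> limn (f : nat -> R[i]^o) = l.
Proof.
move=> [f1 f2]; apply: cvg_lim; first exact: norm_hausdorff.
exact: cvg_complex.
Qed.

End ComplexTopology.

(** * Uniform bounds on the partial products *)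

Section PhiBounds.
Context {R : realType}.
Local Notation kap := (@kap R).
Implicit Types (q : params R).

(* z |-> -z exchanges Phi with 1 / Phi for the swapped parameters. *)
Definition swap q : params R := Params (bp q) (bm q) (ap q) (am q) (cp q) (cm q).

Lemma admissible_swap q : admissible q -> admissible (swap q).
Proof.
move=> [h1 h2 h3 h4 h5]; split=> //=.
- by move=> i; have [? ? ? ?] := h1 i.
- rewrite (eq_eseriesr (g := fun i => (ap q i + am q i + bp q i + bm q i)%:E)) // => i _.
  by congr (_%:E); ring.
- by move=> i; have [? ? ? ?] := h3 i.
Qed.

Definition xsum q i := ap q i + am q i + bp q i + bm q i.

Lemma xsum_ge0 q i : admissible q -> 0 <= xsum q i.
Proof. by move=> [h1 _ _ _ _]; have [? ? ? ?] := h1 i; rewrite /xsum !addr_ge0. Qed.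

Lemma xsum_bounded q : admissible q -> exists S, forall n, \sum_(i < n) xsum q i <= S.
Proof.
move=> hq; have [h1 h2 _ _ _] := hq.
have ge0 i : (0 <= (xsum q i)%:E)%E by rewrite lee_fin xsum_ge0.
exists (fine (\sum_(0 <= i <oo) (xsum q i)%:E)%E) => n.
rewrite -lee_fin fineK; last first.
  by rewrite ge0_fin_numE //; exact: nneseries_ge0.
rewrite -sumEFin -(big_mkord xpredT (fun i => (xsum q i)%:E)).
exact: (@nneseries_lim_ge _ _ xpredT 0).
Qed.

Definition fac q i (z : R[i]) : R[i] :=
  (1 + (bp q i)%:C * z) * (1 + (bm q i)%:C / z) /
    ((1 - (ap q i)%:C * z) * (1 - (am q i)%:C / z)).

Definition Phin q n (z : R[i]) : R[i] :=
  cexp ((cp q)%:C * z + (cm q)%:C / z) * \prod_(i < n) fac q i z.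

(** The case in which [Phi] is regular at 0, so that the vertex may be nonnegative. *)
Definition nominus q := [/\ forall i, am q i = 0, forall i, bm q i = 0 & cm q = 0].

(* The vertices [a] for which [Phi q] has no pole on or to the left of [Gm a]. *)
Definition aok q (a : R) : Prop := (a < 0 \/ nominus q) /\ ap q 0%N * a < 1.

Lemma aok_le q a a' : admissible q -> a' <= a -> aok q a -> aok q a'.
Proof.
move=> [h1 _ _ _ _] aa' [h2 h3]; split.
  by case: h2 => [a0|]; [left; exact: le_lt_trans a0|right].
have [ap0 _ _ _] := h1 0%N.
by apply: le_lt_trans h3; rewrite ler_wpM2l.
Qed.

Lemma nonincr_0 (f : nat -> R) : (forall i, 0 <= f i) -> (forall i, f i.+1 <= f i) ->
  f 0%N = 0 -> forall i, f i = 0.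
Proof.
move=> f0 fS e; elim=> [//|i ih].
by apply/eqP; rewrite eq_le f0 andbT -ih.
Qed.

Lemma nominusP q : admissible q -> ~~ (0 < am q 0%N + bm q 0%N + cm q) -> nominus q.
Proof.
move=> [h1 _ h3 _ h5]; rewrite -leNgt => h.
have [p1 p2 p3 p4] := h1 0%N.
split; last by lra.
- by apply: nonincr_0 => [i|i|]; [have [] := h1 i|have [] := h3 i|lra].
- by apply: nonincr_0 => [i|i|]; [have [] := h1 i|have [] := h3 i|lra].
Qed.

Lemma a_low_ok q a : admissible q -> (a%:E < a_low q)%E -> aok q a.
Proof.
move=> hq; have [h1 _ _ _ _] := hq; have [p1 _ _ _] := h1 0%N.
rewrite /a_low; case: ifPn => [_|nm]; first rewrite lte_fin => a0.
  by split; [left|rewrite (le_lt_trans _ ltr01) // mulr_ge0_le0 // ltW].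
have nm' := nominusP hq nm.
case: eqP => [e _|/eqP ne]; first by split; [right|rewrite e mul0r].
rewrite lte_fin => h; split; first by right.
have p0 : 0 < ap q 0%N by rewrite lt_neqAle eq_sym ne.
by rewrite mulrC -ltr_pdivlMr // mul1r.
Qed.

Lemma b_low_ok q b : admissible q -> (b_low q < b%:E)%E -> aok (swap q) (- b).
Proof.
move=> hq h; apply: a_low_ok; first exact: admissible_swap.
move: h; rewrite /b_low /a_low /= (addrC (bm q 0%N)).
case: ifP => _; first by rewrite !lte_fin oppr_lt0.
case: ifP => _ //; first by rewrite ltry.
by rewrite !lte_fin ltrNl.
Qed.

Lemma nm_Gm_ge (u s : R) : `|u| / 2 <= nm (Gm u s).
Proof.
have h : (`|u| / 2) ^+ 2 <= nm (Gm u s) ^+ 2.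
  rewrite nm_sqr /= exprMn real_normK ?num_real //.
  have -> : (kap * s) ^+ 2 = (kap * `|s|) ^+ 2.
    by rewrite !exprMn real_normK ?num_real.
  set y := kap * `|s|.
  have := sqr_ge0 (u + 2 * y); have := sqr_ge0 u; lra.
by rewrite -(@ler_pXn2r _ 2) // nnegrE ?nm_ge0 // divr_ge0.
Qed.

Lemma nm_Gm_le (u s : R) : nm (Gm u s) <= `|u| + 2 * `|s|.
Proof.
have k0 := @kap_gt0 R; have k1 := @kap_lt1 R.
rewrite (le_trans (nm_le _)) //= (le_trans (lerD (ler_normD _ _) (lexx _))) //.
rewrite !normrM normr_id (gtr0_norm k0) -addrA lerD2l.
have := normr_ge0 s; nra.
Qed.

Section Bounds.
Variables (q : params R) (hq : admissible q) (a : R) (ha : aok q a).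

(** A lower bound for [1 - ap q i * u], uniform in [i] and [u <= a]: this quantity is at least 1 for
    [u <= 0], and at least [1 - ap q 0 * a] for [u > 0]. *)
Let d0 : R := Num.min 1 (1 - ap q 0%N * a).

Let d0_gt0 : 0 < d0.
Proof. by rewrite lt_min ltr01 subr_gt0 ha.2. Qed.

Let ap_bound i u : u <= a -> d0 <= 1 - ap q i * u.
Proof.
move=> ua; have [h1 _ h3 _ _] := hq; have [pj0 _ _ _] := h1 i; have [p0 _ _ _] := h1 0%N.
have pj1 : ap q i <= ap q 0%N.
  clear pj0; elim: i => // i ih; have [s _ _ _] := h3 i; exact: le_trans s ih.
rewrite /d0 ge_min; have [u0|u0] := leP u 0.
  by apply/orP; left; rewrite lerBrDr gerDl mulr_ge0_le0.
apply/orP; right; rewrite lerD2l lerN2.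
by apply: ler_pM => //; exact: ltW.
Qed.

(** Up to sign the denominator is again a point of a wedge, with vertex [ap q i * u - 1], so the
    distance from 0 to a wedge bounds it below. *)
Lemma den_bound i u s : u <= a -> d0 / 2 <= nm (1 - (ap q i)%:C * Gm u s).
Proof.
move=> ua; have b := ap_bound i ua.
have -> : 1 - (ap q i)%:C * Gm u s = - Gm (ap q i * u - 1) (ap q i * s).
  have [h1 _ _ _ _] := hq; have [pj0 _ _ _] := h1 i.
  by apply: complex_eq => /=; rewrite ?normrM ?(ger0_norm pj0); ring.
rewrite nmN; apply: le_trans (nm_Gm_ge _ _); rewrite ler_wpM2r // -normrN opprB.
exact: le_trans b (ler_norm _).
Qed.

Lemma den_neq0 i u s : u <= a -> 1 - (ap q i)%:C * Gm u s != 0.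
Proof.
by move=> ua; rewrite -nm_gt0 (lt_le_trans _ (den_bound i s ua)) // divr_gt0.
Qed.

Lemma nm_Gm_lt0 u s : a < 0 -> u <= a -> `|a| / 2 <= nm (Gm u s).
Proof.
move=> a0 ua; apply: le_trans (nm_Gm_ge u s); rewrite ler_wpM2r //.
by rewrite !ltr0_norm ?lerN2 // (le_lt_trans ua).
Qed.

Lemma Gm_neq0 u s : a < 0 -> u <= a -> Gm u s != 0.
Proof.
move=> a0 ua; rewrite -nm_gt0 (lt_le_trans _ (nm_Gm_lt0 s a0 ua)) //.
by rewrite divr_gt0 // normr_gt0 lt_eqF.
Qed.

(** Subtracting [am q i] moves the vertex further left, to a wedge that still avoids 0. *)
Lemma den2E i u s : a < 0 -> u <= a ->
  1 - (am q i)%:C / Gm u s = Gm (u - am q i) s / Gm u s.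
Proof.
move=> a0 ua; have g0 := Gm_neq0 s a0 ua.
apply: (mulIf g0); rewrite mulrBl !divfK // mul1r.
by apply: complex_eq => /=; ring.
Qed.

Lemma den2_neq0 i u s : u <= a -> 1 - (am q i)%:C / Gm u s != 0.
Proof.
move=> ua; have [h1 _ _ _ _] := hq; have [_ m0 _ _] := h1 i.
case: ha.1 => [a0|[e _ _]]; last by rewrite e mul0r subr0 oner_eq0.
rewrite den2E // mulf_neq0 ?invr_neq0 ?Gm_neq0 //.
by rewrite lerBlDr (le_trans ua) // lerDl.
Qed.

(** The [i]-th factor is at most [expR (K * t * xsum q i)] with [t = 1 + |s|], and [xsum q] is
    summable. The growth is thus linear in the exponent, uniformly in [n], against the cubic decay
    of [gexp]. *)
Lemma Phin_bound A : exists2 C, 0 <= C & forall n u s, A <= u <= a ->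
  nm (Phin q n (Gm u s)) <= expR (C * (1 + `|s|)).
Proof.
have [h1 _ _ c0 c0'] := hq.
have [S hS] := xsum_bounded hq.
have S0 : 0 <= S by have := hS 0%N; rewrite big_ord0.
(* [M * t] bounds the modulus of [Gm u s], and [K'] that of its inverse when [a < 0]; in the other
   case the terms in 1/z vanish. *)
pose M := 2 + `|A| + `|a|; pose K' := 2 / `|a|.
have M0 : 0 <= M by rewrite /M !addr_ge0.
have K'0 : 0 <= K' by rewrite /K' divr_ge0.
pose K := M * (1 + 2 / d0) + 2 * K'.
have d2 : 0 <= 2 / d0 by rewrite divr_ge0 // ltW.
have K0 : 0 <= K.
  by rewrite /K addr_ge0 // mulr_ge0 // addr_ge0.
exists (cp q * M + cm q * K' + K * S).
  by rewrite !addr_ge0 // ?mulr_ge0.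
move=> n u s /andP[Au ua].
pose t := 1 + `|s|; have t1 : 1 <= t by rewrite lerDl.
have t0 : 0 <= t by exact: le_trans t1.
have nz : nm (Gm u s) <= M * t.
  apply: (le_trans (nm_Gm_le u s)).
  have hu : `|u| <= `|A| + `|a|.
    rewrite ler_norml; apply/andP; split.
      have := ler_norm (- A); rewrite normrN; have := normr_ge0 a; lra.
    have := ler_norm a; have := normr_ge0 A; lra.
  have := normr_ge0 A; have := normr_ge0 a; have := normr_ge0 s.
  rewrite /M /t => ? ? ?; nra.
have nzV : a < 0 -> nm (Gm u s)^-1 <= K'.
  move=> a0; rewrite nmV /K' -[2 / _]invf_div lef_pV2 ?posrE; first exact: nm_Gm_lt0.
    by rewrite nm_gt0 Gm_neq0.
  by rewrite divr_gt0 // normr_gt0 lt_eqF.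
have minus (x : R) (m : nominus q -> x = 0) : 0 <= x -> nm (x%:C / Gm u s) <= x * K'.
  move=> x0; case: ha.1 => [a0|/m ->]; last by rewrite !mul0r nm0.
  by rewrite nmM nm_real ger0_norm // ler_wpM2l // nzV.
rewrite /Phin nmM -/t mulrDl expRD; apply: ler_pM; rewrite ?nm_ge0 //.
  rewrite nm_cexp ler_expR cReD mulrDl lerD //.
  - apply: le_trans (ler_norm _) _; apply: le_trans (nm_Re _) _.
    by rewrite nmM nm_real ger0_norm // -mulrA ler_wpM2l.
  - apply: le_trans (ler_norm _) _; apply: le_trans (nm_Re _) _.
    apply: le_trans (minus _ _ c0') _; first by case.
    by rewrite ler_peMr // mulr_ge0.
rewrite (_ : K * S * t = (K * t) * S); last by ring.
apply: (@nm_prod_exp R (xsum q) S hS (fun i => fac q i (Gm u s)) (K * t) n); last by rewrite mulr_ge0.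
move=> i; have [a0 a0' b0 b0'] := h1 i.
have xa : ap q i + am q i + bp q i + bm q i = xsum q i by [].
have f1 : nm (1 + (bp q i)%:C * Gm u s) <= expR (bp q i * (M * t)).
  by rewrite (le_trans (nm1D_exp _)) // ler_expR nmM nm_real ger0_norm // ler_wpM2l.
have f2 : nm (1 + (bm q i)%:C / Gm u s) <= expR (bm q i * K').
  by rewrite (le_trans (nm1D_exp _)) // ler_expR minus // => -[].
have f3 : nm (1 - (ap q i)%:C * Gm u s)^-1 <= expR (ap q i * (M * t) * (2 / d0)).
  have d20 : 0 < d0 / 2 by rewrite divr_gt0.
  rewrite (le_trans (nm_inv1B_exp d20 (den_bound i s ua))) // ler_expR invf_div ler_wpM2r //.
  by rewrite nmM nm_real ger0_norm // ler_wpM2l.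
have f4 : nm (1 - (am q i)%:C / Gm u s)^-1 <= expR (am q i * (2 * K')).
  case: ha.1 => [al0|[e _ _]]; last by rewrite e !mul0r subr0 invr1 nm1 expR0.
  have g0 := Gm_neq0 s al0 ua.
  have ua' : u - am q i <= a by rewrite lerBlDr (le_trans ua) // lerDl.
  have g1 := Gm_neq0 s al0 ua'.
  have -> : (1 - (am q i)%:C / Gm u s)^-1 = 1 + (am q i)%:C / Gm (u - am q i) s.
    rewrite den2E // invf_div; apply: (mulIf g1); rewrite divfK // mulrDl divfK // mul1r.
    by apply: complex_eq => /=; ring.
  rewrite (le_trans (nm1D_exp _)) // ler_expR nmM nm_real ger0_norm // ler_wpM2l //.
  rewrite nmV (@le_trans _ _ K') //; last by rewrite ler_peMl //; lra.
  rewrite /K' -[2 / _]invf_div lef_pV2 ?posrE; first exact: nm_Gm_lt0.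
    by rewrite nm_gt0.
  by rewrite divr_gt0 // normr_gt0 lt_eqF.
rewrite /fac invfM !nmM.
apply: (@le_trans _ _ (expR (bp q i * (M * t)) * expR (bm q i * K') *
   (expR (ap q i * (M * t) * (2 / d0)) * expR (am q i * (2 * K'))))).
  by apply: ler_pM; rewrite ?mulr_ge0 ?nm_ge0 //; apply: ler_pM; rewrite ?nm_ge0.
rewrite -!expRD ler_expR -xa /K.
set D := 2 / d0 in d2 *.
have Mt : 0 <= M * t by rewrite mulr_ge0.
have MtD : 0 <= M * t * D by rewrite mulr_ge0.
have Kt : K' <= K' * t by rewrite ler_peMr.
have g (x y w : R) : 0 <= x -> y <= w -> x * y <= x * w by move=> ? ?; rewrite ler_wpM2l.
have -> : (M * (1 + D) + 2 * K') * t * (ap q i + am q i + bp q i + bm q i) =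
  ap q i * (M * t + M * t * D + 2 * (K' * t)) + am q i * (M * t + M * t * D + 2 * (K' * t))
  + bp q i * (M * t + M * t * D + 2 * (K' * t)) + bm q i * (M * t + M * t * D + 2 * (K' * t)) by ring.
have l1 : bp q i * (M * t) <= bp q i * (M * t + M * t * D + 2 * (K' * t)) by apply: g => //; lra.
have l2 : bm q i * K' <= bm q i * (M * t + M * t * D + 2 * (K' * t)) by apply: g => //; lra.
have l3 : ap q i * (M * t) * D <= ap q i * (M * t + M * t * D + 2 * (K' * t)).
  by rewrite -mulrA; apply: g => //; lra.
have l4 : am q i * (2 * K') <= am q i * (M * t + M * t * D + 2 * (K' * t)) by apply: g => //; lra.
lra.
Qed.

End Bounds.

End PhiBounds.

(** * Holomorphy, convergence and decay of the factors *)

Section PhiAnalysis.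
Context {R : realType}.
Local Notation Re := (@complex.Re R).
Local Notation Im := (@complex.Im R).
Local Notation kap := (@kap R).
Implicit Types (q : params R).

Lemma hol_lin D (c : R[i]) : hol D (fun z => c * z).
Proof. by apply: holM; [exact: hol_cst|exact: hol_id]. Qed.

Lemma hol_Phin q a A n : admissible q -> aok q a -> hol (strip A a) (Phin q n).
Proof.
move=> hq ha; have d1 i z : strip A a z -> 1 - (ap q i)%:C * z != 0.
  by move=> [u [s [/andP[_ ua] ->]]]; exact: (den_neq0 hq ha).
have hol1 D i : hol D (fun z => 1 + (bp q i)%:C * z).
  by apply: holD; [exact: hol_cst|exact: hol_lin].
have hol2 D i : hol D (fun z => 1 - (ap q i)%:C * z).
  by apply: holB; [exact: hol_cst|exact: hol_lin].
(* In the second case the strip may contain 0, but the factors in 1/z are identically 1 and are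
   removed before differentiating. *)
case: ha.1 => [a0|[m1 m2 m3]]; last first.
  have -> : Phin q n = fun z => cexp ((cp q)%:C * z) *
      \prod_(i < n) ((1 + (bp q i)%:C * z) * (1 - (ap q i)%:C * z)^-1).
    apply/funext => z; rewrite /Phin m3 mul0r addr0; congr (_ * _).
    apply: eq_bigr => i _; rewrite /fac m1 m2 !mul0r addr0 subr0 !mulr1 //.
  apply: holM; first by apply: hol_cexp; exact: hol_lin.
  apply: (@hol_prod _ _ (fun i z => (1 + (bp q i)%:C * z) * (1 - (ap q i)%:C * z)^-1)) => i.
  by apply: holM => //; apply: holV => // z; exact: d1.
have z0 z : strip A a z -> z != 0.
  by move=> [u [s [/andP[_ ua] ->]]]; exact: (Gm_neq0 s a0 ua).
have d2 i z : strip A a z -> 1 - (am q i)%:C / z != 0.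
  by move=> [u [s [/andP[_ ua] ->]]]; exact: (den2_neq0 hq ha).
have hV : hol (strip A a) (fun z => z^-1) by apply: holV => //; exact: hol_id.
have hVl (c : R[i]) : hol (strip A a) (fun z => c / z).
  by apply: holM => //; exact: hol_cst.
apply: holM; first by apply: hol_cexp; apply: holD => //; exact: hol_lin.
apply: (@hol_prod _ _ (fun i z => fac q i z)) => i.
apply: holM.
  by apply: holM => //; apply: holD => //; exact: hol_cst.
apply: holV; first by move=> z Dz; rewrite mulf_neq0 ?d1 ?d2.
by apply: holM => //; apply: holB => //; exact: hol_cst.
Qed.

Lemma Phin_swap q n z :
  (forall i, 1 - (ap q i)%:C * z != 0) -> (forall i, 1 - (am q i)%:C / z != 0) ->
  (forall i, 1 + (bp q i)%:C * z != 0) -> (forall i, 1 + (bm q i)%:C / z != 0) ->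
  Phin q n z * Phin (swap q) n (- z) = 1.
Proof.
move=> h1 h2 h3 h4; rewrite /Phin mulrACA -cexpD.
have -> : (cp q)%:C * z + (cm q)%:C / z + ((cp (swap q))%:C * - z + (cm (swap q))%:C / - z) = 0.
  by rewrite /= invrN !mulrN -opprD subrr.
rewrite cexp0 mul1r -big_split big1 //= => i _.
rewrite /fac /= !invrN !mulrN !opprK.
have := h1 i; have := h2 i; have := h3 i; have := h4 i.
set x1 := 1 + _; set x2 := 1 + _; set x3 := 1 - _; set x4 := 1 - _ => n1 n2 n3 n4.
by field; rewrite n1 n2 n3 n4.
Qed.

Lemma nonreal_neq0 (x : R) (z : R[i]) : Im z != 0 -> 1 + x%:C * z != 0.
Proof.
move=> z0; have [->|x0] := eqVneq x 0; first by rewrite mul0r addr0 oner_eq0.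
by rewrite eq_complex negb_and cImD cImM /= add0r mul0r addr0 mulf_neq0 ?orbT.
Qed.

Lemma Im_inv (z : R[i]) : Im z != 0 -> Im z^-1 != 0.
Proof.
move=> z0; rewrite cImV mulf_neq0 ?oppr_eq0 // invr_neq0 // neq0_sqr //.
by apply: contraNneq z0 => ->.
Qed.

Lemma nonrealB_neq0 (x : R) (z : R[i]) : Im z != 0 -> 1 - x%:C * z != 0.
Proof.
move=> z0; have -> : 1 - x%:C * z = 1 + (- x)%:C * z by rewrite rmorphN mulNr.
exact: nonreal_neq0.
Qed.

(** Off the real axis no factor has a zero or a pole, whatever the parameters, and the four products
    converge separately. *)
Lemma Phin_cvg q z : admissible q -> Im z != 0 -> ccvg (fun n => Phin q n z) (Phi q z).
Proof.
move=> hq z0; have iz := Im_inv z0; have [S hS] := xsum_bounded hq.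
have [h1 _ _ _ _] := hq.
have x0 i := @xsum_ge0 R q i hq.
have bnd (y : nat -> R) : (forall i, 0 <= y i) -> (forall i, y i <= xsum q i) ->
    forall n, \sum_(i < n) y i <= S.
  by move=> _ h n; apply: le_trans (hS n); apply: ler_sum.
have lin (y : nat -> R) v : (forall i, 0 <= y i) -> (forall i, y i <= xsum q i) ->
    exists l, ccvg (fun n => \prod_(i < n) (1 + (y i)%:C * v)) l.
  move=> y0 ly; apply: (@prod_ccvg R y S y0 (bnd _ y0 ly) (fun i => (y i)%:C * v) (nm v)) => i.
  by rewrite nmM nm_real ger0_norm // mulrC.
have pl i : [/\ ap q i <= xsum q i, am q i <= xsum q i, bp q i <= xsum q i & bm q i <= xsum q i].
  have [? ? ? ?] := h1 i; rewrite /xsum; split; lra.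
have [l1 c1] := lin (bp q) z (fun i => let: And4 _ _ h _ := h1 i in h) (fun i => let: And4 _ _ h _ := pl i in h).
have [l2 c2] := lin (bm q) z^-1 (fun i => let: And4 _ _ _ h := h1 i in h) (fun i => let: And4 _ _ _ h := pl i in h).
have a0 i : 0 <= ap q i by have [] := h1 i.
have m0 i : 0 <= am q i by have [] := h1 i.
have la i : ap q i <= xsum q i by have [] := pl i.
have lm i : am q i <= xsum q i by have [] := pl i.
have [l3 c3] := @prod_inv_ccvg R (ap q) S a0 (bnd _ a0 la) z z0.
have [l4 c4] := @prod_inv_ccvg R (am q) S m0 (bnd _ m0 lm) z^-1 iz.
have c := ccvgM (ccvgM c1 c2) (ccvgM c3 c4).
have E n : \prod_(i < n) fac q i z =
  \prod_(i < n) (1 + (bp q i)%:C * z) * \prod_(i < n) (1 + (bm q i)%:C / z) *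
  (\prod_(i < n) (1 - (ap q i)%:C * z)^-1 * \prod_(i < n) (1 - (am q i)%:C / z)^-1).
  rewrite -!big_split /=; apply: eq_bigr => i _.
  by rewrite /fac invfM.
have c' : ccvg (fun n => \prod_(i < n) fac q i z) (l1 * l2 * (l3 * l4)).
  by rewrite (funext E).
have PE : Phi q z = cexp ((cp q)%:C * z + (cm q)%:C / z) * (l1 * l2 * (l3 * l4)).
  by rewrite /Phi -(ccvg_lim c').
by rewrite PE; exact: ccvgZ.
Qed.

Lemma Phi_swap q z : admissible q -> Im z != 0 -> Phi q z * Phi (swap q) (- z) = 1.
Proof.
move=> hq z0; have iz := Im_inv z0.
have z0' : Im (- z) != 0 by rewrite cImN oppr_eq0.
have c := ccvgM (Phin_cvg hq z0) (Phin_cvg (admissible_swap hq) z0').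
apply: (ccvg_unique c).
have -> : (fun n => Phin q n z * Phin (swap q) n (- z)) = (fun=> 1).
  apply/funext => n; apply: Phin_swap.
  - by move=> i; exact: nonrealB_neq0.
  - by move=> i; exact: nonrealB_neq0.
  - by move=> i; exact: nonreal_neq0.
  - by move=> i; exact: nonreal_neq0.
exact: ccvg_cst.
Qed.

(** The exponential in the shifted variable Z = z + t, at which [Phi] is evaluated. *)
Definition gexp (t x : R) (Z : R[i]) : R[i] :=
  cexp ((Z - t%:C) ^+ 3 / 3 - x%:C * (Z - t%:C)).

Definition Gn q t x n Z := gexp t x Z * Phin q n Z.
Definition Gi q t x Z := gexp t x Z * Phi q Z.

Lemma hol_gexp D t x : hol D (gexp t x).
Proof.
have h : hol D (fun Z => Z - t%:C) by apply: holB; [exact: hol_id|exact: hol_cst].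
apply: hol_cexp; apply: holB; last by apply: holM => //; exact: hol_cst.
by apply: holM; [exact: holX|exact: hol_cst].
Qed.

(** Along directions at angle pi/4 to the real axis, the real part of the cube has leading term -kap
    |s|^3 and no quadratic term: the source of all decay. *)
Lemma Re_gexp t x u s :
  Re ((Gm u s - t%:C) ^+ 3 / 3 - x%:C * (Gm u s - t%:C)) =
  ((u - t) ^+ 3 + 3 * (u - t) ^+ 2 * kap * `|s| - kap * `|s| ^+ 3) / 3 - x * (u - t + kap * `|s|).
Proof.
have k2 := @kap2 R.
have s2 : s ^+ 2 = `|s| ^+ 2 by rewrite real_normK ?num_real.
have -> : Gm u s - t%:C = (u - t + kap * `|s|) +i* (kap * s).
  by apply: complex_eq => /=; ring.
have -> : (3 : R[i])^-1 = (3^-1)%:C by rewrite natC fmorphV.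
set v := u - t; set r := `|s| in s2 *.
have cube (A B : R) : Re ((A +i* B) ^+ 3) = A ^+ 3 - 3 * A * B ^+ 2.
  by rewrite !exprS expr0 mulr1 /=; ring.
rewrite cReD cReN [Re (_ * (3^-1)%:C)]cReM [Re (x%:C * _)]cReM cube /= !mulr0 mul0r !subr0 exprMn s2.
have -> : kap * r ^+ 3 = (2 * kap ^+ 2) * kap * r ^+ 3 by rewrite k2 mul1r.
by field.
Qed.

(** From r^3 - 3 m^2 r + 2 m^3 = (r - m)^2 (r + 2 m) >= 0, with [m = 1 + L] chosen so that
    [2 * L <= m ^+ 2]. *)
Lemma cubic_bound (L : R) : 0 <= L -> exists c, forall r, 0 <= r -> L * r - r ^+ 3 / 6 <= c.
Proof.
move=> L0; pose m := 1 + L; exists (m ^+ 3 / 3) => r r0.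
have m0 : 0 <= m by rewrite /m; lra.
have h1 : 0 <= (r - m) ^+ 2 * (r + 2 * m) by rewrite mulr_ge0 ?sqr_ge0 // addr_ge0 // mulr_ge0.
have h2 : 2 * L <= m ^+ 2 by rewrite /m; have := sqr_ge0 L; lra.
have h3 : 2 * L * r <= m ^+ 2 * r by rewrite ler_wpM2r.
have -> : m ^+ 3 / 3 = (m ^+ 2 * r / 2 - r ^+ 3 / 6) + (r - m) ^+ 2 * (r + 2 * m) / 6 by field.
lra.
Qed.

(** The cubic term beats every linear one, so the rate [k] is free; [decay_Gi_exp] takes it
    large. *)
Lemma Gn_decay q a A t x k : admissible q -> aok q a -> 0 <= k ->
  exists2 C, 0 <= C & forall n u s, A <= u <= a ->
    nm (Gn q t x n (Gm u s)) <= C * expR (- (k * `|s|)).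
Proof.
move=> hq ha k0; have [C C0 hC] := Phin_bound hq ha A.
have kp0 := @kap_gt0 R; have kp1 := @kap_lt1 R; have kp2 := @kap_gt12 R.
pose V := `|A| + `|a| + `|t|.
have V0 : 0 <= V by rewrite !addr_ge0.
(* The coefficients of [|s|]: [V ^+ 2] and [|x|] from the exponent of [gexp], [C] from [Phin_bound],
   [k] for the desired rate. *)
have L0 : 0 <= V ^+ 2 + `|x| + C + k by rewrite !addr_ge0 // sqr_ge0.
have [c hc] := cubic_bound L0.
exists (expR (V ^+ 3 + `|x| * V + C + c)); first exact: expR_ge0.
move=> n u s uI; rewrite /Gn nmM /gexp nm_cexp Re_gexp -expRD.
apply: (@le_trans _ _ (expR (((u - t) ^+ 3 + 3 * (u - t) ^+ 2 * kap * `|s| - kap * `|s| ^+ 3) / 3 -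
   x * (u - t + kap * `|s|)) * expR (C * (1 + `|s|)))).
  by rewrite ler_wpM2l ?expR_ge0 // hC.
rewrite -expRD ler_expR.
have r0 := normr_ge0 s; set r := `|s| in r0 *.
have hv : `|u - t| <= V.
  move: uI => /andP[Au ua]; rewrite /V.
  rewrite ler_norml; apply/andP; split.
    have := ler_norm (- A); rewrite normrN; have := ler_norm t; have := normr_ge0 a; lra.
  have := ler_norm a; have := ler_norm (- t); rewrite normrN; have := normr_ge0 A; lra.
set v := u - t in hv *.
have v3 : v ^+ 3 <= V ^+ 3.
  by apply: (le_trans (ler_norm _)); rewrite normrX lerXn2r ?nnegrE.
have v2 : v ^+ 2 <= V ^+ 2.
  by apply: (le_trans (ler_norm _)); rewrite normrX lerXn2r ?nnegrE.
have xv : - (x * v) <= `|x| * V.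
  by apply: (le_trans (ler_norm _)); rewrite normrN normrM ler_wpM2l.
have xr : - (x * (kap * r)) <= `|x| * r.
  apply: (le_trans (ler_norm _)); rewrite normrN normrM ler_wpM2l //.
  by rewrite ger0_norm ?mulr_ge0 ?(ltW kp0) // ler_piMl // ltW.
have v2r : v ^+ 2 * kap * r <= V ^+ 2 * r.
  rewrite ler_wpM2r // -[leRHS]mulr1 ler_pM ?sqr_ge0 // ltW //.
have kr : r ^+ 3 / 6 <= kap * r ^+ 3 / 3.
  have r3 : 0 <= r ^+ 3 by rewrite exprn_ge0.
  by have := ler_wpM2r r3 (ltW kp2); lra.
have V3 : 0 <= V ^+ 3 by rewrite exprn_ge0.
have := hc r r0; lra.
Qed.

Lemma hol_Gn q a A t x n : admissible q -> aok q a -> hol (strip A a) (Gn q t x n).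
Proof. by move=> hq ha; apply: holM; [exact: hol_gexp|exact: hol_Phin]. Qed.

Lemma Im_Gm (a s : R) : s != 0 -> Im (Gm a s) != 0.
Proof. by move=> s0; rewrite /= mulf_neq0 // gt_eqF // kap_gt0. Qed.

Lemma Gi_cvg q a t x s : admissible q -> s != 0 ->
  ccvg (fun n => Gn q t x n (Gm a s)) (Gi q t x (Gm a s)).
Proof. by move=> hq s0; apply: ccvgZ; apply: Phin_cvg => //; exact: Im_Gm. Qed.

Lemma Gn_cmeas q a t x n : admissible q -> aok q a ->
  cmeas setT (fun s => Gn q t x n (Gm a s)).
Proof.
by move=> hq ha; have [dG [m _ _]] := hol_Gn a t x n hq ha; apply: m; exact: cmeas_Gm.
Qed.

Lemma cmeas_off0 (f g : R -> R[i]) : cmeas setT f -> (forall s, s != 0 -> f s = g s) ->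
  cmeas setT g.
Proof.
move=> [m1 m2] fg; split.
- by apply: (Rintegral_eq_off (s := [:: 0]) m1 _).1 => s; rewrite inE => s0; rewrite fg.
- by apply: (Rintegral_eq_off (s := [:: 0]) m2 _).1 => s; rewrite inE => s0; rewrite fg.
Qed.

Lemma Gi_decay q a t x k : admissible q -> aok q a -> 0 <= k ->
  exists2 C, 0 <= C & cmeas setT (fun s => Gi q t x (Gm a s)) /\
    forall s, nm (Gi q t x (Gm a s)) <= C * expR (- (k * `|s|)).
Proof.
move=> hq ha k0; have [C C0 hC] := Gn_decay a t x hq ha k0.
(* At the real vertex no convergence of the product is established; adding the single value there
   covers [s = 0]. *)
exists (C + nm (Gi q t x (Gm a 0))); first by rewrite addr_ge0 ?nm_ge0.
split.
  have mz : measurable_fun setT (fun s : R => s == 0).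
    exact: (measurable_fun_eqr (@measurable_id _ _ setT) (@measurable_cst _ _ _ _ setT (0 : R))).
  apply: (@cmeas_off0 (fun s : R => if ~~ (s == 0) then Gi q t x (Gm a s) else 0)); last first.
    by move=> s ->.
  apply: (@cmeas_cvg R _ _ setT (fun n (s : R) => if ~~ (s == 0) then Gn q t x n (Gm a s) else 0)).
  - by move=> n; apply: cmeas_if; [exact: measurable_neg|exact: Gn_cmeas].
  - move=> s _; case: ifPn => s0; [exact: (Gi_cvg a t x hq s0).1|exact: cvg_cst].
  - move=> s _; case: ifPn => s0; [exact: (Gi_cvg a t x hq s0).2|exact: cvg_cst].
move=> s; have [->|s0] := eqVneq s 0.
  by rewrite normr0 mulr0 oppr0 expR0 mulr1 lerDr.
apply: (@le_trans _ _ (C * expR (- (k * `|s|)))); last first.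
  by rewrite ler_wpM2r ?expR_ge0 // lerDl nm_ge0.
have [c1 c2] := Gi_cvg a t x hq s0.
have c : nm (Gn q t x n (Gm a s)) @[n --> \oo] --> nm (Gi q t x (Gm a s)).
  exact: cvg_nm c1 c2.
have cv : cvgn (fun n => nm (Gn q t x n (Gm a s))) by apply/cvg_ex; eexists; exact: c.
rewrite -(cvg_lim (@Rhausdorff R) c); apply: limr_le => //.
by near=> n; apply: hC; rewrite lexx.
Unshelve. all: by end_near. Qed.

End PhiAnalysis.

(** * Continuity of integrals in exponential parameters *)

Section ExponentialParameter.
Context {R : realType}.
Local Notation Re := (@complex.Re R).

Lemma nm_cexpB (Z W : R[i]) (M : R) : Re Z <= M -> Re W <= M ->
  nm (cexp Z - cexp W) <= 2 * expR M * nm (Z - W).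
Proof.
move=> ZM WM.
have c z : chol (@cexp R) (@cexp R) z.
  by apply: (chol_ext _ _ (chol_cexp (chol_id z))) => w; rewrite ?mulr1.
apply: (@nm_increment _ _ (@cexp R)) => t; first by move=> _; exact: c.
move=> /andP[t0 t1]; rewrite nm_cexp ler_expR cReD cReM /= mul0r subr0 cReD cReN.
have -> : Re W + t * (Re Z - Re W) = (1 - t) * Re W + t * Re Z by ring.
have -> : M = (1 - t) * M + t * M by ring.
by rewrite lerD // ler_wpM2l // subr_ge0.
Qed.

Lemma ccont_lip (F : R * R -> R[i]) (x0 : R * R) (c : R) :
  (forall x, `|x.1 - x0.1| <= 1 -> `|x.2 - x0.2| <= 1 ->
    nm (F x - F x0) <= c * (`|x.1 - x0.1| + `|x.2 - x0.2|)) ->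
  ccont F x0.
Proof.
move=> lip.
have c0 : 0 <= c.
  have := lip (x0.1 + 1, x0.2); rewrite /= addrAC subrr add0r normr1 subrr normr0 addr0 mulr1.
  by move=> h; apply: le_trans (nm_ge0 _) (h _ _).
have main (phi : R[i] -> R) : (forall z w, `|phi z - phi w| <= nm (z - w)) ->
    (fun x => phi (F x)) @ x0 --> phi (F x0).
  move=> hphi; apply/cvgrPdist_lt => e e0.
  pose d := Num.min 1 (e / (2 * (c + 1))).
  have c1 : 0 < 2 * (c + 1) by rewrite mulr_gt0 // ltr_wpDl.
  have d0 : 0 < d by rewrite lt_min ltr01 divr_gt0.
  have h1 : \forall x \near x0, `|x0.1 - x.1| < d.
    exact: (@cvgr_dist_lt _ _ _ _ _ (fun x : R * R => x.1) x0.1 cvg_fst _ d0).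
  have h2 : \forall x \near x0, `|x0.2 - x.2| < d.
    exact: (@cvgr_dist_lt _ _ _ _ _ (fun x : R * R => x.2) x0.2 cvg_snd _ d0).
  near=> x.
  have k1 : `|x.1 - x0.1| < d by rewrite distrC; near: x; exact: h1.
  have k2 : `|x.2 - x0.2| < d by rewrite distrC; near: x; exact: h2.
  have d1 : d <= 1 by rewrite ge_min lexx.
  have d2 : d <= e / (2 * (c + 1)) by rewrite ge_min lexx orbT.
  rewrite distrC (le_lt_trans (hphi _ _)) //.
  rewrite (le_lt_trans (lip _ (ltW (lt_le_trans k1 d1)) (ltW (lt_le_trans k2 d1)))) //.
  have : 2 * (c + 1) * d <= e by rewrite mulrC -ler_pdivlMr.
  have := ler_wpM2l c0 (ltW k1); have := ler_wpM2l c0 (ltW k2); lra.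
split; apply: main => z w.
- by rewrite -cReN -cReD; exact: nm_Re.
- by rewrite -cImN -cImD; exact: nm_Im.
Unshelve. all: by end_near. Qed.

(** The integral is Lipschitz near [x0]: the exponents differ by at most [del * t s], and
    [t s <= expR (t s)] absorbs this factor by raising the exponential rate from [N] to [N + 1]. *)
Lemma ccont_expint d (T : measurableType d) (mu : {measure set T -> \bar R}) (D : set T)
    (B U V : T -> R[i]) (x0 : R * R) :
  measurable D -> cmeas D B -> cmeas D U -> cmeas D V ->
  (forall M, 0 <= M -> mu.-integrable D
    (EFin \o (fun s => nm (B s) * expR (M * (nm (U s) + nm (V s)))))) ->
  ccont (fun x : R * R =>
    Cintegral mu D (fun s => B s * cexp (x.1%:C * U s + x.2%:C * V s))) x0.
Proof.
move=> mD mB mU mV iB.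
pose N := `|x0.1| + `|x0.2| + 2.
have N0 : 0 <= N by rewrite !addr_ge0.
have N1 : 0 <= N + 1 by rewrite addr_ge0.
pose A (x : R * R) s := x.1%:C * U s + x.2%:C * V s.
have mA x : cmeas D (fun s => B s * cexp (A x s)).
  apply: cmeasM => //; apply: cmeas_cexp.
  by apply: cmeasD; apply: cmeasM => //; exact: cmeas_cst.
pose t s := nm (U s) + nm (V s).
have t0 s : 0 <= t s by rewrite addr_ge0 ?nm_ge0.
have nA (x : R * R) s : nm (A x s) <= (`|x.1| + `|x.2|) * t s.
  rewrite /A (le_trans (nmD _ _)) // !nmM !nm_real /t.
  have := nm_ge0 (U s); have := nm_ge0 (V s).
  have := normr_ge0 x.1; have := normr_ge0 x.2; nra.
have ReA (x : R * R) s : `|x.1 - x0.1| <= 1 -> `|x.2 - x0.2| <= 1 -> Re (A x s) <= N * t s.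
  move=> h1 h2; rewrite (le_trans (ler_norm _)) // (le_trans (nm_Re _)) // (le_trans (nA _ _)) //.
  apply: ler_wpM2r => //; rewrite /N.
  have := ler_normD (x.1 - x0.1) x0.1; rewrite subrK.
  have := ler_normD (x.2 - x0.2) x0.2; rewrite subrK; lra.
have x00 : `|x0.1 - x0.1| <= 1 /\ `|x0.2 - x0.2| <= 1 by rewrite !subrr normr0.
have iA (x : R * R) : `|x.1 - x0.1| <= 1 -> `|x.2 - x0.2| <= 1 ->
    Cintegrable mu D (fun s => B s * cexp (A x s)).
  move=> h1 h2; apply: (@cintegrable_dom _ _ _ mu D mD _
    (fun s => nm (B s) * expR (N * (nm (U s) + nm (V s))))); [exact: mA| |exact: iB].
  by move=> s _; rewrite nmM nm_cexp ler_wpM2l ?nm_ge0 // ler_expR ReA.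
apply: (@ccont_lip _ _ (2 * \int[mu]_(s in D)
   (2 * (nm (B s) * expR ((N + 1) * (nm (U s) + nm (V s))))))) => x h1 h2.
set del := `|x.1 - x0.1| + `|x.2 - x0.2|.
have del0 : 0 <= del by rewrite addr_ge0.
rewrite -(CintegralB mD (iA x h1 h2) (iA x0 x00.1 x00.2)).
have iB2 : mu.-integrable D (EFin \o (fun s => 2 * (nm (B s) * expR ((N + 1) * (nm (U s) + nm (V s)))))).
  by apply: (rintegrableZ mD); exact: iB.
rewrite -mulrA [X in _ * X]mulrC -RintegralZl //.
apply: nm_Cintegral => //.
- by apply: cmeasB; exact: mA.
- move=> s _; rewrite -mulrBr nmM.
  have hA : nm (A x s - A x0 s) <= del * t s.
    have -> : A x s - A x0 s = A (x.1 - x0.1, x.2 - x0.2) s.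
      by rewrite /A /= !rmorphB; ring.
    exact: nA.
  have hE : nm (cexp (A x s) - cexp (A x0 s)) <= del * (2 * expR ((N + 1) * t s)).
    rewrite (le_trans (nm_cexpB (ReA x s h1 h2) (ReA x0 s x00.1 x00.2))) //.
    have e0 : 0 <= 2 * expR (N * t s) by rewrite mulr_ge0 ?expR_ge0.
    apply: (le_trans (ler_wpM2l e0 hA)).
    have te : t s <= expR (t s) by apply: le_trans (expR_ge1Dx _); rewrite lerDr.
    have -> : (N + 1) * t s = N * t s + t s by ring.
    rewrite expRD.
    have := ler_wpM2l (mulr_ge0 e0 del0) te.
    have -> : 2 * expR (N * t s) * (del * t s) = 2 * expR (N * t s) * del * t s by ring.
    by move=> /le_trans; apply; rewrite le_eqVlt; apply/orP; left; apply/eqP; ring.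
  apply: (le_trans (ler_wpM2l (nm_ge0 _) hE)).
  by rewrite le_eqVlt; apply/orP; left; apply/eqP; rewrite /t; ring.
- by apply: (rintegrableZ mD); exact: iB2.
Qed.

End ExponentialParameter.

(** * The kernel *)

Section Deformation.
Context {R : realType}.
Local Notation TR := (measurableTypeR R).
Implicit Types (q : params R) (G : R[i] -> R[i]).

Lemma Sint_cvg (F1 F2 : nat -> R[i] -> R[i]) G1 G2 a b C1 C2 C1' C2' :
  (forall n, decay (F1 n) a C1) -> (forall n, decay (F2 n) b C2) ->
  decay G1 a C1' -> decay G2 b C2' ->
  (forall s, s != 0 -> ccvg (fun n => F1 n (Gm a s)) (G1 (Gm a s))) ->
  (forall s, s != 0 -> ccvg (fun n => F2 n (Gm b s)) (G2 (Gm b s))) ->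
  ccvg (fun n => Sint (F1 n) a (F2 n) b) (Sint G1 a G2 b).
Proof.
move=> d1 d2 d1' d2' c1 c2.
have cv z : z.1 != 0 -> z.2 != 0 ->
    ccvg (fun n => pullS (F1 n) a (F2 n) b z) (pullS G1 a G2 b z).
  move=> z1 z2; apply: ccvgM; last exact: ccvg_cst.
  by apply: ccvgM; apply: ccvgM; [exact: c1|exact: ccvg_cst|exact: c2|exact: ccvg_cst].
apply: (@Cintegral_dct _ _ _ (leb2 R) setT measurableT _ _ (fun s => C1 * C2 * (2 * dom2 a b s))).
- by move=> n; exact: pullS_cmeas (d1 n) (d2 n).
- exact: pullS_cmeas d1' d2'.
- apply: (@ae_off_lines R [:: 0] [:: 0]) => z; rewrite !inE => z1 z2 _; exact: (cv z z1 z2).1.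
- apply: (@ae_off_lines R [:: 0] [:: 0]) => z; rewrite !inE => z1 z2 _; exact: (cv z z1 z2).2.
- apply: (@ae_off_lines R (exc a b) (exc a b)) => z z1 z2 n _.
  exact: pullS_bound (d1 n) (d2 n) z1 z2.
- apply: (@rintegrableZ _ _ _ (leb2 R) _ measurableT _ (fun s => 2 * dom2 a b s)).
  apply: (@rintegrableZ _ _ _ (leb2 R) _ measurableT _ (dom2 a b)).
  exact: integrable_dom2.
Qed.

Lemma decay_Gn q a A t x : admissible q -> aok q a ->
  exists C, forall n u, A <= u <= a -> decay (Gn q t x n) u C.
Proof.
move=> hq ha; have [C _ hC] := Gn_decay A t x hq ha ler01.
exists C => n u uI; have /andP[_ ua] := uI; split.
  exact: Gn_cmeas hq (aok_le hq ua ha).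
by move=> s; rewrite -[`|s|]mul1r; exact: hC.
Qed.

Lemma decay_Gi q a t x : admissible q -> aok q a -> exists C, decay (Gi q t x) a C.
Proof.
move=> hq ha; have [C _ [m hC]] := Gi_decay t x hq ha ler01.
by exists C; split=> // s; rewrite -[`|s|]mul1r; exact: hC.
Qed.

(* [Gi q t x (- W) * Gi (swap q) t' x' W], with the cancelling factors Phi dropped. *)
Definition Ecross (t x t' x' : R) (W : R[i]) : R[i] := gexp t x (- W) * gexp t' x' W.

Lemma hol_Ecross D t x t' x' : hol D (Ecross t x t' x').
Proof.
apply: holM; last exact: hol_gexp.
have h : hol D (fun Z : R[i] => - Z - t%:C).
  by apply: holB; [apply: holN; exact: hol_id|exact: hol_cst].
apply: hol_cexp; apply: holB; last by apply: holM => //; exact: hol_cst.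
by apply: holM; [exact: holX|exact: hol_cst].
Qed.

Lemma Gn_cross q a b t x t' x' n s : admissible q -> aok q a -> aok (swap q) b ->
  rho (- Gm b s) <= a ->
  Gn q t x n (- Gm b s) * Gn (swap q) t' x' n (Gm b s) = Ecross t x t' x' (Gm b s).
Proof.
move=> hq ha hb ra; rewrite /Gn mulrACA.
have zE := Gm_rho (- Gm b s).
have -> : Phin q n (- Gm b s) * Phin (swap q) n (Gm b s) = 1.
  rewrite -[X in Phin (swap q) n X]opprK; apply: Phin_swap => i.
  - by rewrite -zE; exact: (den_neq0 hq ha).
  - by rewrite -zE; exact: (den2_neq0 hq ha).
  - by rewrite mulrN; exact: (den_neq0 (admissible_swap hq) hb).
  - by rewrite invrN mulrN; exact: (den2_neq0 (admissible_swap hq) hb).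
by rewrite mulr1.
Qed.

Lemma Ttot_shift q a a' b t x t' x' : admissible q -> aok q a' -> aok (swap q) b -> a <= a' ->
  Ttot (Gi q t x) a (Gi (swap q) t' x') b (Ecross t x t' x') =
  Ttot (Gi q t x) a' (Gi (swap q) t' x') b (Ecross t x t' x').
Proof.
move=> hq ha' hb aa'; have hq' := admissible_swap hq; have ha := aok_le hq aa' ha'.
have hE := @hol_Ecross setT t x t' x'.
have [C1 d1] := decay_Gn a t x hq ha'.
have [C2 d2] := decay_Gn b t' x' hq' hb.
have d2b n : decay (Gn (swap q) t' x' n) b C2 by apply: d2; rewrite lexx.
have [C2' d2'] := decay_Gi t' x' hq' hb.
have c u : a <= u <= a' -> ccvg (fun n => Ttot (Gn q t x n) u (Gn (swap q) t' x' n) b (Ecross t x t' x'))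
    (Ttot (Gi q t x) u (Gi (swap q) t' x') b (Ecross t x t' x')).
  move=> uI; have /andP[_ ua] := uI.
  have [C1' d1'] := decay_Gi t x hq (aok_le hq ua ha').
  (* [Ecross] is free of the partial products, so only [Sint] varies with [n]. *)
  apply: ccvgD; first exact: ccvg_cst.
  apply: ccvgZ; apply: (Sint_cvg (fun n => d1 n u uI) d2b d1' d2') => s s0.
    exact: Gi_cvg.
  exact: Gi_cvg.
have aI : a <= a <= a' by rewrite lexx.
have aI' : a <= a' <= a' by rewrite lexx aa'.
apply: (ccvg_unique (c _ aI) (ccvg_near _ (c _ aI'))); apply: nearW => n; apply/esym.
apply: (Ttot_move aa' _ _ (d2b n) hE).
- exact: hol_Gn.
- by move=> u uI s; have [_ h] := d1 n u uI; exact: h.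
- by move=> s /andP[_ /ltW r]; exact: (Gn_cross t x t' x' n hq ha' hb r).
Qed.

Lemma swapK q : swap (swap q) = q. Proof. by case: q. Qed.

Lemma Ttot_indep q a a' b b' t x t' x' : admissible q ->
  aok q a -> aok q a' -> aok (swap q) b -> aok (swap q) b' ->
  Ttot (Gi q t x) a (Gi (swap q) t' x') b (Ecross t x t' x') =
  Ttot (Gi q t x) a' (Gi (swap q) t' x') b' (Ecross t x t' x').
Proof.
have A q1 u u' v y z y' z' : admissible q1 -> aok q1 u -> aok q1 u' -> aok (swap q1) v ->
    Ttot (Gi q1 y z) u (Gi (swap q1) y' z') v (Ecross y z y' z') =
    Ttot (Gi q1 y z) u' (Gi (swap q1) y' z') v (Ecross y z y' z').
  by move=> h1 h2 h3 h4; have [uu|/ltW uu] := leP u u'; [|apply/esym]; exact: Ttot_shift.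
move=> hq ha ha' hb hb'; rewrite (A q a a' b t x t' x' hq ha ha' hb).
have hq' := admissible_swap hq.
have EN : (fun z => Ecross t x t' x' (- z)) = Ecross t' x' t x.
  by apply/funext => z; rewrite /Ecross opprK mulrC.
have S v : aok (swap q) v -> Ttot (Gi q t x) a' (Gi (swap q) t' x') v (Ecross t x t' x') =
    Ttot (Gi (swap q) t' x') v (Gi (swap (swap q)) t x) a' (Ecross t' x' t x).
  move=> hv; have [C1 d1] := decay_Gi t x hq ha'; have [C2 d2] := decay_Gi t' x' hq' hv.
  by rewrite (Ttot_swap d1 d2 (hol_Ecross _ _ _ _ _)) EN swapK.
by rewrite (S b hb) (S b' hb') (A _ b b' a' _ _ _ _ hq' hb hb') // swapK.
Qed.

End Deformation.

(** * The contours and integrands of the definition *)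

Section Contours.
Context {R : realType}.
Local Notation Re := (@complex.Re R).
Local Notation Im := (@complex.Im R).
Local Notation kap := (@kap R).
Implicit Types (q : params R).

Let cos_pi4 : cos (pi / 4 : R) = kap. Proof. by []. Qed.

Lemma cos_3pi4 : cos (3 * pi / 4 : R) = - kap.
Proof.
have -> : 3 * pi / 4 = - (pi / 4) + pi :> R by field.
by rewrite cosDpi cosN.
Qed.

Lemma sin_3pi4 : sin (3 * pi / 4 : R) = kap.
Proof.
have -> : 3 * pi / 4 = - (pi / 4) + pi :> R by field.
by rewrite sinDpi sinN opprK sin_pi4.
Qed.

Lemma cis_sg (th s : R) : (Num.sg s)%:C * cis (Num.sg s * th) =
  (Num.sg s * cos th) +i* (Num.sg s ^+ 2 * sin th).
Proof.
rewrite /cis; have [s0|s0|->] := ltgtP s 0.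
- by rewrite (ltr0_sg s0) mulN1r cosN sinN; apply: complex_eq => /=; ring.
- by rewrite (gtr0_sg s0) (mul1r th); apply: complex_eq => /=; ring.
- by rewrite sgr0; apply: complex_eq => /=; ring.
Qed.

Lemma wedgeE (th a s : R) : wedge th a s = (a + `|s| * cos th) +i* (s * sin th).
Proof.
rewrite /wedge /cis; have [s0|s0|->] := ltgtP s 0.
- by rewrite (ltr0_sg s0) mulN1r cosN sinN ltr0_norm //; apply: complex_eq => /=; ring.
- by rewrite (gtr0_sg s0) (mul1r th) gtr0_norm //; apply: complex_eq => /=; ring.
- by rewrite sgr0 normr0; apply: complex_eq => /=; ring.
Qed.

Lemma Gamma_plusE (a s : R) : Gamma_plus a s = Gm a s.
Proof. by rewrite /Gamma_plus wedgeE sin_pi4 cos_pi4 /Gm; apply: complex_eq => /=; ring. Qed.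

Lemma Gamma_minusE (b s : R) : Gamma_minus b s = - Gm (- b) (- s).
Proof.
rewrite /Gamma_minus wedgeE sin_3pi4 cos_3pi4 /Gm normrN.
by apply: complex_eq => /=; ring.
Qed.

Lemma dGamma_plusE (s : R) : dGamma_plus s = dGm s.
Proof. by rewrite /dGamma_plus /dwedge cis_sg sin_pi4 cos_pi4 /dGm; apply: complex_eq => /=; ring. Qed.

Lemma dGamma_minusE (s : R) : dGamma_minus s = dGm (- s).
Proof.
rewrite /dGamma_minus /dwedge cis_sg sin_3pi4 cos_3pi4 /dGm sgrN.
by apply: complex_eq => /=; ring.
Qed.

Lemma Gm_shift (a t s : R) : Gm a s + t%:C = Gm (a + t) s.
Proof. by apply: complex_eq => /=; ring. Qed.

Lemma K3_pullbackE q (alpha beta t1 x1 t2 x2 : R) (s : R * R) : admissible q ->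
  K3_pullback q alpha beta t1 x1 t2 x2 s =
  pullS (Gi q t1 x1) (alpha + t1) (Gi (swap q) (- t2) x2) (- (beta + t2)) (s.1, - s.2).
Proof.
move=> hq; rewrite /K3_pullback /pullS dGamma_plusE dGamma_minusE /=.
(* At a vertex both sides vanish because [dGm 0 = 0]; elsewhere the argument of [Phi] is not real
   and [Phi_swap] applies. *)
have [->|s10] := eqVneq s.1 0; first by rewrite dGm0 !(mulr0, mul0r).
have [->|s20] := eqVneq s.2 0; first by rewrite oppr0 dGm0 !(mulr0, mul0r).
rewrite /K3_integrand Gamma_plusE Gamma_minusE.
have zE : Gm alpha s.1 = Gm (alpha + t1) s.1 - t1%:C by rewrite -Gm_shift addrK.
have wE : - Gm (- beta) (- s.2) = - Gm (- (beta + t2)) (- s.2) - t2%:C.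
  by apply: complex_eq => /=; ring.
rewrite zE wE !subrK.
set Z := Gm (alpha + t1) s.1; set W := Gm (- (beta + t2)) (- s.2).
have W0 : Im (- W) != 0 by rewrite cImN /= oppr_eq0 mulf_neq0 ?oppr_eq0 // gt_eqF // kap_gt0.
have PW : (Phi q (- W))^-1 = Phi (swap q) W.
  have h := Phi_swap hq W0; rewrite opprK in h.
  have p0 : Phi q (- W) != 0.
    by apply: contraTneq (oner_neq0 (R[i])) => e; rewrite -h e mul0r eqxx.
  by apply: (mulfI p0); rewrite h mulfV.
rewrite PW /Gi /gexp.
have -> : (Z - t1%:C) ^+ 3 / 3 - x1%:C * (Z - t1%:C) - (- W - t2%:C) ^+ 3 / 3 + x2%:C * (- W - t2%:C)
  = ((Z - t1%:C) ^+ 3 / 3 - x1%:C * (Z - t1%:C)) +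
    ((W - (- t2)%:C) ^+ 3 / 3 - x2%:C * (W - (- t2)%:C)).
  by rewrite rmorphN; ring.
rewrite cexpD.
have -> : Z - (- W - t2%:C) - t2%:C = Z + W by ring.
by ring.
Qed.

Lemma K1_integrandE (t1 x1 t2 x2 : R) (w : R[i]) :
  K1_integrand t1 x1 t2 x2 w = Ecross t1 x1 (- t2) x2 (- w).
Proof.
rewrite /K1_integrand /Ecross /gexp opprK -cexpD; congr cexp.
rewrite !(rmorphD, rmorphN, rmorphM, rmorphXn, rmorphB) /= !fmorphV !rmorph_nat.
by field.
Qed.

Section Crossing.
Variables (alpha beta t1 t2 : R).
Let a := alpha + t1.
Let b := - (beta + t2).

(** Membership in the two contours says that |Im z| equals [Re z - a] and [- Re z - b]; these linear
    equations fix [Re z] and |Im z|. The point [p] is unique, so the choice made in [K1] does not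
    matter. *)
Lemma gamma_topP (p : R[i]) :
  gamma_top alpha beta t1 t2 p <-> a + b < 0 /\ p = ((a - b) / 2) +i* hcross a b.
Proof.
have k0 := @kap_gt0 R.
have inI z : (range (Gamma_plus (alpha + t1)) `&` range (Gamma_minus (beta + t2))) z <->
    Re z = (a - b) / 2 /\ `|Im z| = - ((a + b) / 2).
  have IGm x s : `|Im (Gm x s)| = Re (Gm x s) - x.
    by rewrite /= normrM gtr0_norm // addrC addKr.
  split.
    move=> [[s _ zs] [t _ zt]].
    have h1 := IGm a s; rewrite -Gamma_plusE zs in h1.
    have h2 := IGm b (- t); have e2 : Gm b (- t) = - z by rewrite -zt Gamma_minusE opprK.
    rewrite e2 cImN cReN normrN in h2; rewrite h1.
    have : Re z - a = - Re z - b by rewrite -h1.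
    move=> e; split; lra.
  move=> [h1 h2]; split.
    exists (Im z / kap) => //; rewrite Gamma_plusE -/a.
    by rewrite -[RHS]Gm_rho; congr Gm; rewrite /rho h1 h2; field.
  exists (Im z / kap) => //; rewrite Gamma_minusE -/b.
  apply/eqP; rewrite eqr_oppLR; apply/eqP.
  rewrite -[RHS]Gm_rho cImN mulNr; congr Gm.
  by rewrite /rho cReN cImN normrN h1 h2; field.
split.
- move=> [p0 E].
  have : (range (Gamma_plus (alpha + t1)) `&` range (Gamma_minus (beta + t2))) p by rewrite E; left.
  move=> /inI[h1 h2]; have p0' := ltW p0; rewrite gtr0_norm // in h2.
  have ab : a + b < 0 by lra.
  split=> //; apply: complex_eq => //=; rewrite h2 /hcross.
  by apply/esym/max_idPr; lra.
- move=> [ab ->]; have hc : hcross a b = - ((a + b) / 2).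
    by rewrite /hcross; apply/max_idPr; lra.
  split; first by rewrite /= hc; lra.
  apply/seteqP; split=> z.
    move=> /inI[h1 h2]; rewrite hc /=.
    have [z0|z0] := leP 0 (Im z).
      by left; apply: complex_eq => //=; rewrite -h2 ger0_norm.
    by right; apply: complex_eq => //=; rewrite -h2 ltr0_norm // opprK.
  move=> [->|->]; apply/inI => /=; rewrite hc; split=> //.
    by rewrite ger0_norm //; lra.
  by rewrite normrN ger0_norm //; lra.
Qed.

Lemma K1E (x1 x2 : R) : K1 alpha beta t1 x1 t2 x2 =
  twoipi^-1 * vcross (Ecross t1 x1 (- t2) x2) a b.
Proof.
rewrite /K1 /vcross; case: pselect => [ex_p|np].
  have [ab pE] := (gamma_topP _).1 (projT2 (cid ex_p)).
  rewrite -/twoipi; congr (_ * _); rewrite {}pE /vsegment_integral /=.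
  rewrite -(vintN ((b - a) / 2) (hcross a b) (hol_Ecross setT t1 x1 (- t2) x2)).
  have -> : - ((b - a) / 2) = (a - b) / 2 by field.
  by congr (_ * _); apply: eq_Cintegral => s _; exact: K1_integrandE.
have [ab|ab] := ltP (a + b) 0.
  by exfalso; apply: np; eexists; apply/gamma_topP; split.
have -> : hcross a b = 0 by rewrite /hcross; apply/max_idPl; lra.
by rewrite vint0 mulr0.
Qed.

End Crossing.

End Contours.

(** * Integrability, independence and continuity of the kernel *)

Section KernelProperties.
Context {R : realType}.
Local Notation leb := (@lebesgue_measure R).
Local Notation TR := (measurableTypeR R).
Variables (q : params R) (hq : admissible q).

Let hq' : admissible (swap q) := admissible_swap hq.

Lemma K_Ttot alpha beta t1 x1 t2 x2 : aok q (alpha + t1) -> aok (swap q) (- (beta + t2)) ->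
  K q alpha beta t1 x1 t2 x2 =
  Ttot (Gi q t1 x1) (alpha + t1) (Gi (swap q) (- t2) x2) (- (beta + t2))
    (Ecross t1 x1 (- t2) x2) + K2 t1 x1 t2 x2.
Proof.
move=> ha hb; have [C1 d1] := decay_Gi t1 x1 hq ha; have [C2 d2] := decay_Gi (- t2) x2 hq' hb.
rewrite /K K1E /K3 (funext (fun s => K3_pullbackE alpha beta t1 x1 t2 x2 s hq)).
by rewrite (pull_opp d1 d2).2 -/twoipi /Ttot addrAC.
Qed.

Lemma K3_integrable alpha beta t1 x1 t2 x2 : aok q (alpha + t1) -> aok (swap q) (- (beta + t2)) ->
  Cintegrable (leb2 R) setT (K3_pullback q alpha beta t1 x1 t2 x2).
Proof.
move=> ha hb; have [C1 d1] := decay_Gi t1 x1 hq ha; have [C2 d2] := decay_Gi (- t2) x2 hq' hb.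
rewrite (funext (fun s => K3_pullbackE alpha beta t1 x1 t2 x2 s hq)).
exact: (pull_opp d1 d2).1.
Qed.

(** The weight is the one that [ccont_expint] asks for. Since the modulus of [Gm (a - t) s] is at
    most [|a - t| + 2 * |s|], decay of [Gi] at rate [1 + 2 * M] leaves rate 1. *)
Lemma decay_Gi_exp (q1 : params R) (a t M : R) : admissible q1 -> aok q1 a -> 0 <= M ->
  exists C, decay (fun Z => Gi q1 t 0 Z * (expR (M * nm (Z - t%:C)))%:C) a C.
Proof.
move=> h1 ha M0; have k0 : 0 <= 1 + 2 * M by rewrite addr_ge0 // mulr_ge0.
have [C C0 [m hC]] := Gi_decay t 0 h1 ha k0.
exists (C * expR (M * `|a - t|)); split.
  apply: cmeasM => //; apply: cmeas_real; apply: (measurableT_comp (@measurable_expR R)).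
  apply: measurable_funM; first exact: measurable_cst.
  by apply: measurable_nm; apply: cmeasB; [exact: cmeas_Gm|exact: cmeas_cst].
move=> s; rewrite nmM nm_real ger0_norm ?expR_ge0 //.
have -> : Gm a s - t%:C = Gm (a - t) s by rewrite -Gm_shift rmorphN.
apply: (@le_trans _ _ (C * expR (- ((1 + 2 * M) * `|s|)) * expR (M * (`|a - t| + 2 * `|s|)))).
  apply: ler_pM; rewrite ?nm_ge0 ?expR_ge0 // ler_expR ler_wpM2l //; exact: nm_Gm_le.
rewrite -!mulrA -!expRD le_eqVlt; apply/orP; left; apply/eqP; congr (_ * expR _); ring.
Qed.

Lemma K3_ccont alpha beta t1 t2 (x : R * R) : aok q (alpha + t1) -> aok (swap q) (- (beta + t2)) ->
  ccont (fun x : R * R => K3 q alpha beta t1 x.1 t2 x.2) x.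
Proof.
move=> ha hb; apply: ccontM; first exact: ccont_cst.
pose U (s : R * R) := - Gm alpha s.1; pose V (s : R * R) := - Gm (- beta) (- s.2).
pose B := K3_pullback q alpha beta t1 0 t2 0.
have E (y : R * R) : K3_pullback q alpha beta t1 y.1 t2 y.2 =
    fun s => B s * cexp (y.1%:C * U s + y.2%:C * V s).
  apply/funext => s; rewrite /B /K3_pullback /K3_integrand.
  rewrite /U /V -Gamma_minusE -Gamma_plusE.
  set z := Gamma_plus _ _; set w := Gamma_minus _ _.
  have -> : z ^+ 3 / 3 - y.1%:C * z - w ^+ 3 / 3 + y.2%:C * w =
    (z ^+ 3 / 3 - 0%:C * z - w ^+ 3 / 3 + 0%:C * w) + (y.1%:C * - z + y.2%:C * w) by ring.
  by rewrite cexpD; ring.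
under [X in ccont X]eq_fun do rewrite E.
have f1 : measurable_fun setT (fst : TR * TR -> TR) by exact: measurable_fst.
have f2 : measurable_fun setT (fun s : TR * TR => - s.2 : TR).
  by apply: measurable_funN; exact: measurable_snd.
apply: ccont_expint; first exact: measurableT.
- exact: cintegrable_cmeas (K3_integrable 0 0 ha hb).
- by apply: cmeasN; exact: (cmeas_comp (cmeas_Gm alpha) f1).
- by apply: cmeasN; exact: (cmeas_comp (cmeas_Gm (- beta)) f2).
move=> M M0.
have [C1 d1] := decay_Gi_exp t1 hq ha M0.
have [C2 d2] := decay_Gi_exp (- t2) hq' hb M0.
(* The majorant is exactly the modulus of [pullS] for the weighted factors, whose integrability
   [pull_opp] provides. *)
have := rintegrable_nm measurableT (pull_opp d1 d2).1; congr (_.-integrable _ _).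
apply/funext => s; congr (_%:E).
rewrite /B K3_pullbackE // /U /V !nmN /pullS [(_, _).1]/= [(_, _).2]/=; cbv beta.
rewrite mulrDr expRD.
have -> : Gm (alpha + t1) s.1 - t1%:C = Gm alpha s.1 by rewrite -Gm_shift addrK.
have -> : Gm (- (beta + t2)) (- s.2) - (- t2)%:C = Gm (- beta) (- s.2).
  by rewrite opprD -Gm_shift addrK.
by rewrite !nmM !nm_real !(ger0_norm (expR_ge0 _)); ring.
Qed.

Lemma K1_ccont alpha beta t1 t2 (x : R * R) :
  ccont (fun x : R * R => K1 alpha beta t1 x.1 t2 x.2) x.
Proof.
under [X in ccont X]eq_fun do rewrite K1E /vcross /vint.
set m := _ / 2; set h := hcross _ _.
apply: ccontM; first exact: ccont_cst.
apply: ccontM; first exact: ccont_cst.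
pose U (s : R) : R[i] := (m +i* s) + t1%:C; pose V (s : R) : R[i] := (- t2)%:C - (m +i* s).
pose B s := Ecross t1 0 (- t2) 0 (m +i* s).
have E (y : R * R) : (fun s => Ecross t1 y.1 (- t2) y.2 (m +i* s)) =
    fun s => B s * cexp (y.1%:C * U s + y.2%:C * V s).
  apply/funext => s; rewrite /B /Ecross /gexp /U /V -!cexpD; congr cexp; ring.
under [X in ccont X]eq_fun do rewrite E.
have cB s : ccont B s by apply: ccont_hol (ccont_vert m s); exact: hol_Ecross.
have cU s : ccont U s by apply: ccontD; [exact: ccont_vert|exact: ccont_cst].
have cV s : ccont V s.
  apply: ccontD; first exact: ccont_cst.
  by under [X in ccont X]eq_fun do rewrite -mulN1r; apply: ccontM; [exact: ccont_cst|exact: ccont_vert].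
apply: (@ccont_expint _ _ TR leb).
- exact: measurable_itv.
- by apply: (@cintegrable_cmeas _ _ _ leb); exact: cintegrable_cont.
- by apply: (@cintegrable_cmeas _ _ _ leb); exact: cintegrable_cont.
- by apply: (@cintegrable_cmeas _ _ _ leb); exact: cintegrable_cont.
move=> M _; apply: rintegrable_continuous => s _; apply: cvgM; first exact: cvg_nm (cB s).1 (cB s).2.
apply: continuous_cvg; first exact: continuous_expR.
apply: cvgM; first exact: cvg_cst.
by apply: cvgD; [exact: cvg_nm (cU s).1 (cU s).2|exact: cvg_nm (cV s).1 (cV s).2].
Qed.

Lemma K2_ccont t1 t2 (x : R * R) : ccont (fun x : R * R => K2 t1 x.1 t2 x.2) x.
Proof.
apply: ccont_real; case: ifP => _; last exact: cvg_cst.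
have c1 : (fun y : R * R => y.1) @ x --> x.1 by exact: cvg_fst.
have c2 : (fun y : R * R => y.2) @ x --> x.2 by exact: cvg_snd.
apply: cvgN; apply: cvgM; first exact: cvg_cst.
apply: continuous_cvg; first exact: continuous_expR.
apply: cvgD; last exact: cvg_cst.
apply: cvgB.
- apply: cvgN; apply: cvgM; last exact: cvg_cst.
  by apply: cvgM; apply: cvgB.
- apply: cvgM; last exact: cvg_cst.
  by apply: cvgM; [exact: cvg_cst|apply: cvgD].
Qed.

End KernelProperties.

Theorem lemma1p4 (R : realType) (q : params R) (hq : admissible q) :
  [/\ (forall t1 t2 x1 x2 alpha beta : R,
         ((alpha + t1)%:E < a_low q)%E -> (b_low q < (beta + t2)%:E)%E ->
         Cintegrable (leb2 R) setT (K3_pullback q alpha beta t1 x1 t2 x2)),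
      (forall t1 t2 x1 x2 alpha beta alpha' beta' : R,
         ((alpha + t1)%:E < a_low q)%E -> (b_low q < (beta + t2)%:E)%E ->
         ((alpha' + t1)%:E < a_low q)%E -> (b_low q < (beta' + t2)%:E)%E ->
         K q alpha beta t1 x1 t2 x2 = K q alpha' beta' t1 x1 t2 x2)
    & (forall t1 t2 alpha beta : R,
         ((alpha + t1)%:E < a_low q)%E -> (b_low q < (beta + t2)%:E)%E ->
         continuous (fun x : R * R => K q alpha beta t1 x.1 t2 x.2 : R[i]^o))].
Proof.
split.
- by move=> t1 t2 x1 x2 al be /(a_low_ok hq) ha /(b_low_ok hq) hb; exact: K3_integrable.
- move=> t1 t2 x1 x2 al be al' be' /(a_low_ok hq) ha /(b_low_ok hq) hb
    /(a_low_ok hq) ha' /(b_low_ok hq) hb'.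
  rewrite (K_Ttot hq _ _ ha hb) (K_Ttot hq _ _ ha' hb').
  by rewrite (Ttot_indep t1 x1 (- t2) x2 hq ha ha' hb hb').
- move=> t1 t2 al be /(a_low_ok hq) ha /(b_low_ok hq) hb x.
  have [c1 c2] : ccont (fun x : R * R => K q al be t1 x.1 t2 x.2) x.
    apply: ccontD; last exact: K3_ccont.
    by apply: ccontD; [exact: K1_ccont|exact: K2_ccont].
  exact: cvg_complex.
Qed.
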